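(* The space $(S_0(\mathbb{R}^d),\|\cdot\|_{S_0})$ is a Banach space. It is isometrically invariant under the Fourier transform and under time-frequency shifts, i.e. for all $f\in S_0(\mathbb{R}^d)$ and all $x,\omega\in\mathbb{R}^d$ one has $\hat f\in S_0(\mathbb{R}^d)$ with $\|\hat f\|_{S_0}=\|f\|_{S_0}$, and $E_\omega T_x f\in S_0(\mathbb{R}^d)$ with $\|E_\omega T_x f\|_{S_0}=\|f\|_{S_0}$. Moreover, it is a Banach algebra under convolution as well as under pointwise multiplication.
   Context: $C_b(\mathbb{R}^d)$ is the space of bounded continuous functions $\mathbb{R}^d\to\mathbb{C}$ with norm $\|f\|_\infty=\sup_t|f(t)|$. Let $\Delta(t)=\prod_{j=1}^d\max(1-2|t^{(j)}|,0)$ for $t=(t^{(1)},\dots,t^{(d)})\in\mathbb{R}^d$, and $\psi_n(t)=\Delta(t-\tfrac12 n)$ for $n\in\mathbb{Z}^d$. The Wiener algebra $W(\mathbb{R}^d)$ is the space of all $f\in C_b(\mathbb{R}^d)$ with $\|f\|_W=\sum_{n\in\mathbb{Z}^d}\|f\cdot\psi_n\|_\infty<\infty$ (and likewise on $\mathbb{R}^{2d}$); such functions are integrable. $T_xf(t)=f(t-x)$, $E_\omega f(t)=e^{2\pi i\omega\cdot t}f(t)$, $\hat f(s)=\int_{\mathbb{R}^d}f(t)e^{-2\pi i s\cdot t}\,dt$, and $(f*g)(t)=\int_{\mathbb{R}^d}f(t-s)g(s)\,ds$. Let $g_0(t)=e^{-\pi t\cdot t}$, $t\in\mathbb{R}^d$.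 For $f\in C_b(\mathbb{R}^d)$ the short-time Fourier transform is $\mathcal{V}_{g_0}f(x,\omega)=\int_{\mathbb{R}^d}f(t)\,\overline{g_0(t-x)}\,e^{-2\pi i\omega\cdot t}\,dt$, $x,\omega\in\mathbb{R}^d$. The space $S_0(\mathbb{R}^d)$ consists of all $f\in C_b(\mathbb{R}^d)$ with $\mathcal{V}_{g_0}f\in W(\mathbb{R}^{2d})$, with norm $\|f\|_{S_0}=\int_{\mathbb{R}^{2d}}|\mathcal{V}_{g_0}f(x,\omega)|\,d(x,\omega)$. One has $S_0(\mathbb{R}^d)\subset W(\mathbb{R}^d)$, so the Fourier transform and convolution are defined on $S_0(\mathbb{R}^d)$. A Banach algebra is a Banach space $B$ with a multiplication $\bullet$ satisfying the usual rules and $\|b_1\bullet b_2\|_B\le\|b_1\|_B\|b_2\|_B$ for all $b_1,b_2\in B$ (no unit is required). *)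

(* Defs.v *)
From HB Require Import structures.
From mathcomp Require Import all_boot all_order all_algebra.
From mathcomp Require Import all_classical all_reals all_analysis.
From mathcomp Require Import complex.

Set Implicit Arguments.
Unset Strict Implicit.
Unset Printing Implicit Defensive.

Import Order.TTheory GRing.Theory Num.Theory.
Import numFieldTopology.Exports numFieldNormedType.Exports.

Local Open Scope classical_set_scope.
Local Open Scope ring_scope.
Local Open Scope complex_scope.

(* The sigma-algebra on row vectors generated by the coordinate maps, as for
   n.-tuple T; on 'rV[R]_n this is the Borel sigma-algebra. *)
Section measurable_rV.
Context {d : measure_display} {T : sigmaRingType d}.
Variable n : nat.

Let coord : 'I_n -> 'rV[T]_n -> T := fun i x => x ord0 i.

Let rV_set0 : g_sigma_preimage coord set0.
Proof. exact: sigma_algebra0. Qed.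

Let rV_setC A : g_sigma_preimage coord A -> g_sigma_preimage coord (~` A).
Proof. exact: sigma_algebraC. Qed.

Let rV_bigcup (F : _^nat) : (forall i, g_sigma_preimage coord (F i)) ->
  g_sigma_preimage coord (\bigcup_i (F i)).
Proof. exact: sigma_algebra_bigcup. Qed.

HB.instance Definition _ := @isMeasurable.Build (measure_tuple_display d)
  'rV[T]_n (g_sigma_preimage coord) rV_set0 rV_setC rV_bigcup.

End measurable_rV.

Section lebesgue_rV.
Context {R : realType}.

(* The bijection R^n x R -> R^(n+1), (t, s) |-> (s, t_1, ..., t_n). *)
Definition cons_rV n (p : 'rV[R]_n * R) : 'rV[R]_n.+1 :=
  \row_i (if unlift ord0 i is Some j then p.1 ord0 j else p.2).

Lemma measurable_cons_rV n : measurable_fun [set: 'rV[R]_n * R] (@cons_rV n).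
Proof.
suff H : g_sigma_preimage (fun (i : 'I_n.+1) (x : 'rV[R]_n.+1) => x ord0 i)
    `<=` [set A | measurable (@cons_rV n @^-1` A)].
  by move=> _ A mA; rewrite setTI; exact: H.
apply: smallest_sub.
  split => /= [|A mA|F mF].
  - by rewrite preimage_set0.
  - by rewrite setTD -preimage_setC; exact: measurableC.
  - by rewrite preimage_bigcup; exact: bigcup_measurable.
rewrite -bigcup_mkord_ord; apply: bigcup_sub => i _ _ [B mB <-] /=.
rewrite setTI -comp_preimage -[_ @^-1` _]setTI.
suff : measurable_fun setT (fun p : 'rV[R]_n * R => cons_rV p ord0 (inord i)).
  by apply.
case: (unliftP ord0 (inord i : 'I_n.+1)) => [j|] ->.
  rewrite (_ : (fun _ => _) = (fun x : 'rV[R]_n => x ord0 j) \o fst).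
    apply: measurableT_comp => //.
    move=> _ Y mY; rewrite setTI; apply: sub_sigma_algebra => /=.
    rewrite -bigcup_seq/=; exists j => /=; first by rewrite mem_index_enum.
    by exists Y => //; rewrite setTI.
  by apply/funext => p; rewrite /= mxE liftK.
rewrite (_ : (fun _ => _) = snd) //.
by apply/funext => p; rewrite /= mxE unlift_none.
Qed.


Definition lebesgue_cons n (mu : {measure set 'rV[R]_n -> \bar R}) :
    set 'rV[R]_n.+1 -> \bar R :=
  pushforward (mu \x (@lebesgue_measure R))%E (@cons_rV n).

HB.instance Definition _ n (mu : {measure set 'rV[R]_n -> \bar R}) :=
  Measure.copy (lebesgue_cons mu)
    (measure_function_pushforward__canonical__measure_function_Measure
       (mu \x (@lebesgue_measure R))%E (@measurable_cons_rV n)).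

(* Lebesgue measure on R^n, as the iterated product of the one on R. *)
Fixpoint lebesgue_rV n : {measure set 'rV[R]_n -> \bar R} :=
  if n is m.+1 then lebesgue_cons (lebesgue_rV m) else \d_(0 : 'rV[R]_0).

End lebesgue_rV.
Arguments lebesgue_rV R n : clear implicits.

Section integral.
Context {R : realType}.

Definition cintegral n (f : 'rV[R]_n -> R[i]) : R[i] :=
  (\int[lebesgue_rV R n]_t complex.Re (f t)) +i*
  (\int[lebesgue_rV R n]_t complex.Im (f t)).

End integral.

Section function_spaces.
Context {R : realType}.
Local Notation normc := Normc.normc.

Definition supnorm n (f : 'rV[R]_n -> R[i]) : \bar R :=
  ereal_sup [set (normc (f t))%:E | t in [set: 'rV[R]_n]].

(* [R[i]^o] carries the topology of the complex plane, [R[i]] does not. *)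
Definition Cb n : set ('rV[R]_n -> R[i]) :=
  [set f | continuous (f : 'rV[R]_n -> R[i]^o) /\ (supnorm f < +oo)%E].

Definition tent n (t : 'rV[R]_n) : R :=
  \prod_(j < n) Num.max (1 - 2 * `|t ord0 j|) 0.

Definition psi n (k : 'rV[int]_n) (t : 'rV[R]_n) : R :=
  tent (t - 2^-1 *: map_mx intr k).

Definition wiener_norm n (f : 'rV[R]_n -> R[i]) : \bar R :=
  (\esum_(k in [set: 'rV[int]_n]) supnorm (fun t => (f t * (psi k t)%:C)%R))%E.

Definition wiener n : set ('rV[R]_n -> R[i]) :=
  [set f | Cb f /\ (wiener_norm f < +oo)%E].

Definition dot n (s t : 'rV[R]_n) : R := \sum_(j < n) s ord0 j * t ord0 j.

(* [cis a] is e^(2 pi i a). *)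
Definition cis (a : R) : R[i] := cos (2 * pi * a) +i* sin (2 * pi * a).

Definition translation n (x : 'rV[R]_n) (f : 'rV[R]_n -> R[i]) :
    'rV[R]_n -> R[i] :=
  fun t => f (t - x).

Definition modulation n (w : 'rV[R]_n) (f : 'rV[R]_n -> R[i]) :
    'rV[R]_n -> R[i] :=
  fun t => cis (dot w t) * f t.

Definition fourier n (f : 'rV[R]_n -> R[i]) : 'rV[R]_n -> R[i] :=
  fun s => cintegral (fun t => f t * cis (- dot s t)).

Definition convolution n (f g : 'rV[R]_n -> R[i]) : 'rV[R]_n -> R[i] :=
  fun t => cintegral (fun s => f (t - s) * g s).

Definition pointwise_mul n (f g : 'rV[R]_n -> R[i]) : 'rV[R]_n -> R[i] :=
  fun t => f t * g t.

Definition gauss n (t : 'rV[R]_n) : R[i] := (expR (- (pi * dot t t)))%:C.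

Definition stft n (g f : 'rV[R]_n -> R[i]) (x w : 'rV[R]_n) : R[i] :=
  cintegral (fun t => f t * conjc (g (t - x)) * cis (- dot w t)).

(* The short-time Fourier transform with Gaussian window, as a function on
   R^2n; the point z is the pair (x, w) = (lsubmx z, rsubmx z). *)
Definition gauss_stft n (f : 'rV[R]_n -> R[i]) (z : 'rV[R]_(n + n)) : R[i] :=
  stft (@gauss n) f (lsubmx z) (rsubmx z).

Definition S0 n : set ('rV[R]_n -> R[i]) :=
  [set f | Cb f /\ wiener (gauss_stft f)].

Definition S0_norm n (f : 'rV[R]_n -> R[i]) : \bar R :=
  (\int[lebesgue_rV R (n + n)]_z (normc (gauss_stft f z))%:E)%E.

End function_spaces.

Section banach.
Context {R : realType}.
Implicit Types (V : lmodType R[i]).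

(* The subset E of V, with the function N, is a complex Banach space for the
   vector space operations of V. N is extended-real-valued so that its
   finiteness on E is part of the assertion. The norm of a normed module over
   R[i] is R[i]-valued (with real values), whence the Re. *)
Definition is_banach_space V (E : set V) (N : V -> \bar R) : Prop :=
  exists (B : completeNormedModType R[i]) (iota : {linear B -> V}),
    [/\ injective iota, range iota = E &
        forall b, N (iota b) = (complex.Re `|b|)%:E].

Definition is_banach_algebra V (E : set V) (N : V -> \bar R)
    (mul : V -> V -> V) : Prop :=
  [/\ is_banach_space E N,
      forall f g, E f -> E g -> E (mul f g),
      forall f g h, E f -> E g -> E h -> mul f (mul g h) = mul (mul f g) h,
      forall (a : R[i]) f g h, E f -> E g -> E h ->
        mul (a *: f + g) h = a *: mul f h + mul g h /\
        mul h (a *: f + g) = a *: mul h f + mul h g &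
      forall f g, E f -> E g -> (N (mul f g) <= N f * N g)%E].

End banach.

(* Main.v *)
(* Write F for the Gaussian short-time Fourier transform of f. Fourier
   inversion of f(t) g0(t - x) for fixed x gives the pointwise bounds
   |f| <= ||f||_S0 and int |f| <= ||f||_S0, and, after integrating against
   g0(t - x), a formula for f in terms of F. Transforming that formula again
   bounds |F| by a convolution of |F| with a Gaussian. A Gaussian changes by a
   bounded factor, up to rescaling, over a translation by a bounded vector, so
   integrability of F alone bounds its Wiener norm: S0 consists of the f in
   C_b for which F is integrable.

   The four remaining assertions are then statements about integrals of F.
   The transforms of the Fourier transform of f and of a time-frequency shift
   of f are, up to a phase, compositions of F with measure-preserving maps.
   The transform of f * h at (x, w) is int h(s) e^(-2 pi i w.s) F(x - s, w) ds,
   so its integral is at most int |h| times the norm of f. Writing f as a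
   superposition of the characters e^(2 pi i v.t) with coefficients F(y, v), the
   transform of f h at (x, w) is the integral of F(y, v) H(x, w - v), where H is
   the transform of h. Completeness follows from |f| <= ||f||_S0 and Fatou's
   lemma. *)
From HB Require Import structures.
Require Import Defs.
From mathcomp Require Import all_boot all_order all_algebra.
From mathcomp Require Import all_classical all_reals all_analysis.
From mathcomp Require Import complex measurable_realfun ring lra.
Set Implicit Arguments.
Unset Strict Implicit.
Unset Printing Implicit Defensive.
Import Order.TTheory GRing.Theory Num.Theory.
Import numFieldTopology.Exports numFieldNormedType.Exports.
Local Open Scope classical_set_scope.
Local Open Scope ring_scope.

(** * Lebesgue measure on R^n *)

Section rV_measurability.
Context {R : realType}.

Lemma measurable_coord_rV n (i : 'I_n) :
  measurable_fun setT (fun x : 'rV[R]_n => x ord0 i).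
Proof.
move=> _ Y mY; rewrite setTI; apply: sub_sigma_algebra => /=.
rewrite -bigcup_seq/=; exists i => /=; first by rewrite mem_index_enum.
by exists Y => //; rewrite setTI.
Qed.

Lemma measurable_rVP d (T : measurableType d) n (f : T -> 'rV[R]_n) :
  (forall i, measurable_fun setT (fun x => f x ord0 i)) ->
  measurable_fun setT f.
Proof.
move=> mf.
suff H : g_sigma_preimage (fun (i : 'I_n) (x : 'rV[R]_n) => x ord0 i)
    `<=` [set A | measurable (f @^-1` A)].
  by move=> _ A mA; rewrite setTI; exact: H.
apply: smallest_sub.
  split => /= [|A mA|F mF].
  - by rewrite preimage_set0.
  - by rewrite setTD -preimage_setC; exact: measurableC.
  - by rewrite preimage_bigcup; exact: bigcup_measurable.
rewrite -bigcup_seq; apply: bigcup_sub => i _ _ [B mB <-] /=.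
by rewrite setTI -comp_preimage -[_ @^-1` _]setTI; exact: mf.
Qed.

Lemma measurable_rV_ball n (x : 'rV[R]_n) (e : R) : measurable (ball x e).
Proof.
have [e0|e0] := ltP 0 e; last first.
  rewrite (_ : ball x e = set0) ?measurable0//.
  by rewrite -subset0 => y [/=]; rewrite ltNge e0.
have -> : ball x e = \bigcap_(i in [set: 'I_n])
    ((fun y : 'rV[R]_n => y ord0 i) @^-1` ball (x ord0 i) e).
  apply/seteqP; split => y /=; first by move=> [_ xy] i _; exact: xy.
  by move=> xy; split => // i j; rewrite (ord1 i); exact: xy.
apply: fin_bigcap_measurable => // i _.
rewrite -[_ @^-1` _]setTI; apply: measurable_coord_rV => //.
by rewrite ball_itv; exact: measurable_itv.
Qed.

Lemma open_measurable_rV n (O : set 'rV[R]_n) : open O -> measurable O.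
Proof.
move=> oO.
pose c (k : 'rV[rat]_n) : 'rV[R]_n := map_mx ratr k.
pose B (k : 'rV[rat]_n * nat) := ball (c k.1) k.2.+1%:R^-1.
have -> : O = \bigcup_(k in [set k | B k `<=` O]) B k.
  apply/seteqP; split=> [x Ox|x [k /= kO]]; last exact: kO.
  have /nbhs_ballP[e /= e0 eO] := open_nbhs_nbhs (conj oO Ox).
  have [m me] : exists m : nat, m.+1%:R^-1 < e / 2.
    have /ltr_add_invr[m] : 0 < e / 2 by rewrite divr_gt0.
    by rewrite add0r => me; exists m.
  have m0 : 0 < m.+1%:R^-1 :> R by rewrite invr_gt0.
  have /choice[q xq] (i : 'I_n) : exists q : rat, ball (x ord0 i) m.+1%:R^-1 (ratr q).
    have : x ord0 i - m.+1%:R^-1 < x ord0 i + m.+1%:R^-1.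
      by rewrite ltrBlDr -addrA ltrDl addr_gt0.
    move=> /rat_in_itvoo[q]; rewrite in_itv/= => /andP[q1 q2]; exists q.
    by rewrite /ball/= ltr_distlC q1 q2.
  exists (\row_i q i, m) => /=.
    move=> y [_ yB]; apply: eO; split => // i j.
    have := yB i j; rewrite !mxE (ord1 i) => yB'.
    have xqj := le_ball (ltW me) (xq j); rewrite [e](splitr e).
    exact: ball_triangle xqj (le_ball (ltW me) yB').
  split => // i j; rewrite (ord1 i) !mxE; apply: ball_sym; exact: xq.
rewrite bigcup_mkcond; apply: countable_bigcupT_measurable => // k.
by case: ifP => _; [exact: measurable_rV_ball | exact: measurable0].
Qed.

Lemma continuous_measurable_rV n (f : 'rV[R]_n -> R) :
  continuous f -> measurable_fun setT f.
Proof.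
move=> /continuousP cf; apply: (measurability _ (RGenOpens.measurableE R)).
by move=> _ [_ [a [b ->] <-]]; rewrite setTI; apply: open_measurable_rV; apply: cf; exact: interval_open.
Qed.

End rV_measurability.

Section leb.
Context {R : realType}.
Local Notation lambda := (@lebesgue_measure R).

(* [lebesgue_rV R n] as a measure-valued function, so that it can carry a
   sigma-finiteness instance. *)
Definition leb n : set 'rV[R]_n -> \bar R := lebesgue_rV R n.

HB.instance Definition _ n := Measure.on (@leb n).

Lemma leb_succ n : @leb n.+1 = pushforward (@leb n \x lambda)%E (@cons_rV R n).
Proof. by []. Qed.

Lemma leb_zero : @leb 0 = \d_(0 : 'rV[R]_0).
Proof. by []. Qed.

Lemma measurable_cube n (J : set R) : measurable J ->
  measurable [set t : 'rV[R]_n | forall i, J (t ord0 i)].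
Proof.
move=> mJ; rewrite (_ : [set _ | _] = \bigcap_(i in [set: 'I_n])
    ((fun y : 'rV[R]_n => y ord0 i) @^-1` J)).
  apply: fin_bigcap_measurable => // i _.
  by rewrite -[_ @^-1` _]setTI; exact: measurable_coord_rV.
by apply/seteqP; split => t /= h i; [move=> _|]; exact: h.
Qed.

Lemma leb_cube n (J : set R) : measurable J ->
  leb [set t : 'rV[R]_n | forall i, J (t ord0 i)] = (lambda J ^+ n)%E.
Proof.
move=> mJ; elim: n => [|n IH].
  by rewrite leb_zero diracE mem_set//= => -[].
have mc : measurable [set t : 'rV[R]_n | forall i, J (t ord0 i)].
  exact: measurable_cube.
rewrite leb_succ /pushforward.
rewrite (_ : _ @^-1` _ = [set t : 'rV[R]_n | forall i, J (t ord0 i)] `*` J).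
  by rewrite product_measure1E// expeS muleC; congr (_ * _)%E; exact: IH.
apply/seteqP; split => [[t s] /= h|[t s] /= [ht hs] i].
  split => [i|]; first by have := h (lift ord0 i); rewrite mxE liftK.
  by have := h ord0; rewrite mxE unlift_none.
by rewrite mxE; case: unliftP => [j|] _.
Qed.

Lemma leb_sigma_finite n : sigma_finite setT (@leb n).
Proof.
exists (fun k : nat => [set t : 'rV[R]_n | forall i, `[- k%:R, k%:R]%classic (t ord0 i)]).
  apply/esym; rewrite -subTset => t _.
  exists (Num.truncn (\sum_i `|t ord0 i|)).+1 => //= i.
  rewrite in_itv/= -ler_norml.
  rewrite (le_trans _ (ltW (truncnS_gt _)))//.
  by rewrite (bigD1 i)//= lerDl sumr_ge0.
move=> k; split.
  by apply: measurable_cube; exact: measurable_itv.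
rewrite leb_cube// -ge0_fin_numE ?expe_ge0// fin_numX// lebesgue_measure_itv.
by case: ifP.
Qed.

HB.instance Definition _ n := Measure_isSigmaFinite.Build _ _ _ (@leb n) (@leb_sigma_finite n).

Local Open Scope ereal_scope.

Lemma ge0_integral_lebS n (f : 'rV[R]_n.+1 -> \bar R) :
  measurable_fun setT f -> (forall t, 0 <= f t) ->
  \int[@leb n.+1]_t f t = \int[lambda]_s \int[@leb n]_t f (cons_rV (t, s)).
Proof.
move=> mf f0; rewrite leb_succ ge0_integral_pushforward//; last first.
  exact: measurable_cons_rV.
rewrite preimage_setT fubini_tonelli2//.
  by apply: measurableT_comp => //; exact: measurable_cons_rV.
by move=> x; exact: f0.
Qed.

Lemma measurable_cons_l n (s : R) :
  measurable_fun setT (fun t : 'rV[R]_n => cons_rV (t, s)).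
Proof.
apply: measurable_rVP => i; case: (unliftP ord0 i) => [j|] ->.
  by under eq_fun do rewrite mxE liftK; exact: measurable_coord_rV.
under eq_fun do rewrite mxE unlift_none /=.
exact: measurable_cst.
Qed.

Lemma measurable_integral_cons n (f : 'rV[R]_n.+1 -> \bar R) :
  measurable_fun setT f -> (forall t, 0 <= f t) ->
  measurable_fun setT (fun s : R => \int[@leb n]_t f (cons_rV (t, s))).
Proof.
move=> mf f0.
apply: (measurable_fun_fubini_tonelli_G (m1 := @leb n)
  (fun p : 'rV[R]_n * R => f (cons_rV p))) => //.
by apply: measurableT_comp => //; exact: measurable_cons_rV.
Qed.

End leb.

Section affine.
Context {R : realType}.
Local Notation lambda := (@lebesgue_measure R).
Local Open Scope ereal_scope.

Lemma measurable_affine (a b : R) :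
  measurable_fun setT (fun x : measurableTypeR R => a * x + b : measurableTypeR R)%R.
Proof. by apply: measurable_funD => //; exact: measurable_funM. Qed.

Lemma lebesgue_measure_affine (a b : R) (A : set R) : a != 0%R -> measurable A ->
  lambda A = `|a|%:E * lambda ((fun x => a * x + b)%R @^-1` A).
Proof.
move=> a0 mA; have na0 : (0 < `|a|)%R by rewrite normr_gt0.
pose mm : {measure set (measurableTypeR R) -> \bar R} :=
  mscale (NngNum (ltW na0))
   (measure_function_pushforward__canonical__measure_function_Measure
       lambda (measurable_affine a b)).
rewrite (@lebesgue_measure_unique _ mm)//.
move=> _ [[c d] _ <-]; rewrite /mm /= /mscale /pushforward/=.
transitivity (`|a|%:E * lambda ((fun x => a * x + b)%R @^-1` `]c, d]%classic)); last by [].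
have [{}a0|{}a0|a0'] := ltgtP a 0%R; last by rewrite a0' eqxx in a0.
  rewrite [X in (_ * lambda X)%E](_ : _ = `[((d - b) / a)%R, ((c - b) / a)%R[%classic); last first.
    apply/seteqP; split => x /=; rewrite !in_itv/= ltr_ndivlMr// ler_ndivrMr//;
    by rewrite ltrBlDr lerBrDr mulrC andbC.
  rewrite !lebesgue_measure_itv/= !lte_fin ltr_nM2r ?invr_lt0// ltrD2r.
  case: ifPn => _; last by rewrite mule0.
  rewrite -!EFinB -EFinM ltr0_norm//; congr EFin.
  by field; rewrite lt_eqF.
rewrite [X in (_ * lambda X)%E](_ : _ = `]((c - b) / a)%R, ((d - b) / a)%R]%classic); last first.
  apply/seteqP; split => x /=; rewrite !in_itv/= ltr_pdivrMr// ler_pdivlMr//;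
  by rewrite ltrBlDr lerBrDr mulrC.
rewrite !lebesgue_measure_itv/= !lte_fin ltr_pM2r ?invr_gt0// ltrD2r.
case: ifPn => _; last by rewrite mule0.
rewrite -!EFinB -EFinM gtr0_norm//; congr EFin.
by field; rewrite gt_eqF.
Qed.

Lemma ge0_integral_lebesgue_affine (a b : R) (f : R -> \bar R) : a != 0%R ->
  measurable_fun setT f -> (forall x, 0 <= f x) ->
  \int[lambda]_x f x = `|a|%:E * \int[lambda]_x f (a * x + b)%R.
Proof.
move=> a0 mf f0; have na0 : (0 < `|a|)%R by rewrite normr_gt0.
pose mu := measure_function_pushforward__canonical__measure_function_Measure
       lambda (measurable_affine a b).
rewrite (eq_measure_integral (mscale (NngNum (ltW na0)) mu)); last first.
  move=> A mA _; rewrite /= (lebesgue_measure_affine b a0 mA).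
  by rewrite /mscale/= /pushforward.
rewrite ge0_integral_mscale//= ge0_integral_pushforward//.
exact: measurable_affine.
Qed.

Lemma scale_cons_rV n (a s : R) (t : 'rV[R]_n) (b : 'rV[R]_n.+1) :
  (a *: cons_rV (t, s) + b = cons_rV
    (a *: t + \row_j b ord0 (lift ord0 j), a * s + b ord0 ord0))%R.
Proof.
apply/rowP => i; rewrite !mxE; case: unliftP => [j|] -> /=.
  by rewrite !mxE.
by [].
Qed.

Lemma measurable_affine_rV n (a : R) (b : 'rV[R]_n) :
  measurable_fun setT (fun t : 'rV[R]_n => a *: t + b)%R.
Proof.
apply: measurable_rVP => i.
under eq_fun do rewrite !mxE.
apply: measurable_funD => //; apply: measurable_funM => //.
exact: measurable_coord_rV.
Qed.

Lemma ge0_integral_leb_affine n (a : R) (b : 'rV[R]_n) (f : 'rV[R]_n -> \bar R) :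
  a != 0%R -> measurable_fun setT f -> (forall x, 0 <= f x) ->
  \int[@leb R n]_t f t = (`|a| ^+ n)%:E * \int[@leb R n]_t f (a *: t + b)%R.
Proof.
move=> a0; have na0 : (0 < `|a|)%R by rewrite normr_gt0.
elim: n b f => [|n IH] b f mf f0.
  rewrite mul1e; apply: eq_integral => t _; congr f.
  by apply/rowP => -[].
have mfb : measurable_fun setT (fun t : 'rV[R]_n.+1 => f (a *: t + b)%R).
  by apply: measurableT_comp => //; exact: measurable_affine_rV.
rewrite !ge0_integral_lebS//.
pose F s := \int[@leb R n]_t f (cons_rV (t, s)).
have mF : measurable_fun setT F.
  exact: measurable_integral_cons.
have F0 s : 0 <= F s by exact: integral_ge0.
rewrite (ge0_integral_lebesgue_affine (b ord0 ord0) a0 mF F0).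
rewrite exprS EFinM -muleA; congr (_ * _).
rewrite -ge0_integralZl//=; last 2 first.
- by apply: (measurable_integral_cons mfb).
- by move=> s _; exact: integral_ge0.
apply: eq_integral => s _.
rewrite /F [LHS](IH (\row_j b ord0 (lift ord0 j))%R)//.
  by congr (_ * _); apply: eq_integral => t _; rewrite scale_cons_rV.
by apply: measurableT_comp => //; exact: measurable_cons_l.
Qed.

End affine.

Section row_mx.
Context {R : realType}.
Local Open Scope ereal_scope.

Lemma measurable_row_mx m n :
  measurable_fun setT (fun p : 'rV[R]_m * 'rV[R]_n => row_mx p.1 p.2).
Proof.
apply: measurable_rVP => i; case: (split_ordP i) => j ->.
  under eq_fun do rewrite row_mxEl.
  exact: (measurableT_comp (measurable_coord_rV j)).
under eq_fun do rewrite row_mxEr.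
exact: (measurableT_comp (measurable_coord_rV j)).
Qed.

Lemma row_mx_cons m n (s : R) (x : 'rV[R]_m) (y : 'rV[R]_n) :
  row_mx (cons_rV (x, s)) y = cons_rV (row_mx x y, s) :> 'rV[R]_(m + n).+1.
Proof.
have El (k : 'I_m.+1) : (row_mx (cons_rV (x, s)) y : 'rV[R]_(m + n).+1) ord0 (lshift n k : 'I_(m.+1 + n)) =
  cons_rV (x, s) ord0 k by exact: row_mxEl.
have Er (k : 'I_n) : (row_mx (cons_rV (x, s)) y : 'rV[R]_(m + n).+1) ord0 (rshift m.+1 k : 'I_(m.+1 + n)) =
  y ord0 k by exact: row_mxEr.
apply/rowP => i; rewrite [RHS]mxE; case: unliftP => [j|] ->.
  case: (split_ordP j) => k ->.
    rewrite (_ : lift ord0 (lshift n k) = (lshift n (lift ord0 k) : 'I_(m.+1 + n))); last exact: val_inj.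
    by rewrite El mxE liftK row_mxEl.
  rewrite (_ : lift ord0 (rshift m k) = (rshift m.+1 k : 'I_(m.+1 + n))); last exact: val_inj.
  by rewrite Er row_mxEr.
have E0 : ord0 = (lshift n ord0 : 'I_(m.+1 + n)) by exact: val_inj.
by rewrite [X in _ X = _]E0 El mxE unlift_none.
Qed.

Lemma ge0_integral_leb_row_mx m n (f : 'rV[R]_(m + n) -> \bar R) :
  measurable_fun setT f -> (forall x, 0 <= f x) ->
  \int[@leb R (m + n)]_z f z =
  \int[@leb R m]_x \int[@leb R n]_y f (row_mx x y).
Proof.
elim: m f => [|m IH] f mf f0.
  rewrite [in RHS]leb_zero integral_dirac//=; last first.
    apply: (measurable_fun_fubini_tonelli_F (m2 := @leb R n)
      (fun p : 'rV[R]_0 * 'rV[R]_n => f (row_mx p.1 p.2))) => //.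
    by apply: measurableT_comp => //; exact: measurable_row_mx.
  rewrite diracT mul1e; apply: eq_integral => t _; congr f.
  by apply/rowP => i; rewrite mxE; case: splitP => [[]//|j ij]; congr (t _ _); exact: val_inj.
rewrite [RHS]ge0_integral_lebS//; last 2 first.
- apply: (measurable_fun_fubini_tonelli_F (m2 := @leb R n)
      (fun p : 'rV[R]_m.+1 * 'rV[R]_n => f (row_mx p.1 p.2))) => //.
  by apply: measurableT_comp => //; exact: measurable_row_mx.
- by move=> x; exact: integral_ge0.
rewrite [LHS](@ge0_integral_lebS _ (m + n) f mf f0).
apply: eq_integral => s _.
have mfs : measurable_fun setT (fun z : 'rV[R]_(m + n) => f (cons_rV (z, s))).
  by apply: measurableT_comp => //; exact: measurable_cons_l.
rewrite [LHS](IH _ mfs (fun z => f0 _)).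
by apply: eq_integral => x _; apply: eq_integral => y _; rewrite row_mx_cons.
Qed.

End row_mx.

Section leb2.
Context {R : realType}.
Local Open Scope ereal_scope.

(* The library infers no sigma-finiteness for a product of sigma-finite
   measures, hence the alias. *)
Definition leb2 n : set ('rV[R]_n * 'rV[R]_n) -> \bar R :=
  (@leb R n \x @leb R n)%E.

HB.instance Definition _ n := Measure.on (@leb2 n).

Lemma leb2_sigma_finite n : sigma_finite setT (@leb2 n).
Proof.
have /sigma_finiteP[F [TF ndF Foo]] := sigma_finiteT (@leb R n).
exists (fun k => F k `*` F k).
  rewrite -setXTT TF predeqE => -[x y]; split.
    move=> [/= [i _ Fx] [k _ Fy]]; exists (maxn i k) => //; split.
    - by move: x Fx; exact/subsetPset/ndF/leq_maxl.
    - by move: y Fy; exact/subsetPset/ndF/leq_maxr.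
  by move=> [k _ []/= ? ?]; split; exists k.
move=> k; have [mFk Fk] := Foo k; split; first exact: measurableX.
by rewrite /leb2 product_measure1E// lte_mul_pinfty// ge0_fin_numE.
Qed.

HB.instance Definition _ n :=
  Measure_isSigmaFinite.Build _ _ _ (@leb2 n) (@leb2_sigma_finite n).

End leb2.

(** * Complex-valued integrals *)

Section normc.
Context {R : realType}.
Local Notation normc := Normc.normc.
Local Open Scope complex_scope.
Implicit Types x y : R[i].

Lemma complexReD x y : complex.Re (x + y) = complex.Re x + complex.Re y.
Proof. by case: x y => [? ?] [? ?]. Qed.

Lemma complexImD x y : complex.Im (x + y) = complex.Im x + complex.Im y.
Proof. by case: x y => [? ?] [? ?]. Qed.

Lemma complexReM x y : complex.Re (x * y) =
  complex.Re x * complex.Re y - complex.Im x * complex.Im y.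
Proof. by case: x y => [? ?] [? ?]. Qed.

Lemma complexImM x y : complex.Im (x * y) =
  complex.Re x * complex.Im y + complex.Im x * complex.Re y.
Proof. by case: x y => [? ?] [? ?]. Qed.

Lemma normcE2 x : normc x = Num.sqrt (complex.Re x ^+ 2 + complex.Im x ^+ 2).
Proof. by case: x. Qed.

Lemma normc_ge0 x : 0 <= normc x.
Proof. by rewrite normcE2. Qed.

Lemma normc_Re x : `|complex.Re x| <= normc x.
Proof. by rewrite normcE2 -sqrtr_sqr ler_wsqrtr// lerDl sqr_ge0. Qed.

Lemma normc_Im x : `|complex.Im x| <= normc x.
Proof. by rewrite normcE2 -sqrtr_sqr ler_wsqrtr// lerDr sqr_ge0. Qed.

Lemma normc_le_ReIm x : normc x <= `|complex.Re x| + `|complex.Im x|.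
Proof.
rewrite normcE2 -[leRHS]ger0_norm ?addr_ge0// -sqrtr_sqr ler_wsqrtr//.
by rewrite sqrrD !real_normK ?num_real// addrAC lerDl mulrn_wge0// mulr_ge0.
Qed.

Lemma normc_real (r : R) : normc r%:C = `|r|.
Proof. by rewrite normcE2/= expr0n addr0 sqrtr_sqr. Qed.

Lemma normc_conjc x : normc (conjc x) = normc x.
Proof. by case: x => a b; rewrite !normcE2/= sqrrN. Qed.

Lemma normc_distrC x y : normc (x - y) = normc (y - x).
Proof. by rewrite -opprB normcN. Qed.

Lemma normc_cis (a : R) : normc (cis a) = 1.
Proof. by rewrite normcE2/= cos2Dsin2 sqrtr1. Qed.

Lemma cisD (a b : R) : cis (a + b) = cis a * cis b.
Proof.
apply/eqP; rewrite eq_complex/= mulrDr cosD sinD eqxx/=.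
by rewrite addrC [X in _ == X + _]mulrC [X in _ == _ + X]mulrC [X in _ == X]addrC mulrC [X in _ + X]mulrC; apply/eqP; ring.
Qed.

Lemma cis0 : cis (0 : R) = 1.
Proof. by rewrite /cis mulr0 cos0 sin0. Qed.

Lemma mulJc x : conjc x * x = (normc x ^+ 2)%:C.
Proof.
case: x => a b; rewrite /normc sqr_sqrtr ?addr_ge0 ?sqr_ge0//.
by apply/eqP; rewrite eq_complex/=; apply/andP; split; apply/eqP; ring.
Qed.

Lemma real_complexM (a b : R) : (a * b)%:C = a%:C * b%:C.
Proof. by rewrite rmorphM. Qed.

End normc.

Section complex_measurability.
Context {R : realType} d {T : measurableType d}.
Local Notation normc := Normc.normc.
Local Open Scope complex_scope.
Implicit Types f g : T -> R[i].

Definition cmeasurable f :=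
  measurable_fun setT (fun t => complex.Re (f t)) /\
  measurable_fun setT (fun t => complex.Im (f t)).

Lemma cmeasurable_cst (c : R[i]) : cmeasurable (fun=> c).
Proof. by split; exact: measurable_cst. Qed.

Lemma cmeasurableD f g : cmeasurable f -> cmeasurable g ->
  cmeasurable (fun t => f t + g t).
Proof.
move=> [mf1 mf2] [mg1 mg2]; split.
- by under eq_fun do rewrite complexReD; exact: measurable_funD.
- by under eq_fun do rewrite complexImD; exact: measurable_funD.
Qed.

Lemma cmeasurableM f g : cmeasurable f -> cmeasurable g ->
  cmeasurable (fun t => f t * g t).
Proof.
move=> [mf1 mf2] [mg1 mg2]; split.
- by under eq_fun do rewrite complexReM; apply: measurable_funB; exact: measurable_funM.
- by under eq_fun do rewrite complexImM; apply: measurable_funD; exact: measurable_funM.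
Qed.

Lemma cmeasurable_real (r : T -> R) : measurable_fun setT r ->
  cmeasurable (fun t => (r t)%:C).
Proof. by move=> mr; split => //=; exact: measurable_cst. Qed.

Lemma cmeasurable_cis (r : T -> R) : measurable_fun setT r ->
  cmeasurable (fun t => cis (r t)).
Proof.
have mcos : measurable_fun setT (@cos R).
  by apply: continuous_measurable_fun; exact: continuous_cos.
have msin : measurable_fun setT (@sin R).
  by apply: continuous_measurable_fun; exact: continuous_sin.
by move=> mr; split => /=; apply: measurableT_comp => //; exact: measurable_funM.
Qed.

Lemma measurable_normc f : cmeasurable f ->
  measurable_fun setT (fun t => normc (f t)).
Proof.
move=> [mf1 mf2]; under eq_fun do rewrite normcE2.
apply: measurableT_comp; last by apply: measurable_funD; exact: measurable_funX.
by apply: continuous_measurable_fun; exact: sqrt_continuous.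
Qed.

Lemma measurable_enormc f : cmeasurable f ->
  measurable_fun setT (fun t => (normc (f t))%:E).
Proof. by move=> mf; apply/measurable_EFinP; exact: measurable_normc. Qed.

End complex_measurability.

Lemma cmeasurable_comp {R : realType} d d' (T : measurableType d)
    (U : measurableType d') (f : U -> R[i]) (h : T -> U) :
  measurable_fun setT h -> cmeasurable f -> cmeasurable (fun t => f (h t)).
Proof.
move=> mh [mf1 mf2]; split.
  exact: (measurableT_comp mf1 mh).
exact: (measurableT_comp mf2 mh).
Qed.

Section complex_integral.
Context {R : realType} d {T : measurableType d}.
Variable mu : {measure set T -> \bar R}.
Local Notation normc := Normc.normc.
Local Open Scope complex_scope.
Implicit Types f g : T -> R[i].

Definition cint f : R[i] :=
  (\int[mu]_t complex.Re (f t)) +i* (\int[mu]_t complex.Im (f t)).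

Definition norm1 f : \bar R := (\int[mu]_t (normc (f t))%:E)%E.

Lemma norm1_ge0 f : (0 <= norm1 f)%E.
Proof. by apply: integral_ge0 => t _; rewrite lee_fin normc_ge0. Qed.

Lemma eq_cint f g : f =1 g -> cint f = cint g.
Proof. by move=> /funext ->. Qed.

Lemma le_norm1 f g : cmeasurable f -> cmeasurable g ->
  (forall t, normc (f t) <= normc (g t)) -> (norm1 f <= norm1 g)%E.
Proof.
move=> mf mg fg; apply: ge0_le_integral => //.
- by move=> t _; rewrite lee_fin normc_ge0.
- exact: measurable_enormc.
- exact: measurable_enormc.
- by move=> t _; rewrite lee_fin.
Qed.

Lemma norm1Z (c : R[i]) f : cmeasurable f ->
  norm1 (fun t => c * f t) = ((normc c)%:E * norm1 f)%E.
Proof.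
move=> mf; rewrite /norm1 -ge0_integralZl//.
- by apply: eq_integral => t _; rewrite Normc.normcM EFinM.
- exact: measurable_enormc.
- by move=> t _; rewrite lee_fin normc_ge0.
- by rewrite lee_fin normc_ge0.
Qed.

Lemma norm1D f g : cmeasurable f -> cmeasurable g ->
  (norm1 (fun t => f t + g t)%R <= norm1 f + norm1 g)%E.
Proof.
move=> mf mg; rewrite /norm1 -ge0_integralD//; last 4 first.
- by move=> t _; rewrite lee_fin normc_ge0.
- exact: measurable_enormc.
- by move=> t _; rewrite lee_fin normc_ge0.
- exact: measurable_enormc.
apply: ge0_le_integral => //.
- by move=> t _; rewrite lee_fin normc_ge0.
- by apply: measurable_enormc; exact: cmeasurableD.
- by apply: emeasurable_funD; exact: measurable_enormc.
- by move=> t _; rewrite -EFinD lee_fin le_normcD.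
Qed.

Lemma integrable_Re f : cmeasurable f -> (norm1 f < +oo)%E ->
  mu.-integrable setT (EFin \o (fun t => complex.Re (f t))).
Proof.
move=> mf ff; apply/integrableP; split; first by apply/measurable_EFinP; case: mf.
apply: le_lt_trans ff; apply: ge0_le_integral => //.
- by apply: measurableT_comp => //; apply/measurable_EFinP; case: mf.
- exact: measurable_enormc.
- by move=> t _; rewrite lee_fin normc_Re.
Qed.

Lemma integrable_Im f : cmeasurable f -> (norm1 f < +oo)%E ->
  mu.-integrable setT (EFin \o (fun t => complex.Im (f t))).
Proof.
move=> mf ff; apply/integrableP; split; first by apply/measurable_EFinP; case: mf.
apply: le_lt_trans ff; apply: ge0_le_integral => //.
- by apply: measurableT_comp => //; apply/measurable_EFinP; case: mf.
- exact: measurable_enormc.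
- by move=> t _; rewrite lee_fin normc_Im.
Qed.

Lemma cintD f g : cmeasurable f -> cmeasurable g ->
  (norm1 f < +oo)%E -> (norm1 g < +oo)%E ->
  cint (fun t => f t + g t) = cint f + cint g.
Proof.
move=> mf mg ff fg; rewrite /cint; apply/eqP; rewrite eq_complex/=.
under eq_Rintegral do rewrite complexReD.
under [X in _ && (X == _)]eq_Rintegral do rewrite complexImD.
rewrite !RintegralD ?eqxx//; by [exact: integrable_Re|exact: integrable_Im].
Qed.

Lemma cintZ (c : R[i]) f : cmeasurable f -> (norm1 f < +oo)%E ->
  cint (fun t => c * f t) = c * cint f.
Proof.
move=> mf ff; have ir := integrable_Re mf ff; have ii := integrable_Im mf ff.
case: c => a b; rewrite /cint; apply/eqP; rewrite eq_complex/=.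
under eq_Rintegral do rewrite complexReM/=.
under [X in _ && (X == _)]eq_Rintegral do rewrite complexImM/=.
have iZ (r : R) (h : T -> R) : mu.-integrable setT (EFin \o h) ->
    mu.-integrable setT (EFin \o (fun t => r * h t)).
  move=> ih; rewrite (_ : EFin \o _ = (fun t => r%:E * (h t)%:E)%E)//.
  by apply: integrableZl => //.
rewrite RintegralB ?RintegralD//; try exact: iZ.
by rewrite !RintegralZl// !eqxx.
Qed.

Lemma cintZr (c : R[i]) f : cmeasurable f -> (norm1 f < +oo)%E ->
  cint (fun t => f t * c) = cint f * c.
Proof.
by move=> mf ff; rewrite mulrC -cintZ//; apply: eq_cint => t; rewrite mulrC.
Qed.

Lemma normc_cint f : cmeasurable f -> ((normc (cint f))%:E <= norm1 f)%E.
Proof.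
move=> mf; have := leey (norm1 f); rewrite le_eqVlt => /predU1P[->|ff].
  by rewrite leey.
have [z0|z0] := eqVneq (cint f) 0.
  by rewrite z0 Normc.normc0 norm1_ge0.
have nz0 : normc (cint f) != 0.
  by apply/eqP => h; move/eqP: z0; apply; exact: Normc.eq0_normc.
pose c := conjc (cint f) / (normc (cint f))%:C.
have nc : normc c = 1.
  by rewrite Normc.normcM normc_conjc Normc.normcV normc_real ger0_norm ?normc_ge0// divff.
have -> : normc (cint f) = complex.Re (cint (fun t => c * f t)).
  rewrite cintZ// /c mulrAC.
  rewrite mulJc.
  by rewrite expr2 real_complexM mulfK// fmorph_eq0.
have mcf : cmeasurable (fun t => c * f t).
  by apply: cmeasurableM => //; exact: cmeasurable_cst.
have nf : norm1 (fun t => c * f t) = norm1 f by rewrite norm1Z// nc mul1e.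
rewrite -nf /= fineK; last first.
  apply: (integrable_fin_num measurableT (integrable_Re mcf _)).
  by rewrite nf.
have icf : (norm1 (fun t => c * f t)%R < +oo)%E by rewrite nf.
have := integrable_Re mcf icf => /integrableP[mRe _].
apply: le_trans (lee_abs _) _.
apply: le_trans (le_abse_integral mu measurableT mRe) _.
apply: ge0_le_integral => //.
- exact: measurableT_comp.
- exact: measurable_enormc.
- by move=> t _; rewrite lee_fin normc_Re.
Qed.

Lemma ae_eq_cint f g : cmeasurable f -> cmeasurable g ->
  {ae mu, forall t, f t = g t} -> cint f = cint g.
Proof.
move=> [mf1 mf2] [mg1 mg2] fg; rewrite /cint /Rintegral; congr (fine _ +i* fine _).
- apply: ae_eq_integral => //; try exact/measurable_EFinP.
  by apply: filterS fg => t /= -> _.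
- apply: ae_eq_integral => //; try exact/measurable_EFinP.
  by apply: filterS fg => t /= -> _.
Qed.

End complex_integral.

Section complex_fubini.
Context {R : realType} d1 d2 {T1 : measurableType d1} {T2 : measurableType d2}.
Variable m1 : {sigma_finite_measure set T1 -> \bar R}.
Variable m2 : {sigma_finite_measure set T2 -> \bar R}.
Local Notation normc := Normc.normc.
Variable F : T1 * T2 -> R[i].
Hypothesis mF : cmeasurable F.

Lemma cmeasurable_pair1 x : cmeasurable (fun y => F (x, y)).
Proof. by apply: cmeasurable_comp mF; exact: measurable_fun_pair. Qed.

Lemma measurable_norm1_F : measurable_fun setT (fun x => norm1 m2 (fun y => F (x, y))).
Proof.
apply: (measurable_fun_fubini_tonelli_F (m2 := m2) (fun p => (normc (F p))%:E)).
- exact: measurable_enormc.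
- by move=> p; rewrite lee_fin normc_ge0.
Qed.

Lemma measurable_norm1_G : measurable_fun setT (fun y => norm1 m1 (fun x => F (x, y))).
Proof.
apply: (measurable_fun_fubini_tonelli_G (m1 := m1) (fun p => (normc (F p))%:E)).
- exact: measurable_enormc.
- by move=> p; rewrite lee_fin normc_ge0.
Qed.

Lemma norm1_tonelli1 :
  (norm1 (m1 \x m2) F = \int[m1]_x norm1 m2 (fun y => F (x, y)))%E.
Proof.
rewrite /norm1 (fubini_tonelli1 (fun p => (normc (F p))%:E))//.
- exact: measurable_enormc.
- by move=> p; rewrite lee_fin normc_ge0.
Qed.

Lemma norm1_tonelli2 :
  (norm1 (m1 \x m2) F = \int[m2]_y norm1 m1 (fun x => F (x, y)))%E.
Proof.
rewrite /norm1 (fubini_tonelli2 (fun p => (normc (F p))%:E))//.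
- exact: measurable_enormc.
- by move=> p; rewrite lee_fin normc_ge0.
Qed.

Hypothesis iF : (norm1 (m1 \x m2) F < +oo)%E.

Let iRe := integrable_Re mF iF.
Let iIm := integrable_Im mF iF.

Lemma ae_norm1_F : {ae m1, forall x, (norm1 m2 (fun y => F (x, y)) < +oo)%E}.
Proof.
have : m1.-integrable setT (fun x => norm1 m2 (fun y => F (x, y))).
  apply/integrableP; split; first exact: measurable_norm1_F.
  move: iF; rewrite norm1_tonelli1; apply: le_lt_trans.
  by under eq_integral do rewrite gee0_abs ?norm1_ge0//.
move=> /(integrable_ae measurableT); apply: filterS => x /(_ I).
by rewrite ge0_fin_numE ?norm1_ge0.
Qed.

Lemma cmeasurable_cint1 : cmeasurable (fun x => cint m2 (fun y => F (x, y))).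
Proof.
split => /=.
- have := measurable_fubini_F iRe; move=> /(measurableT_comp (@fine_measurable R setT measurableT)).
  by [].
- have := measurable_fubini_F iIm; move=> /(measurableT_comp (@fine_measurable R setT measurableT)).
  by [].
Qed.

Let fineK_ae d (T : measurableType d) (m : {measure set T -> \bar R}) (f : T -> \bar R) :
  m.-integrable setT f -> (\int[m]_x (fine (f x))%:E = \int[m]_x f x)%E.
Proof.
move=> intf; have mf := measurable_int m intf.
apply: ae_eq_integral => //.
  by apply/measurable_EFinP; exact: (measurableT_comp (@fine_measurable R setT measurableT)).
apply: filterS (integrable_ae measurableT intf) => x xf _.
by rewrite fineK// xf.
Qed.

Lemma cint_fubini1 :
  cint (m1 \x m2)%E F = cint m1 (fun x => cint m2 (fun y => F (x, y))).
Proof.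
rewrite {1}/cint /Rintegral -(integral12_prod_meas1 iRe) -(integral12_prod_meas1 iIm).
rewrite -(fineK_ae (integrable_fubini_F iRe)) -(fineK_ae (integrable_fubini_F iIm)).
by [].
Qed.

Let integrable_fubini_G (f : T1 * T2 -> R) :
  (m1 \x m2)%E.-integrable setT (EFin \o f) ->
  m2.-integrable setT (fubini_G m1 (EFin \o f)).
Proof.
move=> intf; have /integrableP[mf ff] := intf.
have maf : measurable_fun setT (abse \o (EFin \o f)).
  have := measurableT_comp (@abse_measurable R setT) mf. exact.
apply/integrableP; split; first exact: (measurable_fubini_G intf).
apply: le_lt_trans ff.
rewrite (fubini_tonelli2 (abse \o (EFin \o f)) maf (fun p => abse_ge0 _)).
apply: ge0_le_integral => //.
- by apply: measurableT_comp => //; exact: (measurable_fubini_G intf).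
- exact: (measurable_fun_fubini_tonelli_G (m1 := m1) _ maf (fun p => abse_ge0 _)).
- move=> y _; apply: le_abse_integral => //.
  by apply: (measurableT_comp mf); exact: measurable_fun_pair.
Qed.

Lemma cint_fubini2 :
  cint (m1 \x m2)%E F = cint m2 (fun y => cint m1 (fun x => F (x, y))).
Proof.
rewrite {1}/cint /Rintegral -(integral21_prod_meas1 iRe) -(integral21_prod_meas1 iIm).
rewrite -(fineK_ae (integrable_fubini_G iRe)) -(fineK_ae (integrable_fubini_G iIm)).
by [].
Qed.

Lemma cint_fubini : cint m1 (fun x => cint m2 (fun y => F (x, y))) =
  cint m2 (fun y => cint m1 (fun x => F (x, y))).
Proof. by rewrite -cint_fubini1 cint_fubini2. Qed.

End complex_fubini.

Section complex_dominated_convergence.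
Context {R : realType} d {T : measurableType d}.
Variable mu : {measure set T -> \bar R}.
Local Notation normc := Normc.normc.

Definition ccvg (u : nat -> R[i]) (l : R[i]) :=
  (complex.Re (u n) @[n --> \oo] --> complex.Re l) /\
  (complex.Im (u n) @[n --> \oo] --> complex.Im l).

Let real_dct (u : nat -> T -> R) (f b : T -> R) :
  (forall n, measurable_fun setT (u n)) -> measurable_fun setT f ->
  (forall t, u n t @[n --> \oo] --> f t) ->
  mu.-integrable setT (EFin \o b) -> (forall n t, `|u n t| <= b t) ->
  \int[mu]_t u n t @[n --> \oo] --> \int[mu]_t f t.
Proof.
move=> mu_ mf uf ib ub.
have mu' n : measurable_fun setT (fun t => (u n t)%:E) by exact/measurable_EFinP.
have mf' : measurable_fun setT (EFin \o f) by exact/measurable_EFinP.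
have cu : {ae mu, forall t, setT t -> (u n t)%:E @[n --> \oo] --> (EFin \o f) t}.
  by apply/aeW => t _; apply/fine_cvgP; split; [exact: nearW|exact: uf].
have bu : {ae mu, forall t n, setT t -> (`|(u n t)%:E| <= (EFin \o b) t)%E}.
  by apply/aeW => t n _; rewrite lee_fin.
have [i _ h] := dominated_convergence measurableT mu' mf' cu ib bu.
apply: fine_cvg; rewrite fineK; first exact: h.
exact: (integrable_fin_num measurableT i).
Qed.

Lemma cint_dct (u : nat -> T -> R[i]) (f : T -> R[i]) (b : T -> R) :
  (forall n, cmeasurable (u n)) -> cmeasurable f ->
  (forall t, ccvg (u ^~ t) (f t)) ->
  mu.-integrable setT (EFin \o b) -> (forall n t, normc (u n t) <= b t) ->
  ccvg (fun n => cint mu (u n)) (cint mu f).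
Proof.
move=> mu_ [mf1 mf2] uf ib ub; split.
- apply: (real_dct (b := b)) => //; [by move=> n; case: (mu_ n)|by move=> t; case: (uf t)|].
  by move=> n t; apply: le_trans (ub n t); exact: normc_Re.
- apply: (real_dct (b := b)) => //; [by move=> n; case: (mu_ n)|by move=> t; case: (uf t)|].
  by move=> n t; apply: le_trans (ub n t); exact: normc_Im.
Qed.

End complex_dominated_convergence.

Section complex_convergence.
Context {R : realType}.
Local Notation normc := Normc.normc.
Local Open Scope complex_scope.
Implicit Types u v : nat -> R[i].

Lemma ccvg_cst (l : R[i]) : ccvg (fun=> l) l.
Proof. by split; exact: cvg_cst. Qed.

Lemma ccvgM u v (l m : R[i]) : ccvg u l -> ccvg v m ->
  ccvg (fun n => u n * v n) (l * m).
Proof.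
move=> [u1 u2] [v1 v2]; split.
- under eq_fun do rewrite complexReM; rewrite complexReM.
  by apply: cvgB; exact: cvgM.
- under eq_fun do rewrite complexImM; rewrite complexImM.
  by apply: cvgD; exact: cvgM.
Qed.

Lemma ccvg_real (r : nat -> R) (l : R) : r n @[n --> \oo] --> l ->
  ccvg (fun n => (r n)%:C) l%:C.
Proof. by move=> rl; split => //; exact: cvg_cst. Qed.

Lemma ccvg_cis (r : nat -> R) (l : R) : r n @[n --> \oo] --> l ->
  ccvg (fun n => cis (r n)) (cis l).
Proof.
move=> rl; split => /=.
- apply: cvg_comp; last exact: continuous_cos.
  by apply: cvgM => //; exact: cvg_cst.
- apply: cvg_comp; last exact: continuous_sin.
  by apply: cvgM => //; exact: cvg_cst.
Qed.

Lemma ccvg_unique u l m : ccvg u l -> ccvg u m -> l = m.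
Proof.
move=> [u1 u2] [v1 v2]; apply/eqP; rewrite eq_complex; apply/andP; split; apply/eqP.
- exact: (cvg_unique _ u1 v1).
- exact: (cvg_unique _ u2 v2).
Qed.

Lemma ccvg_normc u l : ccvg u l -> normc (u n) @[n --> \oo] --> normc l.
Proof.
move=> [u1 u2]; under eq_fun do rewrite normcE2; rewrite normcE2.
apply: cvg_comp; last exact: sqrt_continuous.
by apply: cvgD; rewrite expr2; under eq_fun do rewrite expr2; exact: cvgM.
Qed.

Lemma ccvgP u l : ccvg u l <->
  forall e, 0 < e -> \forall n \near \oo, normc (u n - l) < e.
Proof.
split=> [[u1 u2] e e0|h].
  have e20 : 0 < e / 2 by rewrite divr_gt0.
  move/cvgrPdist_lt : u1 => /(_ _ e20) u1.
  move/cvgrPdist_lt : u2 => /(_ _ e20) u2.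
  near=> n; apply: le_lt_trans (normc_le_ReIm _) _.
  rewrite !(complexReD, complexImD) [ltRHS]splitr ltrD//.
    have -> : complex.Re (- l) = - complex.Re l by case: (l).
    by rewrite distrC; near: n.
  have -> : complex.Im (- l) = - complex.Im l by case: (l).
  by rewrite distrC; near: n.
split; apply/cvgrPdist_lt => e e0; apply: filterS (h _ e0) => n; apply: le_lt_trans.
- rewrite normc_distrC; apply: le_trans (normc_Re _).
  by rewrite complexReD; case: (u n).
- rewrite normc_distrC; apply: le_trans (normc_Im _).
  by rewrite complexImD; case: (u n).
Unshelve. all: by end_near. Qed.

End complex_convergence.

Section Cb.
Context {R : realType}.
Local Notation normc := Normc.normc.
Local Open Scope complex_scope.

Lemma normrc (z : R[i]) : `|z| = (normc z)%:C.
Proof. by case: z. Qed.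

Lemma gt0_complex (e : R[i]) : 0 < e -> exists2 r : R, 0 < r & e = r%:C.
Proof.
case: e => a b; rewrite ltcE/= => /andP[/eqP -> a0].
by exists a.
Qed.

Lemma continuous_complexP n (f : 'rV[R]_n -> R[i]) :
  continuous (f : 'rV[R]_n -> R[i]^o) <->
  forall a e, 0 < e -> \forall x \near a, normc (f x - f a) < e.
Proof.
split => [cf a e e0|h a].
  have ce0 : (0 : R[i]) < e%:C by rewrite ltcR.
  have /(@cvgrPdist_lt R[i] R[i]^o)/(_ _ ce0) := cf a.
  by apply: filterS => x; rewrite normrc ltcR normc_distrC.
apply/(@cvgrPdist_lt R[i] R[i]^o _ _ (nbhs_filter a)) => _ /gt0_complex[e e0 ->].
by apply: filterS (h a _ e0) => x; rewrite normrc ltcR normc_distrC.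
Qed.

Lemma continuous_seqP n (f : 'rV[R]_n -> R[i]) :
  continuous (f : 'rV[R]_n -> R[i]^o) <->
  forall (u : nat -> 'rV[R]_n) a, u k @[k --> \oo] --> a -> ccvg (f \o u) (f a).
Proof.
rewrite continuous_complexP; split => [h u a ua|h a e e0].
  by apply/ccvgP => e e0; exact: (ua _ (h a e e0)).
apply: contrapT => nh.
have /choice[u ua] (k : nat) : exists x, ball a k.+1%:R^-1 x /\ ~ (normc (f x - f a) < e).
  apply: contrapT => /forallNP nx; apply: nh; apply/nbhs_ballP.
  exists k.+1%:R^-1 => /=; first by rewrite invr_gt0.
  by move=> x ax; apply: contrapT => fx; apply: (nx x).
have : u k @[k --> \oo] --> a.
  apply/cvgrPdist_lt => d d0; near=> k.
  have [] := ua k; rewrite -ball_normE/= => + _; move=> /lt_trans; apply.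
  near: k; have /ltr_add_invr[m] : 0 < d by [].
  rewrite add0r => md; exists m => //= k mk; apply: le_lt_trans md.
  by rewrite lef_pV2 ?posrE// ler_nat ltnS.
move=> /h/ccvgP/(_ _ e0)[m _ /(_ m (leqnn m))/=].
by case: (ua m).
Unshelve. all: by end_near. Qed.

Lemma continuous_cmeasurable n (f : 'rV[R]_n -> R[i]) :
  continuous (f : 'rV[R]_n -> R[i]^o) -> cmeasurable f.
Proof.
move=> /continuous_complexP cf; split; apply: continuous_measurable_rV => a.
- apply/(@cvgrPdist_lt R R^o _ _ (nbhs_filter a)) => e e0; apply: filterS (cf a e e0) => x.
  by apply: le_lt_trans; rewrite normc_distrC; apply: le_trans (normc_Re _); rewrite complexReD; case: (f x).
- apply/(@cvgrPdist_lt R R^o _ _ (nbhs_filter a)) => e e0; apply: filterS (cf a e e0) => x.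
  by apply: le_lt_trans; rewrite normc_distrC; apply: le_trans (normc_Im _); rewrite complexImD; case: (f x).
Qed.

Lemma normc_le_supnorm n (f : 'rV[R]_n -> R[i]) t : ((normc (f t))%:E <= supnorm f)%E.
Proof. by apply: ereal_sup_ubound; exists t. Qed.

Lemma supnorm_le n (f : 'rV[R]_n -> R[i]) (M : \bar R) :
  (forall t, ((normc (f t))%:E <= M)%E) -> (supnorm f <= M)%E.
Proof. by move=> h; apply: ge_ereal_sup => _ [t _ <-]. Qed.

Lemma CbP n (f : 'rV[R]_n -> R[i]) : Cb f <->
  continuous (f : 'rV[R]_n -> R[i]^o) /\
  exists2 M, 0 <= M & forall t, normc (f t) <= M.
Proof.
split => [[cf sf]|[cf [M M0 fM]]]; split=> //.
  have s0 : (0 <= supnorm f)%E.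
    by apply: le_trans (normc_le_supnorm f 0); rewrite lee_fin normc_ge0.
  exists (fine (supnorm f)); first exact: fine_ge0.
  move=> t; rewrite -lee_fin fineK; first exact: normc_le_supnorm.
  by rewrite ge0_fin_numE.
apply: (@le_lt_trans _ _ M%:E); last by rewrite ltry.
by apply: supnorm_le => t; rewrite lee_fin.
Qed.

Lemma Cb_cmeasurable n (f : 'rV[R]_n -> R[i]) : Cb f -> cmeasurable f.
Proof. by move=> [cf _]; exact: continuous_cmeasurable. Qed.

End Cb.

Section cint_leb.
Context {R : realType}.
Local Open Scope complex_scope.

Lemma norm1_leb_affine n (a : R) (b : 'rV[R]_n) (f : 'rV[R]_n -> R[i]) :
  a != 0 -> cmeasurable f ->
  norm1 (@leb R n) f =
  ((`|a| ^+ n)%:E * norm1 (@leb R n) (fun t => f (a *: t + b)%R))%E.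
Proof.
move=> a0 mf; rewrite /norm1 (ge0_integral_leb_affine b a0)//.
- exact: measurable_enormc.
- by move=> t; rewrite lee_fin normc_ge0.
Qed.

Let integral_leb_affine n (a : R) (b : 'rV[R]_n) (f : 'rV[R]_n -> R) :
  a != 0 -> (@leb R n).-integrable setT (EFin \o f) ->
  \int[@leb R n]_t f t = `|a| ^+ n * \int[@leb R n]_t f (a *: t + b).
Proof.
move=> a0 intf; have /integrableP[mf ff] := intf.
have an0 : 0 < `|a| ^+ n by rewrite exprn_gt0// normr_gt0.
have maf : measurable_fun setT (abse \o (EFin \o f)).
  exact: (measurableT_comp (@abse_measurable R setT) mf).
have intfa : (@leb R n).-integrable setT (EFin \o (fun t => f (a *: t + b))).
  apply/integrableP; split.
    by apply: (measurableT_comp mf); exact: measurable_affine_rV.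
  move: ff; rewrite (ge0_integral_leb_affine b a0 maf (fun p => abse_ge0 _)).
  by apply: contraTT; rewrite -!leNgt !leye_eq => /eqP ->; rewrite gt0_muley.
rewrite /Rintegral integralE [X in _ = _ * fine X]integralE.
pose h t := (a *: t + b)%R.
have eqp : (EFin \o (fun t => f (h t)))^\+%E = (EFin \o f)^\+%E \o h.
  by rewrite -funepos_comp.
have eqn : (EFin \o (fun t => f (h t)))^\-%E = (EFin \o f)^\-%E \o h.
  by rewrite -funeneg_comp.
rewrite [X in _ = _ * fine (integral _ _ X - _)%E]eqp.
rewrite [X in _ = _ * fine (_ - integral _ _ X)%E]eqn.
have mp := measurable_funepos mf; have mn := measurable_funeneg mf.
rewrite (ge0_integral_leb_affine b a0 mp)//.
rewrite (ge0_integral_leb_affine b a0 mn)//.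
have := integrable_fin_num measurableT (integrable_funepos measurableT intfa).
rewrite [X in integral _ _ X]eqp => ip.
have := integrable_fin_num measurableT (integrable_funeneg measurableT intfa).
rewrite [X in integral _ _ X]eqn => iN.
pose A := (\int[@leb R n]_t (EFin \o f)^\+ (a *: t + b)%R)%E.
pose B := (\int[@leb R n]_t (EFin \o f)^\- (a *: t + b)%R)%E.
rewrite -[LHS]/(fine ((`|a| ^+ n)%:E * A - (`|a| ^+ n)%:E * B)%E).
rewrite -[RHS]/(`|a| ^+ n * fine (A - B)%E).
have /fineK <- : A \is a fin_num by exact: ip.
have /fineK <- : B \is a fin_num by exact: iN.
by rewrite /= mulrBr.
Qed.

Lemma cint_leb_affine n (a : R) (b : 'rV[R]_n) (f : 'rV[R]_n -> R[i]) :
  a != 0 -> cmeasurable f -> (norm1 (@leb R n) f < +oo)%E ->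
  cint (@leb R n) f =
  (`|a| ^+ n)%:C * cint (@leb R n) (fun t => f (a *: t + b)).
Proof.
move=> a0 mf ff; rewrite /cint.
rewrite (integral_leb_affine b a0 (integrable_Re mf ff)).
rewrite (integral_leb_affine b a0 (integrable_Im mf ff)).
by apply/eqP; rewrite eq_complex/= !mul0r subr0 addr0 !eqxx.
Qed.

Lemma norm1_leb_shift n (b : 'rV[R]_n) (f : 'rV[R]_n -> R[i]) : cmeasurable f ->
  norm1 (@leb R n) (fun t => f (t + b)) = norm1 (@leb R n) f.
Proof.
move=> mf; rewrite [RHS](norm1_leb_affine b (oner_neq0 R) mf) normr1 expr1n mul1e.
by congr norm1; apply/funext => t; rewrite scale1r.
Qed.

Lemma cint_leb_shift n (b : 'rV[R]_n) (f : 'rV[R]_n -> R[i]) :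
  cmeasurable f -> (norm1 (@leb R n) f < +oo)%E ->
  cint (@leb R n) (fun t => f (t + b)) = cint (@leb R n) f.
Proof.
move=> mf ff; rewrite [RHS](cint_leb_affine b (oner_neq0 R) mf ff).
rewrite normr1 expr1n mul1r.
by apply: eq_cint => t; rewrite scale1r.
Qed.

Lemma norm1_leb_opp n (b : 'rV[R]_n) (f : 'rV[R]_n -> R[i]) : cmeasurable f ->
  norm1 (@leb R n) (fun t => f (b - t)) = norm1 (@leb R n) f.
Proof.
have N10 : (-1 : R) != 0 by rewrite oppr_eq0 oner_neq0.
move=> mf; rewrite [RHS](norm1_leb_affine b N10 mf) normrN1 expr1n mul1e.
by congr norm1; apply/funext => t; rewrite scaleN1r addrC.
Qed.

End cint_leb.

Lemma lebesgue_integral_isometry {R : realType} (e x : R) (f : R -> R) : `|e| = 1 ->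
  (@lebesgue_measure R).-integrable setT (EFin \o f) ->
  (@lebesgue_measure R).-integrable setT (EFin \o (fun t => f (e * t + x))) /\
  \int[@lebesgue_measure R]_t f (e * t + x) = \int[@lebesgue_measure R]_t f t.
Proof.
move=> e1 intf; have /integrableP[mf ff] := intf.
have e0 : e != 0 by rewrite -normr_gt0 e1.
have mx := measurable_affine e x.
have pE A : measurable A ->
    pushforward (@lebesgue_measure R) (fun t : measurableTypeR R => e * t + x : measurableTypeR R) A =
    @lebesgue_measure R A.
  by move=> mA; rewrite (lebesgue_measure_affine x e0 mA) e1 mul1e.
have intfx : (@lebesgue_measure R).-integrable setT (EFin \o (fun t => f (e * t + x))).
  apply/integrableP; split; first exact: (measurableT_comp mf mx).
  apply: le_lt_trans ff.
  have maf : measurable_fun setT (abse \o (EFin \o f)).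
    exact: (measurableT_comp (@abse_measurable R setT) mf).
  rewrite [leRHS](ge0_integral_lebesgue_affine x e0 maf (fun p => abse_ge0 _)).
  by rewrite e1 mul1e.
split => //; congr fine.
have := integral_pushforward mx mf intfx measurableT.
rewrite preimage_setT => <-.
by apply: eq_measure_integral => A mA _; exact: pE.
Qed.

(** * Gaussians *)

Section gauss1.
Context {R : realType}.
Local Notation lambda := (@lebesgue_measure R).

Definition gauss1 (t : R) : R := expR (- (pi * t ^+ 2)).

Lemma gauss1_gt0 t : 0 < gauss1 t. Proof. exact: expR_gt0. Qed.

Lemma measurable_gauss1 : measurable_fun setT gauss1.
Proof.
apply: measurableT_comp => //; apply: measurableT_comp => //.
by apply: measurable_funM => //; exact: measurable_funX.
Qed.

Lemma integral_gauss1 : (\int[lambda]_t (gauss1 t)%:E = 1)%E.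
Proof.
have sp0 : Num.sqrt (pi : R) != 0 by rewrite gt_eqF// sqrtr_gt0 pi_gt0.
have := @integralT_gauss R.
rewrite (ge0_integral_lebesgue_affine 0 sp0); last 2 first.
- by apply/measurable_EFinP; exact: measurable_gauss_fun.
- by move=> x; rewrite lee_fin gauss_fun_ge0.
under eq_integral.
  move=> x _; rewrite addr0 /gauss_fun exprMn sqr_sqrtr ?pi_ge0//.
  rewrite -[X in X%:E]/(gauss1 x); over.
rewrite ger0_norm ?sqrtr_ge0// => h.
have : ((Num.sqrt pi)^-1%:E * ((Num.sqrt (pi : R))%:E * \int[lambda]_t (gauss1 t)%:E) =
  (Num.sqrt pi)^-1%:E * (Num.sqrt (pi : R))%:E)%E by rewrite h.
by rewrite muleA -EFinM mulVf// mul1e.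
Qed.

Lemma integrable_gauss1_scale (a : R) : a != 0 ->
  lambda.-integrable setT (fun t => (gauss1 (a * t))%:E).
Proof.
move=> a0; apply/integrableP; split.
  apply/measurable_EFinP; apply: (measurableT_comp measurable_gauss1).
  exact: measurable_funM.
under eq_integral do rewrite gee0_abs ?lee_fin ?(ltW (gauss1_gt0 _))//.
have mg : measurable_fun setT (fun t => (gauss1 t)%:E).
  by apply/measurable_EFinP; exact: measurable_gauss1.
have g0 t : (0 <= (gauss1 t)%:E)%E by rewrite lee_fin ltW// gauss1_gt0.
have := ge0_integral_lebesgue_affine 0 a0 mg g0; rewrite integral_gauss1.
rewrite [X in integral _ _ X](_ : _ = (fun t => (gauss1 (a * t))%:E)); last first.
  by apply/funext => t; rewrite addr0.
move=> /esym; rewrite ltey; apply: contra_eqN => /eqP ->.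
by rewrite gt0_muley// lte_fin normr_gt0.
Qed.

Lemma integrable_gauss1 : lambda.-integrable setT (fun t => (gauss1 t)%:E).
Proof.
have := integrable_gauss1_scale (oner_neq0 R).
by under eq_fun do rewrite mul1r.
Qed.

Lemma normr_gauss1_le (t : R) : `|t * gauss1 t| <= gauss1 (2^-1 * t).
Proof.
rewrite normrM (gtr0_norm (gauss1_gt0 t)).
have -> : gauss1 (2^-1 * t) = expR (pi * t ^+ 2 * (3 / 4)) * gauss1 t.
  by rewrite /gauss1 -expRD; congr expR; field.
rewrite ler_wpM2r ?(ltW (gauss1_gt0 _))//.
apply: le_trans (expR_ge1Dx _).
have p2 : 2 <= (pi : R) := pi_ge2 R.
have : 0 <= (`|t| - 1) ^+ 2 by exact: sqr_ge0.
rewrite -(real_normK (num_real t)); have := normr_ge0 t; nra.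
Qed.

Let k (s t : R) := gauss1 t * cos (2 * pi * (s * t)).
Let l (s t : R) := gauss1 t * sin (2 * pi * (s * t)).

Let is_derive_k (s t : R) :
  is_derive s 1 (fun s : R => k s t) (- (2 * pi) * t * gauss1 t * sin (2 * pi * (s * t))).
Proof.
by rewrite /k; apply: is_derive_eq; rewrite /GRing.scale/=; ring.
Qed.

Let is_derive_l (s x t : R) : is_derive x 1 (fun x : R => l s (x + t))
  (- (2 * pi) * (x + t) * gauss1 (x + t) * sin (2 * pi * (s * (x + t))) +
   2 * pi * s * gauss1 (x + t) * cos (2 * pi * (s * (x + t)))).
Proof.
by rewrite /l /gauss1; apply: is_derive_eq; rewrite /GRing.scale/=; ring.
Qed.

Let k' (s t : R) := - (2 * pi) * t * gauss1 t * sin (2 * pi * (s * t)).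
Let l' (s u : R) := - (2 * pi) * u * gauss1 u * sin (2 * pi * (s * u)) +
   2 * pi * s * gauss1 u * cos (2 * pi * (s * u)).

Let mcos : measurable_fun setT (@cos R).
Proof. by apply: continuous_measurable_fun; exact: continuous_cos. Qed.
Let msin : measurable_fun setT (@sin R).
Proof. by apply: continuous_measurable_fun; exact: continuous_sin. Qed.

Let mlin (s : R) : measurable_fun setT (fun t : R => 2 * pi * (s * t)).
Proof. by do 2 (apply: measurable_funM => //). Qed.

Let normr_cos_le1 (x : R) : `|cos x| <= 1.
Proof. by rewrite ler_norml cos_geN1 cos_le1. Qed.

Let normr_sin_le1 (x : R) : `|sin x| <= 1.
Proof. by rewrite ler_norml sin_geN1 sin_le1. Qed.

Let integrable_dom (f b : R -> R) : measurable_fun setT f ->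
  lambda.-integrable setT (fun t => (b t)%:E) -> (forall t, `|f t| <= b t) ->
  lambda.-integrable setT (EFin \o f).
Proof.
move=> mf ib fb; apply: (le_integrable measurableT _ _ ib).
  exact/measurable_EFinP.
by move=> t _; rewrite lee_fin; apply: le_trans (fb t) (ler_norm _).
Qed.

Let integrable_k s : lambda.-integrable setT (EFin \o k s).
Proof.
apply: (integrable_dom _ integrable_gauss1).
  apply: measurable_funM; first exact: measurable_gauss1.
  exact: measurableT_comp.
move=> t; rewrite normrM gtr0_norm ?gauss1_gt0// ler_piMr//.
exact/ltW/gauss1_gt0.
Qed.

Let integrable_l s : lambda.-integrable setT (EFin \o l s).
Proof.
apply: (integrable_dom _ integrable_gauss1).
  apply: measurable_funM; first exact: measurable_gauss1.
  exact: measurableT_comp.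
move=> t; rewrite normrM gtr0_norm ?gauss1_gt0// ler_piMr//.
exact/ltW/gauss1_gt0.
Qed.

Let half_neq0 : (2^-1 : R) != 0. Proof. by rewrite invr_eq0 pnatr_eq0. Qed.
Let integrable_cst_gauss (C a : R) : a != 0 ->
  lambda.-integrable setT (fun t => (C * gauss1 (a * t))%:E).
Proof.
move=> a0; rewrite (_ : (fun _ => _) = (fun t => C%:E * (gauss1 (a * t))%:E)%E)//.
by apply: integrableZl => //; exact: integrable_gauss1_scale.
Qed.

Let k'_le s t : `|k' s t| <= 2 * pi * gauss1 (2^-1 * t).
Proof.
have p0 := @pi_ge0 R.
have -> : k' s t = 2 * pi * (t * gauss1 t * - sin (2 * pi * (s * t))).
  by rewrite /k'; ring.
rewrite normrM ger0_norm ?mulr_ge0// ler_wpM2l ?mulr_ge0// normrM.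
apply: le_trans (normr_gauss1_le t).
by rewrite normrN ler_piMr.
Qed.

Let gauss1_half_le t : gauss1 t <= gauss1 (2^-1 * t).
Proof.
rewrite ler_expR lerN2 ler_wpM2l ?pi_ge0//.
have := sqr_ge0 t; nra.
Qed.

Let gauss1_shift_le (x t : R) : `|x| <= 1 ->
  gauss1 (2^-1 * (x + t)) <= expR pi * gauss1 (4^-1 * t).
Proof.
move=> x1; rewrite -expRD ler_expR.
have -> : pi + - (pi * (4^-1 * t) ^+ 2) = - (pi * ((4^-1 * t) ^+ 2 - 1)) :> R by ring.
rewrite lerN2 ler_wpM2l ?pi_ge0//.
have : x ^+ 2 <= 1 by rewrite -real_normK ?num_real// expr_le1.
have := sqr_ge0 (t + 2 * x); nra.
Qed.

Let l'_le s u : `|l' s u| <= 2 * pi * (1 + `|s|) * gauss1 (2^-1 * u).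
Proof.
have p0 := @pi_ge0 R.
rewrite mulrDr mulr1 mulrDl; apply: le_trans (ler_normD _ _) _.
apply: lerD; first exact: k'_le.
rewrite normrM 2!normrM (gtr0_norm (gauss1_gt0 _)) (ger0_norm (mulr_ge0 _ _))//.
apply: (@le_trans _ _ (2 * pi * `|s| * gauss1 u)).
  by rewrite ler_piMr// !mulr_ge0// ltW// gauss1_gt0.
by rewrite ler_wpM2l ?mulr_ge0.
Qed.

Let ck (s : R) : R := \int[lambda]_t k s t.

Let is_derive_ck (s : R) : is_derive s (1 : R) ck (\int[lambda]_t k' s t).
Proof.
have d1k x y : partial1of2 k x y = k' x y.
  by rewrite /partial1of2 derive1E; apply: derive_val; exact: is_derive_k.
have Is : `](s - 1), (s + 1)[%classic s by rewrite /= in_itv/= gtrBl ltrDl ltr01.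
have intk x : `](s - 1), (s + 1)[%classic x -> lambda.-integrable setT (EFin \o k x).
  by move=> _; exact: integrable_k.
have derk x y : `](s - 1), (s + 1)[%classic x -> setT y -> derivable (k ^~ y) x 1.
  by move=> _ _; case: (is_derive_k x y).
pose G t := 2 * pi * gauss1 (2^-1 * t).
have G0 t : 0 <= G t by rewrite mulr_ge0 ?mulr_ge0 ?pi_ge0// ltW// gauss1_gt0.
have intG : lambda.-integrable setT (EFin \o G) by exact: integrable_cst_gauss.
have Gub x y : `](s - 1), (s + 1)[%classic x -> setT y -> `|partial1of2 k x y| <= G y.
  by move=> _ _; rewrite d1k; exact: k'_le.
apply: DeriveDef.
  exact: (derivable_under_integral measurableT Is intk derk G0 intG Gub).
rewrite -derive1E (differentiation_under_integral measurableT Is intk derk G0 intG Gub).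
by apply: eq_Rintegral => t _; rewrite d1k.
Qed.

(* The integral of [l s (x + t)] over t does not depend on x, and [l'] is its
   derivative in x under the integral sign. *)
Let integral_l' s : \int[lambda]_t l' s t = 0.
Proof.
pose L (x t : R) := l s (x + t).
have d1L x y : partial1of2 L x y = l' s (x + y).
  by rewrite /partial1of2 derive1E; apply: derive_val; exact: is_derive_l.
have Is : `](-1), 1[%classic (0 : R) by rewrite /= in_itv/= ltrN10 ltr01.
have intL x : lambda.-integrable setT (EFin \o L x) /\ \int[lambda]_t L x t = \int[lambda]_t l s t.
  have := lebesgue_integral_isometry x (normr1 R) (integrable_l s).
  rewrite (_ : (fun t => l s (1 * t + x)) = L x)//.
  by apply/funext => t; rewrite /L mul1r addrC.
have intL' x : `](-1), 1[%classic x -> lambda.-integrable setT (EFin \o L x).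
  by move=> _; case: (intL x).
have derL x y : `](-1), 1[%classic x -> setT y -> derivable (L ^~ y) x 1.
  by move=> _ _; case: (is_derive_l s x y).
pose G t := (2 * pi * (1 + `|s|) * expR pi) * gauss1 (4^-1 * t).
have C0 : 0 <= 2 * pi * (1 + `|s|) by rewrite !mulr_ge0 ?pi_ge0// addr_ge0.
have G0 t : 0 <= G t.
  by rewrite mulr_ge0 ?(ltW (gauss1_gt0 _))// mulr_ge0// expR_ge0.
have intG : lambda.-integrable setT (EFin \o G) by exact: integrable_cst_gauss.
have Gub x y : `](-1), 1[%classic x -> setT y -> `|partial1of2 L x y| <= G y.
  rewrite /= in_itv/= => /andP[x1 x2] _; rewrite d1L.
  apply: le_trans (l'_le _ _) _; rewrite -[leRHS]mulrA ler_wpM2l//.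
  by apply: gauss1_shift_le; rewrite ler_norml (ltW x1) (ltW x2).
have := differentiation_under_integral measurableT Is intL' derL G0 intG Gub.
under [X in _ = X -> _]eq_Rintegral do rewrite d1L add0r.
move=> <-; rewrite (_ : (fun _ => _) = cst (\int[lambda]_t l s t)) ?derive1_cst//.
by apply/funext => x; case: (intL x).
Qed.

(* [l' = k' + 2 pi s k] and [integral_l'] turn the derivative of [ck] into
   [- 2 pi s * ck s]. *)
Lemma integral_gauss1_cos s : \int[lambda]_t (gauss1 t * cos (2 * pi * (s * t))) = gauss1 s.
Proof.
rewrite -[LHS]/(ck s).
have intk' x : lambda.-integrable setT (EFin \o k' x).
  apply: (integrable_dom _ (integrable_cst_gauss (2 * pi) half_neq0)); last exact: k'_le.
  apply: measurable_funM; last exact: measurableT_comp.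
  by apply: measurable_funM; [exact: measurable_funM|exact: measurable_gauss1].
have ck' (x : R) : is_derive x (1 : R) ck (- (2 * pi * x) * ck x).
  apply: is_derive_eq; first exact: is_derive_ck.
  have := integral_l' x; under eq_Rintegral => t _.
    have -> : l' x t = k' x t + 2 * pi * x * k x t by rewrite /l' /k' /k; ring.
    over.
  rewrite RintegralD//=; last first.
    rewrite (_ : EFin \o _ = (fun t => (2 * pi * x)%:E * (k x t)%:E)%E)//.
    by apply: integrableZl => //; exact: integrable_k.
  rewrite (RintegralZl (2 * pi * x) measurableT (integrable_k x)).
  by move/eqP; rewrite addr_eq0 => /eqP ->; rewrite mulNr.
have h (x : R) : is_derive x (1 : R) (fun x => ck x * expR (pi * x ^+ 2)) 0.
  by apply: is_derive_eq; rewrite /GRing.scale/=; ring.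
have := is_derive_0_is_cst s 0 h.
rewrite expr0n mulr0 expR0 mulr1 => /(congr1 ( *%R^~ (gauss1 s))).
rewrite -mulrA -expRD subrr expR0 mulr1 => ->.
rewrite (_ : ck 0 = 1) ?mul1r// /ck /k.
under eq_Rintegral do rewrite mul0r mulr0 cos0 mulr1.
by rewrite /Rintegral integral_gauss1.
Qed.

Lemma integral_gauss1_sin s : \int[lambda]_t (gauss1 t * sin (2 * pi * (s * t))) = 0.
Proof.
have [_] := lebesgue_integral_isometry 0 (normrN1 R) (integrable_l s).
rewrite (_ : (fun t => l s (-1 * t + 0)) = (fun t => -1 * l s t)); last first.
  apply/funext => t; rewrite addr0 mulN1r /l mulrN mulrN sinN.
  by rewrite /gauss1 sqrrN; ring.
rewrite (RintegralZl (-1) measurableT (integrable_l s)) mulN1r => /eqP.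
by rewrite eq_sym -addr_eq0 -mulr2n mulrn_eq0/= => /eqP.
Qed.

End gauss1.

Section dot.
Context {R : realType} {n : nat}.
Implicit Types s t u : 'rV[R]_n.

Lemma dotC s t : dot s t = dot t s.
Proof. by apply: eq_bigr => i _; rewrite mulrC. Qed.

Lemma dotDl s t u : dot (s + t) u = dot s u + dot t u.
Proof. by rewrite -big_split; apply: eq_bigr => i _; rewrite mxE mulrDl. Qed.

Lemma dotDr s t u : dot u (s + t) = dot u s + dot u t.
Proof. by rewrite dotC dotDl !(dotC u). Qed.

Lemma dotNl s t : dot (- s) t = - dot s t.
Proof. by rewrite -sumrN; apply: eq_bigr => i _; rewrite mxE mulNr. Qed.

Lemma dotNr s t : dot s (- t) = - dot s t.
Proof. by rewrite dotC dotNl dotC. Qed.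

Lemma dotZl (a : R) s t : dot (a *: s) t = a * dot s t.
Proof. by rewrite mulr_sumr; apply: eq_bigr => i _; rewrite mxE mulrA. Qed.

Lemma dotZr (a : R) s t : dot s (a *: t) = a * dot s t.
Proof. by rewrite dotC dotZl dotC. Qed.

Lemma dot0r s : dot s 0 = 0.
Proof. by apply: big1 => i _; rewrite mxE mulr0. Qed.

Lemma dotBl s t u : dot (s - t) u = dot s u - dot t u.
Proof. by rewrite dotDl dotNl. Qed.

Lemma dotBr s t u : dot u (s - t) = dot u s - dot u t.
Proof. by rewrite dotDr dotNr. Qed.

Lemma dot_ge0 s : 0 <= dot s s.
Proof. by apply: sumr_ge0 => i _; rewrite -expr2 sqr_ge0. Qed.

Lemma measurable_dot d (T : measurableType d) (f g : T -> 'rV[R]_n) :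
  measurable_fun setT f -> measurable_fun setT g ->
  measurable_fun setT (fun x => dot (f x) (g x)).
Proof.
move=> mf mg; apply: measurable_sum => i; apply: measurable_funM.
- exact: (measurableT_comp (measurable_coord_rV i) mf).
- exact: (measurableT_comp (measurable_coord_rV i) mg).
Qed.

Lemma measurable_rVD d (T : measurableType d) (f g : T -> 'rV[R]_n) :
  measurable_fun setT f -> measurable_fun setT g ->
  measurable_fun setT (fun x => f x + g x).
Proof.
move=> mf mg; apply: measurable_rVP => i; under eq_fun do rewrite mxE.
apply: measurable_funD.
- exact: (measurableT_comp (measurable_coord_rV i) mf).
- exact: (measurableT_comp (measurable_coord_rV i) mg).
Qed.

Lemma measurable_rVN d (T : measurableType d) (f : T -> 'rV[R]_n) :
  measurable_fun setT f -> measurable_fun setT (fun x => - f x).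
Proof.
move=> mf; apply: measurable_rVP => i; under eq_fun do rewrite mxE.
apply: measurableT_comp => //.
exact: (measurableT_comp (measurable_coord_rV i) mf).
Qed.

Lemma measurable_rVZ d (T : measurableType d) (a : R) (f : T -> 'rV[R]_n) :
  measurable_fun setT f -> measurable_fun setT (fun x => a *: f x).
Proof.
move=> mf; apply: measurable_rVP => i; under eq_fun do rewrite mxE.
apply: measurable_funM => //.
exact: (measurableT_comp (measurable_coord_rV i) mf).
Qed.

End dot.

Lemma dot_cons {R : realType} n (x y : 'rV[R]_n) (s r : R) :
  dot (cons_rV (x, s)) (cons_rV (y, r)) = s * r + dot x y.
Proof.
rewrite /dot big_ord_recl !mxE unlift_none /=; congr (_ + _).
by apply: eq_bigr => i _; rewrite !mxE liftK.
Qed.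

Section gauss.
Context {R : realType}.
Local Notation normc := Normc.normc.
Local Notation lambda := (@lebesgue_measure R).
Local Open Scope complex_scope.

Definition gaussr n (t : 'rV[R]_n) : R := expR (- (pi * dot t t)).

Lemma gaussE n (t : 'rV[R]_n) : gauss t = (gaussr t)%:C.
Proof. by []. Qed.

Lemma gaussr_gt0 n (t : 'rV[R]_n) : 0 < gaussr t. Proof. exact: expR_gt0. Qed.

Lemma gaussr_le1 n (t : 'rV[R]_n) : gaussr t <= 1.
Proof. by rewrite -expR0 ler_expR oppr_le0 mulr_ge0 ?dot_ge0// pi_ge0. Qed.

Lemma gaussrN n (t : 'rV[R]_n) : gaussr (- t) = gaussr t.
Proof. by rewrite /gaussr dotNl dotNr opprK. Qed.

Lemma normc_gauss n (t : 'rV[R]_n) : normc (gauss t) = gaussr t.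
Proof. by rewrite normc_real gtr0_norm// gaussr_gt0. Qed.

Lemma gaussr_cons n (t : 'rV[R]_n) s : gaussr (cons_rV (t, s)) = gauss1 s * gaussr t.
Proof. by rewrite /gaussr dot_cons -expRD mulrDr opprD. Qed.

Lemma measurable_gaussr d (T : measurableType d) n (f : T -> 'rV[R]_n) :
  measurable_fun setT f -> measurable_fun setT (fun x => gaussr (f x)).
Proof.
move=> mf; apply: (measurableT_comp (@measurable_expR R)).
apply: (measurableT_comp (@oppr_measurable R setT)).
by apply: measurable_funM => //; exact: measurable_dot.
Qed.

Lemma cmeasurable_gauss d (T : measurableType d) n (f : T -> 'rV[R]_n) :
  measurable_fun setT f -> cmeasurable (fun x => gauss (f x)).
Proof. by move=> mf; apply: cmeasurable_real; exact: measurable_gaussr. Qed.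

Lemma integral_gaussr n : (\int[@leb R n]_t (gaussr t)%:E = 1)%E.
Proof.
have mg m : measurable_fun setT (fun t : 'rV[R]_m => (gaussr t)%:E).
  by apply/measurable_EFinP; exact: measurable_gaussr.
elim: n => [|n IH].
  rewrite leb_zero integral_dirac//; last exact: mg.
  by rewrite diracT mul1e /gaussr /dot big_ord0 mulr0 oppr0 expR0.
rewrite ge0_integral_lebS//; last by move=> t; rewrite lee_fin ltW// gaussr_gt0.
rewrite -[RHS]integral_gauss1; apply: eq_integral => s _.
under eq_integral do rewrite gaussr_cons EFinM.
rewrite ge0_integralZl//; last 3 first.
- exact: mg.
- by move=> t _; rewrite lee_fin ltW// gaussr_gt0.
- by rewrite lee_fin ltW// gauss1_gt0.
by rewrite IH mule1.
Qed.

Lemma norm1_gauss n : norm1 (@leb R n) (@gauss R n) = 1%E.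
Proof.
by rewrite -(integral_gaussr n); apply: eq_integral => t _; rewrite normc_gauss.
Qed.

Lemma norm1_gauss_affine n (a : R) (b : 'rV[R]_n) : a != 0 ->
  (norm1 (@leb R n) (fun t => gauss (a *: t + b)%R) < +oo)%E.
Proof.
move=> a0; have mg : cmeasurable (@gauss R n) by exact: cmeasurable_gauss.
have := norm1_leb_affine b a0 mg; rewrite norm1_gauss => /esym.
rewrite ltey; apply: contra_eqN => /eqP ->.
by rewrite gt0_muley// lte_fin exprn_gt0// normr_gt0.
Qed.

Lemma integrable_gaussr_affine n (a : R) (b : 'rV[R]_n) : a != 0 ->
  (@leb R n).-integrable setT (fun t => (gaussr (a *: t + b))%:E).
Proof.
move=> a0; have mg : cmeasurable (fun t : 'rV[R]_n => gauss (a *: t + b)).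
  by apply: cmeasurable_gauss; exact: measurable_affine_rV.
exact: (integrable_Re mg (norm1_gauss_affine b a0)).
Qed.

Lemma integrable_gaussr n : (@leb R n).-integrable setT (fun t => (gaussr t)%:E).
Proof.
have := integrable_gaussr_affine (0 : 'rV[R]_n) (oner_neq0 R).
by under eq_fun do rewrite scale1r addr0.
Qed.

Lemma cint_gauss n : cint (@leb R n) (@gauss R n) = 1.
Proof.
rewrite /cint /Rintegral integral_gaussr.
by rewrite integral0.
Qed.

Lemma cint_lebS n (f : 'rV[R]_n.+1 -> R[i]) : cmeasurable f ->
  (norm1 (@leb R n.+1) f < +oo)%E ->
  cint (@leb R n.+1) f = cint lambda (fun s => cint (@leb R n) (fun t => f (cons_rV (t, s)))).
Proof.
move=> mf ff.
have mc : measurable_fun [set: 'rV[R]_n * measurableTypeR R] (@cons_rV R n).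
  exact: measurable_cons_rV.
have mfc : cmeasurable (fun p : 'rV[R]_n * measurableTypeR R => f (cons_rV p)) by exact: cmeasurable_comp mf.
have ffc : (norm1 (@leb R n \x lambda)%E (f \o @cons_rV R n) < +oo)%E.
  move: ff; rewrite /norm1 leb_succ ge0_integral_pushforward//.
  - exact: measurable_enormc.
  - by move=> t _; rewrite lee_fin normc_ge0.
rewrite -(cint_fubini2 (m1 := @leb R n) (m2 := lambda) mfc ffc) /cint /Rintegral leb_succ.
have [mf1 mf2] := mf.
have h1 := integral_pushforward mc ((measurable_EFinP _ _).2 mf1) (integrable_Re mfc ffc) measurableT.
have h2 := integral_pushforward mc ((measurable_EFinP _ _).2 mf2) (integrable_Im mfc ffc) measurableT.
by rewrite h1 h2 preimage_setT.
Qed.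

Lemma cmeasurable_cis_dot d (T : measurableType d) n (f g : T -> 'rV[R]_n) :
  measurable_fun setT f -> measurable_fun setT g ->
  cmeasurable (fun x => cis (- dot (f x) (g x))).
Proof.
by move=> mf mg; apply: cmeasurable_cis; apply: measurableT_comp => //; exact: measurable_dot.
Qed.

Lemma cint_gauss_cis n (s : 'rV[R]_n) :
  cint (@leb R n) (fun t => gauss t * cis (- dot s t)) = gauss s.
Proof.
have mg m (r : 'rV[R]_m) : cmeasurable (fun t => gauss t * cis (- dot r t)).
  by apply: cmeasurableM; [exact: cmeasurable_gauss|exact: cmeasurable_cis_dot].
have fg m (r : 'rV[R]_m) : (norm1 (@leb R m) (fun t => gauss t * cis (- dot r t))%R < +oo)%E.
  rewrite /norm1; under eq_integral do rewrite Normc.normcM normc_cis mulr1 normc_gauss.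
  by rewrite integral_gaussr ltry.
elim: n s => [|n IH] s.
  rewrite (_ : (fun _ => _) = @gauss R 0) ?cint_gauss.
    by rewrite /gauss /dot big_ord0 mulr0 oppr0 expR0.
  by apply/funext => t; rewrite /dot big_ord0 oppr0 cis0 mulr1.
have [r [x ->]] : exists r x, s = cons_rV (x, r).
  exists (s ord0 ord0), (\row_i s ord0 (lift ord0 i)).
  by apply/rowP => i; rewrite mxE; case: unliftP => [j|] ->; rewrite ?mxE.
rewrite cint_lebS//.
rewrite (_ : (fun _ => _) = (fun s : R => ((gauss1 s)%:C * cis (- (r * s))) * gauss x)); last first.
  apply/funext => u; rewrite -IH -cintZ//; apply: eq_cint => t.
  by rewrite dot_cons gaussE gaussr_cons opprD cisD real_complexM gaussE; ring.
have m1 : cmeasurable (fun s : R => (gauss1 s)%:C * cis (- (r * s))).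
  apply: cmeasurableM; first by apply: cmeasurable_real; exact: measurable_gauss1.
  by apply: cmeasurable_cis; apply: measurableT_comp => //; exact: measurable_funM.
have f1 : (norm1 lambda (fun s : R => (gauss1 s)%:C * cis (- (r * s)))%R < +oo)%E.
  rewrite /norm1; under eq_integral do
    rewrite Normc.normcM normc_cis mulr1 normc_real gtr0_norm ?gauss1_gt0//.
  by rewrite integral_gauss1 ltry.
rewrite cintZr// !gaussE gaussr_cons real_complexM; congr (_ * _).
apply/eqP; rewrite eq_complex; apply/andP; split; apply/eqP.
  rewrite /= -[RHS]integral_gauss1_cos; apply: eq_Rintegral => t _.
  by rewrite mul0r subr0 mulrN cosN.
rewrite /= -[RHS](integral_gauss1_sin (- r)); apply: eq_Rintegral => t _.
by rewrite mul0r addr0 mulNr.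
Qed.

End gauss.

Lemma measurable_oppfun {R : realType} d (T : measurableType d) (r : T -> R) :
  measurable_fun setT r -> measurable_fun setT (fun t => - r t).
Proof. exact: (measurableT_comp (@oppr_measurable R setT)). Qed.

Lemma measurable_fst_comp d d1 d2 (T : measurableType d) (T1 : measurableType d1)
    (T2 : measurableType d2) (f : T -> T1 * T2) :
  measurable_fun setT f -> measurable_fun setT (fun x => (f x).1).
Proof. exact: (measurableT_comp measurable_fst). Qed.

Lemma measurable_snd_comp d d1 d2 (T : measurableType d) (T1 : measurableType d1)
    (T2 : measurableType d2) (f : T -> T1 * T2) :
  measurable_fun setT f -> measurable_fun setT (fun x => (f x).2).
Proof. exact: (measurableT_comp measurable_snd). Qed.

(* The [constr_eq] guards keep unification from unfolding integrands in an
   attempt to apply a hypothesis about another function. *)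
Ltac measurability := repeat first
  [ match goal with H : ?A |- ?B => constr_eq A B; exact: H end
  | exact: measurable_cst | exact: measurable_id
  | exact: measurable_fst | exact: measurable_snd
  | apply: cmeasurable_cst
  | match goal with H : cmeasurable ?f |- cmeasurable (fun x => ?g (@?h x)) =>
      constr_eq f g; apply: (cmeasurable_comp (h := h) _ H) end
  | apply: cmeasurable_gauss | apply: cmeasurable_cis | apply: cmeasurableM
  | apply: cmeasurable_real
  | apply: measurable_dot | apply: measurable_rVD | apply: measurable_rVN
  | apply: measurable_rVZ | apply: measurable_oppfun
  | apply: measurable_gaussr
  | apply: measurable_fst_comp | apply: measurable_snd_comp ].

Section rV_convergence.
Context {R : realType}.
Local Notation normc := Normc.normc.

Lemma cvg_rVP n (u : nat -> 'rV[R]_n) (a : 'rV[R]_n) :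
  (forall i, u k ord0 i @[k --> \oo] --> a ord0 i) -> u k @[k --> \oo] --> a.
Proof.
move=> ua; apply/cvg_ballP => e e0.
have : \forall k \near \oo, forall i, ball (a ord0 i) e (u k ord0 i).
  apply: filter_forall => i; move/cvg_ballP : (ua i); exact.
by apply: filterS => k h; split => // i j; rewrite (ord1 i); exact: h.
Qed.

Lemma cvg_coord_rV n (u : nat -> 'rV[R]_n) (a : 'rV[R]_n) i :
  u k @[k --> \oo] --> a -> u k ord0 i @[k --> \oo] --> a ord0 i.
Proof.
move=> ua; exact: (cvg_comp _ (fun x : 'rV[R]_n => x ord0 i) ua (@coord_continuous R 1 n ord0 i a)).
Qed.

Lemma cvg_dot n (u v : nat -> 'rV[R]_n) (a b : 'rV[R]_n) :
  u k @[k --> \oo] --> a -> v k @[k --> \oo] --> b ->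
  dot (u k) (v k) @[k --> \oo] --> dot a b.
Proof.
move=> ua vb; rewrite /dot; elim: (index_enum _) => [|i r IH].
  by under eq_fun do rewrite big_nil; rewrite big_nil; exact: cvg_cst.
under eq_fun do rewrite big_cons; rewrite big_cons.
by apply: cvgD => //; apply: cvgM; exact: cvg_coord_rV.
Qed.

Lemma cvg_lsubmx m n (u : nat -> 'rV[R]_(m + n)) (a : 'rV[R]_(m + n)) :
  u k @[k --> \oo] --> a -> lsubmx (u k) @[k --> \oo] --> lsubmx a.
Proof.
move=> ua; apply: cvg_rVP => i; rewrite mxE; under eq_fun do rewrite mxE.
exact: cvg_coord_rV.
Qed.

Lemma cvg_rsubmx m n (u : nat -> 'rV[R]_(m + n)) (a : 'rV[R]_(m + n)) :
  u k @[k --> \oo] --> a -> rsubmx (u k) @[k --> \oo] --> rsubmx a.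
Proof.
move=> ua; apply: cvg_rVP => i; rewrite mxE; under eq_fun do rewrite mxE.
exact: cvg_coord_rV.
Qed.

Lemma ccvg_gauss n (u : nat -> 'rV[R]_n) (a : 'rV[R]_n) :
  u k @[k --> \oo] --> a -> ccvg (fun k => gauss (u k)) (gauss a).
Proof.
move=> ua; apply: ccvg_real.
apply: cvg_comp; last exact: continuous_expR.
by apply: cvgN; apply: cvgM; [exact: cvg_cst|exact: cvg_dot].
Qed.

Lemma continuous_cint d (T : measurableType d) (mu : {measure set T -> \bar R})
    n (k : 'rV[R]_n -> T -> R[i]) (b : T -> R) :
  (forall p, cmeasurable (k p)) -> mu.-integrable setT (EFin \o b) ->
  (forall p t, normc (k p t) <= b t) ->
  (forall t (u : nat -> 'rV[R]_n) (a : 'rV[R]_n), u j @[j --> \oo] --> a ->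
     ccvg (fun j => k (u j) t) (k a t)) ->
  continuous ((fun p => cint mu (k p)) : 'rV[R]_n -> R[i]^o).
Proof.
move=> mk ib kb ck; apply/continuous_seqP => u a ua.
by apply: (cint_dct (b := b)) => // t; exact: ck.
Qed.

Lemma Cb_seq n (f : 'rV[R]_n -> R[i]) (u : nat -> 'rV[R]_n) (a : 'rV[R]_n) : Cb f ->
  u j @[j --> \oo] --> a -> ccvg (fun j => f (u j)) (f a).
Proof. by move=> [cf _]; move/continuous_seqP : cf; apply. Qed.

Lemma CbI n (f : 'rV[R]_n -> R[i]) (M : R) :
  (forall (u : nat -> 'rV[R]_n) (a : 'rV[R]_n), u j @[j --> \oo] --> a ->
     ccvg (fun j => f (u j)) (f a)) ->
  (forall t, normc (f t) <= M) -> Cb f.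
Proof.
move=> cf fM; apply/CbP; split; first exact/continuous_seqP.
by exists M => //; apply: le_trans (fM 0); exact: normc_ge0.
Qed.

End rV_convergence.

(** * The short-time Fourier transform and Fourier inversion *)

Section stft.
Context {R : realType} {n : nat}.
Local Notation normc := Normc.normc.
Local Notation leb := (@leb R n).
Local Open Scope complex_scope.
Implicit Types (f p : 'rV[R]_n -> R[i]) (x w t : 'rV[R]_n).

Lemma integrable_normc f : cmeasurable f -> (norm1 leb f < +oo)%E ->
  leb.-integrable setT (EFin \o (fun t => normc (f t))).
Proof.
move=> mf ff; apply/integrableP; split; first exact: measurable_enormc.
apply: le_lt_trans ff; apply: ge0_le_integral => //.
- by apply: measurableT_comp => //; exact: measurable_enormc.
- exact: measurable_enormc.
- by move=> t _; rewrite /= ger0_norm// normc_ge0.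
Qed.

Definition gstft f x w : R[i] :=
  cint leb (fun t => f t * gauss (t - x) * cis (- dot w t)).

Lemma gauss_stftE f z : gauss_stft f z = gstft f (lsubmx z) (rsubmx z).
Proof. by apply: eq_cint => t; rewrite conjc_real. Qed.

Lemma normc_fourier f w : cmeasurable f ->
  ((normc (fourier f w))%:E <= norm1 leb f)%E.
Proof.
move=> mf; apply: le_trans (normc_cint _ _) _; first by measurability.
apply: le_norm1; [by measurability|by []|].
by move=> t; rewrite Normc.normcM normc_cis mulr1.
Qed.

Lemma Cb_fourier f : cmeasurable f -> (norm1 leb f < +oo)%E -> Cb (fourier f).
Proof.
move=> mf ff; apply/CbP; split.
  apply: (continuous_cint (k := fun w t => f t * cis (- dot w t)) _ (integrable_normc mf ff)).
  - by move=> p; measurability.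
  - by move=> w t; rewrite Normc.normcM normc_cis mulr1.
  - move=> t u a ua; apply: ccvgM; first exact: ccvg_cst.
    by apply: ccvg_cis; apply: cvgN; apply: cvg_dot => //; exact: cvg_cst.
exists (fine (norm1 leb f)); first by rewrite fine_ge0// norm1_ge0.
move=> w; rewrite -lee_fin fineK ?ge0_fin_numE ?norm1_ge0//.
exact: normc_fourier.
Qed.

Lemma norm1_window f x (M : R) : cmeasurable f -> (forall t, normc (f t) <= M) ->
  (norm1 leb (fun t => f t * gauss (t - x))%R <= M%:E)%E.
Proof.
move=> mf fM; have M0 : 0 <= M by apply: le_trans (fM 0); exact: normc_ge0.
have mg : cmeasurable (fun t => gauss (t - x)) by measurability.
have -> : M%:E = norm1 leb (fun t => M%:C * gauss (t - x)).
  rewrite norm1Z// norm1_leb_shift ?norm1_gauss; last by measurability.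
  by rewrite mule1 normc_real ger0_norm.
apply: le_norm1; [by measurability|by measurability|].
move=> t; rewrite !Normc.normcM normc_real (ger0_norm M0).
by rewrite ler_wpM2r ?normc_ge0.
Qed.

Lemma normc_gstft f (M : R) x w : cmeasurable f -> (forall t, normc (f t) <= M) ->
  normc (gstft f x w) <= M.
Proof.
move=> mf fM; rewrite -lee_fin; apply: le_trans (normc_cint _ _) _.
  by measurability.
apply: le_trans _ (norm1_window x mf fM).
apply: le_norm1; [by measurability|by measurability|].
by move=> t; rewrite Normc.normcM normc_cis mulr1.
Qed.

Lemma gstft_shift f x w : Cb f -> gstft f x w =
  cint leb (fun t => f (t + x) * gauss t * cis (- dot w (t + x))).
Proof.
move=> /[dup] /CbP[_ [M M0 fM]] /Cb_cmeasurable mf.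
rewrite -(@cint_leb_shift _ _ (- x)); last 2 first.
- by measurability.
- apply: le_lt_trans (_ : (M%:E < +oo)%E); last by rewrite ltry.
  have mfx : cmeasurable (fun t => f (t + x)) by measurability.
  apply: le_trans _ (norm1_window 0 mfx (fun t => fM _)).
  apply: le_norm1; [by measurability|by measurability|move=> t].
  by rewrite Normc.normcM normc_cis mulr1 subr0.
by apply: eq_cint => t; rewrite subrK.
Qed.

Lemma Cb_gauss_stft f : Cb f -> Cb (gauss_stft f).
Proof.
move=> /[dup] cf /[dup] /CbP[_ [M M0 fM]] /Cb_cmeasurable mf.
apply/CbP; split; last first.
  by exists M => // z; rewrite gauss_stftE; exact: normc_gstft.
have -> : gauss_stft f = fun z : 'rV[R]_(n + n) => cint leb (fun t => f (t + lsubmx z) * gauss t * cis (- dot (rsubmx z) (t + lsubmx z))).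
  by apply/funext => z; rewrite gauss_stftE gstft_shift.
have ig : leb.-integrable setT (EFin \o (fun t => M * gaussr t)).
  rewrite (_ : EFin \o _ = (fun t => M%:E * (gaussr t)%:E)%E)//.
  by apply: integrableZl => //; exact: integrable_gaussr.
apply: (continuous_cint (k := fun (z : 'rV[R]_(n + n)) t => f (t + lsubmx z) * gauss t * cis (- dot (rsubmx z) (t + lsubmx z))) _ ig).
- by move=> z; measurability.
- move=> z t; rewrite !Normc.normcM normc_cis mulr1 normc_gauss.
  by rewrite ler_wpM2r// ltW// gaussr_gt0.
- move=> t u a ua.
  have cl : t + lsubmx (u j) @[j --> \oo] --> t + lsubmx a.
    by apply: cvgD; [exact: cvg_cst|exact: cvg_lsubmx].
  apply: ccvgM.
    by apply: ccvgM; [exact: Cb_seq|exact: ccvg_cst].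
  by apply: ccvg_cis; apply: cvgN; apply: cvg_dot => //; exact: cvg_rsubmx.
Qed.

Lemma norm1_gauss_scale (a : R) : a != 0 ->
  (norm1 leb (fun t => gauss (a *: t)) < +oo)%E.
Proof.
move=> a0; have := norm1_gauss_affine (0 : 'rV[R]_n) a0.
by under [X in norm1 _ X]eq_fun do rewrite addr0.
Qed.

Lemma cint_gauss_scale_cis (a : R) (s : 'rV[R]_n) : 0 < a ->
  cint leb (fun w => gauss (a *: w) * cis (- dot w s)) =
  (a ^- n)%:C * gauss (a^-1 *: s).
Proof.
move=> a0; have a00 : a != 0 by rewrite gt_eqF.
have m1 : cmeasurable (fun w => gauss (a *: w) * cis (- dot w s)) by measurability.
rewrite (cint_leb_affine (a := a^-1) 0 _ m1) ?invr_eq0//; last first.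
  apply: le_lt_trans (norm1_gauss_scale a00).
  apply: le_norm1; [by measurability|by measurability|move=> t].
  by rewrite Normc.normcM normc_cis mulr1.
rewrite gtr0_norm ?invr_gt0// exprVn -cint_gauss_cis; congr (_ * _).
apply: eq_cint => t; rewrite addr0 scalerA mulfV// scale1r; congr (_ * cis (- _)).
by rewrite dotZl dotC -dotZl.
Qed.

(* Gaussian regularization: inserting [gauss (e k *: w)] makes the double
   integral absolutely convergent, and Fubini turns [A k] into an average [B k]
   of p around t. *)
Lemma fourier_inversion p : Cb p -> (norm1 leb p < +oo)%E ->
  (norm1 leb (fourier p) < +oo)%E ->
  forall t, p t = cint leb (fun w => fourier p w * cis (dot w t)).
Proof.
move=> /[dup] cp /[dup] /CbP[_ [M M0 pM]] /Cb_cmeasurable mp fp fph t.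
have mph : cmeasurable (fourier p) by apply: Cb_cmeasurable; exact: Cb_fourier.
pose e (k : nat) : R := k.+1%:R^-1.
have e0 k : 0 < e k by rewrite invr_gt0.
have cvge : e k @[k --> \oo] --> 0 by exact: cvg_harmonic.
pose A k := cint leb (fun w => fourier p w * cis (dot w t) * gauss (e k *: w)).
pose B k := cint leb (fun u => p (e k *: u + t) * gauss u).
have AB k : A k = B k.
  pose Phi (z : 'rV[R]_n * 'rV[R]_n) :=
    p z.2 * cis (- dot z.1 z.2) * (cis (dot z.1 t) * gauss (e k *: z.1)).
  have mPhi : cmeasurable Phi by measurability.
  have fPhi : (norm1 (leb \x leb)%E Phi < +oo)%E.
    rewrite norm1_tonelli1//.
    rewrite (eq_integral (fun w => (norm1 leb p * (normc (gauss (e k *: w)))%:E)%E)); last first.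
      move=> w _; rewrite muleC -norm1Z//; apply: eq_integral => s _.
      by rewrite /Phi/= !Normc.normcM !normc_cis mulr1 mul1r mulrC.
    rewrite ge0_integralZl//; last 3 first.
    - by apply: measurable_enormc; measurability.
    - by move=> w _; rewrite lee_fin normc_ge0.
    - exact: norm1_ge0.
    by rewrite lte_mul_pinfty ?norm1_ge0 ?ge0_fin_numE ?norm1_ge0 ?norm1_gauss_scale ?gt_eqF.
  have -> : A k = cint leb (fun w => cint leb (fun s => Phi (w, s))).
    apply: eq_cint => w; rewrite /Phi/= cintZr ?mulrA//; first by measurability.
    apply: le_lt_trans fp; apply: le_norm1; [by measurability|by []|move=> s].
    by rewrite Normc.normcM normc_cis mulr1.
  rewrite (cint_fubini mPhi fPhi).
  have -> : (fun s => cint leb (fun w => Phi (w, s))) =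
      fun s => p s * ((e k ^- n)%:C * gauss ((e k)^-1 *: (s - t))).
    apply/funext => s; rewrite -cint_gauss_scale_cis// -cintZ; last 2 first.
    - by measurability.
    - apply: le_lt_trans (norm1_gauss_scale (lt0r_neq0 (e0 k))).
      apply: le_norm1; [by measurability|by measurability|move=> w].
      by rewrite Normc.normcM normc_cis mulr1.
    apply: eq_cint => w; rewrite /Phi/= dotBr opprB addrC cisD; ring.
  have mps : cmeasurable (fun s => p s * ((e k ^- n)%:C * gauss ((e k)^-1 *: (s - t)))).
    by measurability.
  rewrite (cint_leb_affine t (lt0r_neq0 (e0 k)) mps); last first.
    have mg : cmeasurable (fun s : 'rV[R]_n => (e k ^- n)%:C * gauss ((e k)^-1 *: (s - t))) by measurability.
    apply: (@le_lt_trans _ _ (norm1 leb (fun s : 'rV[R]_n => (M%:C * (e k ^- n)%:C) * gauss ((e k)^-1 *: s + (- ((e k)^-1 *: t)))))).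
      apply: le_norm1; [by measurability|by measurability|move=> s].
      rewrite -scalerBr -mulrA (Normc.normcM (p s)) (Normc.normcM M%:C) normc_real (ger0_norm M0).
      by rewrite ler_wpM2r ?normc_ge0.
    rewrite norm1Z; last by measurability.
    rewrite lte_mul_pinfty ?lee_fin ?normc_ge0//.
    by apply: norm1_gauss_affine; rewrite invr_eq0 gt_eqF.
  have mpu : cmeasurable (fun u : 'rV[R]_n => p (e k *: u + t)) by measurability.
  rewrite (_ : (fun u => _) = (fun u => (e k ^- n)%:C * (p (e k *: u + t) * gauss u))); last first.
    apply/funext => u; rewrite addrK scalerA mulVf ?gt_eqF// scale1r; ring.
  rewrite cintZ; last 2 first.
  - by measurability.
  - apply: le_lt_trans (_ : (M%:E < +oo)%E); last by rewrite ltry.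
    apply: le_trans _ (norm1_window 0 mpu (fun u => pM _)).
    by apply: le_norm1; [by measurability|by measurability|move=> u; rewrite subr0].
  by rewrite gtr0_norm// mulrA -real_complexM mulfV ?expf_neq0 ?gt_eqF// mul1r.
have gs w : ccvg (fun k => gauss (e k *: w)) 1.
  rewrite -[X in ccvg _ X](_ : gauss (0 : 'rV[R]_n) = 1); last by rewrite /gauss dot0r mulr0 oppr0 expR0.
  apply: ccvg_gauss; apply: cvg_rVP => i; rewrite mxE.
  under eq_fun do rewrite mxE.
  by rewrite -(mul0r (w ord0 i)); apply: cvgM => //; exact: cvg_cst.
have cA : ccvg A (cint leb (fun w => fourier p w * cis (dot w t))).
  apply: (cint_dct (b := fun w => normc (fourier p w))).
  - by move=> k; measurability.
  - by measurability.
  - move=> w; rewrite -[X in ccvg _ X]mulr1; apply: ccvgM => //; exact: ccvg_cst.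
  - exact: integrable_normc.
  - move=> k w; rewrite !Normc.normcM normc_cis mulr1 normc_gauss.
    by rewrite ler_piMr ?normc_ge0// gaussr_le1.
have cB : ccvg B (p t).
  have -> : p t = cint leb (fun u => p t * gauss u).
    by rewrite cintZ ?norm1_gauss ?ltry ?cint_gauss ?mulr1//; measurability.
  apply: (cint_dct (b := fun u => M * gaussr u)).
  - by move=> k; measurability.
  - by measurability.
  - move=> u; apply: ccvgM; last exact: ccvg_cst.
    apply: Cb_seq => //; rewrite -[X in _ --> X]add0r; apply: cvgD; last exact: cvg_cst.
    apply: cvg_rVP => i; rewrite mxE; under eq_fun do rewrite mxE.
    by rewrite -(mul0r (u ord0 i)); apply: cvgM => //; exact: cvg_cst.
  - rewrite (_ : EFin \o _ = (fun t => M%:E * (gaussr t)%:E)%E)//.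
    by apply: integrableZl => //; exact: integrable_gaussr.
  - move=> k u; rewrite Normc.normcM normc_gauss ler_wpM2r// ltW// gaussr_gt0.
    by [].
have BA : B = A by apply/funext => k; rewrite AB.
by rewrite BA in cB; exact: (ccvg_unique cB cA).
Qed.

End stft.

Section gstft_reproduction.
Context {R : realType} {n : nat}.
Local Notation normc := Normc.normc.
Local Notation leb := (@leb R n).
Local Open Scope complex_scope.
Implicit Types (f p : 'rV[R]_n -> R[i]) (x w t : 'rV[R]_n).

Lemma Cb_mul f p : Cb f -> Cb p -> Cb (fun t => f t * p t).
Proof.
move=> /[dup] cf /CbP[_ [M M0 fM]] /[dup] cp /CbP[_ [M' M'0 pM]].
apply: (@CbI _ _ _ (M * M')); first by move=> u a ua; apply: ccvgM; exact: Cb_seq.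
by move=> t; rewrite Normc.normcM ler_pM ?normc_ge0.
Qed.

Lemma Cb_gauss_shift x : Cb (fun t => gauss (t - x)).
Proof.
apply: (@CbI _ _ _ 1); last by move=> t; rewrite normc_gauss gaussr_le1.
by move=> u a ua; apply: ccvg_gauss; apply: cvgB => //; exact: cvg_cst.
Qed.

Definition gstft2 f (z : 'rV[R]_n * 'rV[R]_n) : R[i] := gstft f z.1 z.2.

Lemma gstft2E f z : gstft2 f z = gauss_stft f (row_mx z.1 z.2).
Proof. by rewrite gauss_stftE row_mxKl row_mxKr. Qed.

Lemma cmeasurable_gstft2 f : Cb f -> cmeasurable (gstft2 f).
Proof.
move=> cf; rewrite (_ : gstft2 f = fun z => gauss_stft f (row_mx z.1 z.2)); last first.
  by apply/funext => z; rewrite gstft2E.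
apply: cmeasurable_comp; first exact: measurable_row_mx.
by apply: Cb_cmeasurable; exact: Cb_gauss_stft.
Qed.

Lemma S0_normE f : Cb f -> S0_norm f = norm1 (leb \x leb)%E (gstft2 f).
Proof.
move=> cf; rewrite norm1_tonelli1; last exact: cmeasurable_gstft2.
rewrite /S0_norm (@ge0_integral_leb_row_mx _ n n (fun z => (normc (gauss_stft f z))%:E)).
- apply: eq_integral => x _; apply: eq_integral => w _.
  by rewrite -[row_mx x w]/(row_mx (x, w).1 (x, w).2) -gstft2E.
- by apply: measurable_enormc; apply: Cb_cmeasurable; exact: Cb_gauss_stft.
- by move=> z; rewrite lee_fin normc_ge0.
Qed.

Lemma gstft_inversion f x t : Cb f ->
  (norm1 leb (gstft f x) < +oo)%E ->
  f t * gauss (t - x) = cint leb (fun w => gstft f x w * cis (dot w t)).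
Proof.
move=> /[dup] cf /[dup] /CbP[_ [M M0 fM]] /Cb_cmeasurable mf fF.
apply: (@fourier_inversion _ _ (fun t => f t * gauss (t - x))) => //.
- by apply: Cb_mul => //; exact: Cb_gauss_shift.
- by apply: le_lt_trans (norm1_window x mf fM) _; rewrite ltry.
Qed.

Lemma gstft_reproducing f (h : 'rV[R]_n -> R) (H : R) t : Cb f ->
  (norm1 (leb \x leb)%E (gstft2 f) < +oo)%E ->
  measurable_fun setT h -> (forall x, `|h x| <= H) ->
  f t * cint leb (fun x => (h x)%:C * gauss (t - x)) =
  cint (leb \x leb)%E (fun z => (h z.1)%:C * gstft2 f z * cis (dot z.2 t)).
Proof.
move=> cf fF mh hH; have mF := cmeasurable_gstft2 cf.
have H0 : 0 <= H by apply: le_trans (hH 0).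
have mh' : cmeasurable (fun x => (h x)%:C) by exact: cmeasurable_real.
have mPhi : cmeasurable (fun z : 'rV[R]_n * 'rV[R]_n => (h z.1)%:C * gstft2 f z * cis (dot z.2 t)).
  apply: cmeasurableM; last by measurability.
  apply: cmeasurableM => //; apply: (cmeasurable_comp _ mh'); exact: measurable_fst.
have fPhi : (norm1 (leb \x leb)%E (fun z => (h z.1)%:C * gstft2 f z * cis (dot z.2 t))%R < +oo)%E.
  apply: (@le_lt_trans _ _ (norm1 (leb \x leb)%E (fun z => H%:C * gstft2 f z))).
    apply: le_norm1 => //; first by measurability.
    move=> z; rewrite Normc.normcM normc_cis mulr1 !Normc.normcM !normc_real (ger0_norm H0).
    by rewrite ler_wpM2r ?normc_ge0.
  by rewrite norm1Z// normc_real lte_mul_pinfty ?lee_fin.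
rewrite (cint_fubini1 mPhi fPhi).
have mg : cmeasurable (fun x => (h x)%:C * gauss (t - x)) by measurability.
have mg' : cmeasurable (fun x => H%:C * gauss (t - x)) by measurability.
rewrite -cintZ//; last first.
  apply: (@le_lt_trans _ _ (norm1 leb (fun x => H%:C * gauss (t - x)))).
    apply: le_norm1 => //.
    move=> x; rewrite !Normc.normcM !normc_real (ger0_norm H0).
    by rewrite ler_wpM2r ?normc_ge0.
  rewrite norm1Z; last by measurability.
  rewrite norm1_leb_opp ?norm1_gauss ?mule1 ?ltry//; last by measurability.
apply: ae_eq_cint.
- by measurability.
- exact: (cmeasurable_cint1 mPhi fPhi).
apply: filterS (ae_norm1_F mF fF) => x fx /=.
have mFx : cmeasurable (fun w => gstft2 f (x, w)) by exact: cmeasurable_pair1.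
rewrite mulrCA gstft_inversion// -cintZ; last 2 first.
- by measurability.
- apply: le_lt_trans fx; apply: le_norm1 => //; first by measurability.
  by move=> w; rewrite Normc.normcM normc_cis mulr1.
by apply: eq_cint => w; rewrite mulrA.
Qed.

Lemma normc_le_S0_norm f t : Cb f -> ((normc (f t))%:E <= S0_norm f)%E.
Proof.
move=> cf; rewrite S0_normE//; have mF := cmeasurable_gstft2 cf.
have := leey (norm1 (leb \x leb)%E (gstft2 f)); rewrite le_eqVlt => /predU1P[->|fF].
  by rewrite leey.
have h1 (x : 'rV[R]_n) : `|1 : R| <= 1 by rewrite normr1.
have := gstft_reproducing t cf fF (@measurable_cst _ _ _ _ _ (1 : R)) h1.
rewrite (_ : cint leb _ = 1) => [|]; last first.
  rewrite -(@cint_gauss R n) -(@cint_leb_shift _ _ (- t) (@gauss R n)); last 2 first.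
  - exact: cmeasurable_gauss.
  - by rewrite norm1_gauss ltry.
  by apply: eq_cint => x; rewrite mul1r -(opprB x) /gauss dotNl dotNr opprK.
rewrite mulr1 => ->; apply: le_trans (normc_cint _ _) _.
  by measurability.
apply: le_norm1 => //; first by measurability.
by move=> z; rewrite Normc.normcM normc_cis mulr1 mul1r.
Qed.

Lemma norm1_le_S0_norm f : Cb f -> (norm1 leb f <= S0_norm f)%E.
Proof.
move=> /[dup] cf /Cb_cmeasurable mf; have mF := cmeasurable_gstft2 cf.
rewrite S0_normE// norm1_tonelli1//; apply: ge0_le_integral => //.
- by move=> x _; rewrite lee_fin normc_ge0.
- exact: measurable_enormc.
- exact: measurable_norm1_F.
move=> x _; rewrite -[X in norm1 _ X]/(gstft f x).
have mFx : cmeasurable (gstft f x) by exact: (cmeasurable_pair1 mF x).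
have := leey (norm1 leb (gstft f x)); rewrite le_eqVlt => /predU1P[->|fF].
  by rewrite leey.
have := gstft_inversion x cf fF.
rewrite subrr (_ : gauss 0 = 1); last by rewrite /gauss dot0r mulr0 oppr0 expR0.
rewrite mulr1 => ->; apply: le_trans (normc_cint _ _) _; first by measurability.
apply: le_norm1 => //; first by measurability.
by move=> w; rewrite Normc.normcM normc_cis mulr1.
Qed.

Lemma gauss_mul_shift x y t (a : R) : a ^+ 2 = 2 -> a != 0 ->
  gauss (t - x) * gauss (t - y) =
  gauss (a *: (t - 2^-1 *: (x + y))) * gauss (a^-1 *: (x - y)).
Proof.
move=> a2 a0; rewrite !gaussE -!real_complexM /gaussr -!expRD; congr (expR _)%:C.
rewrite -!opprD -!mulrDr; congr (- (_ * _)).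
rewrite !dotZl !dotZr !mulrA -expr2 a2 -invfM -expr2 a2.
rewrite /dot !mulr_sumr -!big_split; apply: eq_bigr => i _; by rewrite !mxE /=; field.
Qed.

Lemma cint_gauss_scale (a : R) : 0 < a ->
  cint leb (fun t => gauss (a *: t)) = (a ^- n)%:C.
Proof.
move=> a0; have := @cint_gauss_scale_cis R n a 0 a0.
rewrite scaler0 [X in _ * X](_ : _ = 1) ?mulr1 => [<-|]; last first.
  by rewrite /gauss dot0r mulr0 oppr0 expR0.
by apply: eq_cint => t; rewrite dot0r oppr0 cis0 mulr1.
Qed.

Lemma cint_gauss_gauss x y w (a : R) : a ^+ 2 = 2 -> 0 < a ->
  cint leb (fun t => gauss (t - x) * gauss (t - y) * cis (- dot t w)) =
  cis (- dot (2^-1 *: (x + y)) w) *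
    ((a ^- n)%:C * gauss (a^-1 *: w) * gauss (a^-1 *: (x - y))).
Proof.
move=> a2 a0; have a00 : a != 0 by rewrite gt_eqF.
set m := 2^-1 *: (x + y).
have mh : cmeasurable (fun t => gauss (a *: t) * cis (- dot t w)) by measurability.
have fh : (norm1 leb (fun t => gauss (a *: t) * cis (- dot t w))%R < +oo)%E.
  apply: le_lt_trans (norm1_gauss_scale a00).
  apply: le_norm1; [by []|by measurability|move=> t].
  by rewrite Normc.normcM normc_cis mulr1.
transitivity (cint leb (fun t =>
  (cis (- dot m w) * gauss (a^-1 *: (x - y))) * (gauss (a *: (t - m)) * cis (- dot (t - m) w)))).
  apply: eq_cint => t; rewrite (gauss_mul_shift x y t a2 a00) -/m.
  have -> : cis (- dot t w) = cis (- dot m w) * cis (- dot (t - m) w).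
    by rewrite -cisD; congr cis; rewrite dotBl; ring.
  ring.
rewrite cintZ; last 2 first.
- by measurability.
- have := norm1_leb_shift (- m) mh => ->; exact: fh.
have := cint_leb_shift (- m) mh fh => ->.
by rewrite cint_gauss_scale_cis//; ring.
Qed.

(* The reproducing formula with [h x = gauss (t - x)], transformed at (y, v). *)
Lemma gstft2_kernel_bound f (a : R) (y v : 'rV[R]_n) : a ^+ 2 = 2 -> 0 < a -> Cb f ->
  (norm1 (leb \x leb)%E (gstft2 f) < +oo)%E ->
  ((normc (gstft2 f (y, v)))%:E <= \int[leb \x leb]_z (normc (gstft2 f z) *
     (gaussr (a^-1 *: (z.1 - y)) * gaussr (a^-1 *: (z.2 - v))))%:E)%E.
Proof.
move=> a2 a0 cf fF; have a00 : a != 0 by rewrite gt_eqF.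
have [_ [M M0 fM]] := (CbP f).1 cf; have mf := Cb_cmeasurable cf.
have mF := cmeasurable_gstft2 cf.
pose c := (a ^- n)%:C : R[i].
have nc : normc c = a ^- n by rewrite normc_real ger0_norm// invr_ge0 exprn_ge0// ltW.
have c0 : 0 < a ^- n by rewrite invr_gt0 exprn_gt0.
have fc t : f t * c = cint (leb \x leb)%E
    (fun z => gauss (t - z.1) * gstft2 f z * cis (dot z.2 t)).
  have mh : measurable_fun setT (fun x => gaussr (t - x)) by measurability.
  have hH x : `|gaussr (t - x)| <= 1.
    by rewrite gtr0_norm ?gaussr_gt0// gaussr_le1.
  rewrite -(gstft_reproducing t cf fF mh hH); congr (_ * _).
  rewrite /c -cint_gauss_scale// -(@cint_leb_shift _ _ (- t) (fun t => gauss (a *: t))); last 2 first.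
  - by measurability.
  - exact: norm1_gauss_scale.
  apply: eq_cint => x; rewrite -gaussE -(opprB x) ![gauss (- _)]gaussE gaussrN -!gaussE.
  rewrite (gauss_mul_shift t t x a2 a00) subrr scaler0.
  rewrite [X in _ * X](_ : _ = 1) ?mulr1; last by rewrite /gauss dot0r mulr0 oppr0 expR0.
  by rewrite (_ : 2^-1 *: (t + t) = t)//; apply/rowP => i; rewrite !mxE; field.
pose Phi (q : 'rV[R]_n * ('rV[R]_n * 'rV[R]_n)) := gauss (q.1 - q.2.1) * gstft2 f q.2 *
  cis (dot q.2.2 q.1) * (gauss (q.1 - y) * cis (- dot v q.1)).
have PhiE t z : Phi (t, z) = gauss (t - z.1) * gstft2 f z * cis (dot z.2 t) *
  (gauss (t - y) * cis (- dot v t)) by [].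
have mPhi : cmeasurable Phi by measurability.
have fPhi : (norm1 (leb \x @leb2 R n)%E Phi < +oo)%E.
  rewrite norm1_tonelli2//.
  apply: le_lt_trans fF; apply: ge0_le_integral => //.
  - by move=> z _; exact: norm1_ge0.
  - exact: measurable_norm1_G.
  - exact: measurable_enormc.
  move=> z _; rewrite -[leRHS]mule1 -(@norm1_gauss R n) -(norm1_leb_shift (- y)); last by measurability.
  rewrite -[(normc _)%:E]/((normc (gstft2 f z))%:E) -norm1Z; last by measurability.
  apply: le_norm1; [by measurability|by measurability|move=> t].
  rewrite PhiE !Normc.normcM !normc_cis !mulr1 mulrAC [leRHS]mulrC ler_wpM2r ?normc_ge0//.
  by rewrite ler_piMl ?normc_ge0// normc_gauss gaussr_le1.
have main : gstft2 f (y, v) * c = cint (leb \x leb)%E (fun z => gstft2 f z *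
    (cis (- dot (2^-1 *: (z.1 + y)) (v - z.2)) *
    (c * gauss (a^-1 *: (v - z.2)) * gauss (a^-1 *: (z.1 - y))))).
  rewrite -[gstft2 f (y, v)]/(cint leb (fun t => f t * gauss (t - y) * cis (- dot v t))).
  rewrite -cintZr; last 2 first.
  - by measurability.
  - apply: le_lt_trans (_ : (M%:E < +oo)%E); last by rewrite ltry.
    apply: le_trans _ (norm1_window y mf fM).
    apply: le_norm1; [by measurability|by measurability|move=> t].
    by rewrite Normc.normcM normc_cis mulr1.
  transitivity (cint leb (fun t => cint (leb \x leb)%E (fun z => Phi (t, z)))).
    apply: eq_cint => t; under [RHS]eq_cint do rewrite PhiE; rewrite cintZr; last 2 first.
    - by measurability.
    - apply: le_lt_trans fF; apply: le_norm1; [by measurability|by measurability|move=> z].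
      rewrite !Normc.normcM normc_cis mulr1 ler_piMl ?normc_ge0//.
      by rewrite normc_gauss gaussr_le1.
    by rewrite -fc; ring.
  rewrite (cint_fubini mPhi fPhi); apply: eq_cint => z.
  rewrite -cint_gauss_gauss// -cintZ; last 2 first.
  - by measurability.
  - apply: (@le_lt_trans _ _ (norm1 leb (fun t => gauss (t - y)))).
      apply: le_norm1; [by measurability|by measurability|move=> t].
      rewrite !Normc.normcM normc_cis mulr1 ler_piMl ?normc_ge0//.
      by rewrite normc_gauss gaussr_le1.
    by rewrite norm1_leb_shift ?norm1_gauss ?ltry//; exact: cmeasurable_gauss.
  apply: eq_cint => t; rewrite PhiE.
  have -> : - dot t (v - z.2) = dot z.2 t + (- dot v t).
    by rewrite dotBr (dotC t) (dotC t); ring.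
  by rewrite cisD; ring.
have : ((normc (gstft2 f (y, v) * c))%:E <= (a ^- n)%:E *
    \int[leb \x leb]_z (normc (gstft2 f z) *
     (gaussr (a^-1 *: (z.1 - y)) * gaussr (a^-1 *: (z.2 - v))))%:E)%E.
  rewrite main; apply: le_trans (normc_cint _ _) _; first by measurability.
  rewrite -ge0_integralZl//; last 3 first.
  - apply/measurable_EFinP; apply: measurable_funM; first exact: measurable_normc.
    by apply: measurable_funM; measurability.
  - move=> z _; rewrite lee_fin mulr_ge0 ?normc_ge0//.
    by rewrite mulr_ge0// ltW// gaussr_gt0.
  - by rewrite lee_fin ltW.
  rewrite /norm1 le_eqVlt; apply/orP; left; apply/eqP; apply: eq_integral => z _.
  rewrite !Normc.normcM normc_cis mul1r nc !normc_gauss -EFinM; congr EFin.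
  rewrite -(opprB z.2 v) scalerN gaussrN; ring.
rewrite Normc.normcM nc mulrC EFinM lee_pmul2l ?lte_fin//.
Qed.

End gstft_reproduction.

(** * Integrability of a kernel-dominated function and its Wiener norm *)

Section countable_partition.
Context {R : realType} d {T : measurableType d} {J : countType}.
Variable mu : {measure set T -> \bar R}.
Local Open Scope ereal_scope.

Lemma ge0_integral_partition (cell : J -> set T) (f : T -> \bar R) :
  (forall k, measurable (cell k)) -> trivIset setT cell ->
  \bigcup_k cell k = setT -> measurable_fun setT f -> (forall t, 0 <= f t) ->
  \int[mu]_t f t = \esum_(k in [set: J]) \int[mu]_(t in cell k) f t.
Proof.
move=> mc tc cT mf f0.
pose G (i : nat) := if @choice.pickle_inv J i is Some k then cell k else set0.
have GT : \bigcup_i G i = setT.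
  rewrite -cT; apply/seteqP; split => [t [i _]|t [k _ kt]].
    by rewrite /G; case: pickle_inv => // k kt; exists k.
  by exists (choice.pickle k) => //; rewrite /G pickleK_inv.
have mG i : measurable (G i).
  by rewrite /G; case: pickle_inv.
have tG : trivIset setT G.
  apply/trivIsetP => i j _ _ ij; rewrite /G.
  case Ei : (pickle_inv i) => [k|]; last by rewrite set0I.
  case Ej : (pickle_inv j) => [l|]; last by rewrite setI0.
  have kl : k != l.
    apply: contra ij => /eqP kl; have := @pickle_invK J i; have := @pickle_invK J j.
    by rewrite Ei Ej /= kl => -> ->.
  by move/trivIsetP : tc => /(_ k l I I kl).
rewrite -[in LHS]GT ge0_integral_bigcup//; last by rewrite GT.
rewrite nneseries_esumT; last by move=> i; apply: integral_ge0.
transitivity (\esum_(i in range (@choice.pickle J)) \int[mu]_(x in G i) f x).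
  rewrite [RHS]esum_mkcond; apply: eq_esum => i _; case: ifPn => // /negP.
  rewrite inE /G; case Ei : (pickle_inv i) => [k|] h; last by rewrite integral_set0.
  by exfalso; apply: h; exists k => //; have := @pickle_invK J i; rewrite Ei.
rewrite (@reindex_esum R J nat setT (range (@choice.pickle J)) (@choice.pickle J)); last first.
  by split.
by apply: eq_esum => k _; rewrite /G pickleK_inv.
Qed.

End countable_partition.

Section tent_cells.
Context {R : realType} {n : nat}.
Local Notation normc := Normc.normc.
Local Notation leb := (@leb R n).
Local Open Scope complex_scope.

Definition cube : set 'rV[R]_n :=
  [set t | forall i, `[- 4^-1, 4^-1[%classic (t ord0 i)].

Definition node (k : 'rV[int]_n) : 'rV[R]_n := 2^-1 *: map_mx intr k.

Definition cell (k : 'rV[int]_n) : set 'rV[R]_n := [set u | cube (u - node k)].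

Lemma cellP k u : cell k u <-> forall i, - 4^-1 <= u ord0 i - 2^-1 * (k ord0 i)%:~R < 4^-1.
Proof.
by split => h i; have := h i; rewrite /cell/= !mxE/= in_itv/=.
Qed.

Lemma measurable_cell k : measurable (cell k).
Proof.
have mc : measurable cube by apply: measurable_cube; exact: measurable_itv.
have := measurable_affine_rV 1 (- node k) measurableT mc.
rewrite setTI; congr (measurable _); apply/funext => u /=.
by rewrite scale1r.
Qed.

Lemma trivIset_cell : trivIset setT cell.
Proof.
apply/trivIsetP => k l _ _ kl; rewrite -subset0 => u [/cellP ku /cellP lu].
move/eqP : kl; apply; apply/rowP => i.
have /andP[k1 k2] := ku i; have /andP[l1 l2] := lu i.
have h1 : ((k ord0 i)%:~R : R) < (l ord0 i + 1)%:~R by rewrite intrD; lra.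
have h2 : ((l ord0 i)%:~R : R) < (k ord0 i + 1)%:~R by rewrite intrD; lra.
by move: h1 h2; rewrite !ltr_int !ltzD1 => h1 h2; apply/eqP; rewrite eq_le h1 h2.
Qed.

Lemma bigcup_cell : \bigcup_k cell k = setT.
Proof.
rewrite -subTset => u _; exists (\row_i Num.floor (2 * u ord0 i + 2^-1)) => //.
apply/cellP => i; rewrite mxE.
have /andP[] := floor_itv (2 * u ord0 i + 2^-1).
rewrite intrD => h1 h2; apply/andP; split; lra.
Qed.

Lemma leb_cell k : leb (cell k) = (2^-1 ^+ n)%:E.
Proof.
have mc : measurable cube by apply: measurable_cube; exact: measurable_itv.
have <- : leb cube = (2^-1 ^+ n)%:E.
  rewrite leb_cube//= lebesgue_measure_itv/= lte_fin ifT; last by lra.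
  by rewrite -EFinB -EFin_expe; congr EFin; congr (_ ^+ n); field.
have := ge0_integral_leb_affine (- node k) (oner_neq0 R)
  (f := fun t => (\1_cube t)%:E).
rewrite normr1 expr1n mul1e integral_indic// setIT => ->.
- rewrite -[RHS]/(\int[leb]_t (\1_cube (1 *: t - node k))%:E)%E.
  rewrite -(setIT (cell k)) -integral_indic//; last exact: measurable_cell.
  by apply: eq_integral => t _; rewrite scale1r.
- by apply/measurable_EFinP; exact: measurable_indic.
- by move=> t; rewrite lee_fin.
Qed.

Lemma psi_itv (k : 'rV[int]_n) (t : 'rV[R]_n) : 0 <= psi k t <= 1.
Proof.
rewrite /psi /tent; elim/big_ind: _ => //.
- by rewrite ler01 lexx.
- by move=> x y /andP[x0 x1] /andP[y0 y1]; rewrite mulr_ge0// mulr_ile1.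
- by move=> i _; rewrite le_max lexx orbT ge_max ler01 andbT; have := normr_ge0 ((t - 2^-1 *: map_mx intr k) ord0 i); lra.
Qed.

Lemma psi_ge (k : 'rV[int]_n) (t : 'rV[R]_n) : cell k t -> 2^-1 ^+ n <= psi k t.
Proof.
move=> /cellP kt; have -> : 2^-1 ^+ n = \prod_(j < n) (2^-1 : R) by rewrite prodr_const card_ord.
rewrite /psi /tent; apply: ler_prod => i _; rewrite invr_ge0 ler0n/= le_max.
apply/orP; left; rewrite !mxE; have := kt i => /andP[k1 k2].
suff : `|t ord0 i - 2^-1 * (k ord0 i)%:~R| <= 4^-1 by lra.
by rewrite ler_norml k1 ltW.
Qed.

Lemma psi_neq0 (k : 'rV[int]_n) (t : 'rV[R]_n) : psi k t != 0 -> forall i,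
  `|t ord0 i - 2^-1 * (k ord0 i)%:~R| < 2^-1.
Proof.
move=> h i; rewrite ltNge; apply: contra h => h.
rewrite /psi /tent (bigD1 i)//= !mxE [X in X * _](_ : _ = 0) ?mul0r//.
by apply/eqP; rewrite eq_maxr//; lra.
Qed.

Let two_gt0 : 0 < (2 ^+ n : R). Proof. by rewrite exprn_gt0. Qed.

Lemma wiener_norm1 (F : 'rV[R]_n -> R[i]) : Cb F -> (wiener_norm F < +oo)%E ->
  (norm1 leb F < +oo)%E.
Proof.
move=> /Cb_cmeasurable mF wF.
have c0 : 0 < (2^-1 ^+ n : R) by rewrite exprn_gt0// invr_gt0.
pose G u := (2^-1 ^+ n)%:C * F u.
have mG : cmeasurable G by measurability.
suff : (norm1 leb G < +oo)%E.
  rewrite norm1Z// normc_real gtr0_norm// !ltey; apply: contra => /eqP ->.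
  by rewrite gt0_muley// lte_fin.
apply: le_lt_trans wF; rewrite /norm1.
rewrite (ge0_integral_partition _ measurable_cell trivIset_cell bigcup_cell); last 2 first.
- exact: measurable_enormc.
- by move=> t; rewrite lee_fin normc_ge0.
apply: le_esum => k _; set s := supnorm _.
have s0 : (0 <= s)%E.
  by apply: le_trans (normc_le_supnorm _ 0); rewrite lee_fin normc_ge0.
apply: (@le_trans _ _ (\int[leb]_(t in cell k) s)%E).
  apply: ge0_le_integral => //; first exact: measurable_cell.
  - by move=> t _; rewrite lee_fin normc_ge0.
  - by apply: measurable_funTS; exact: measurable_enormc.
  move=> t kt; apply: le_trans (normc_le_supnorm _ t).
  have /andP[p0 p1] := psi_itv k t.
  rewrite lee_fin !Normc.normcM !normc_real mulrC ler_wpM2l ?normc_ge0//.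
  by rewrite !ger0_norm// ?psi_ge// ltW.
rewrite integral_cst; last exact: measurable_cell.
rewrite -[leLHS]/(s * leb (cell k))%E leb_cell -[leRHS]mule1 lee_wpmul2l//.
by rewrite lee_fin exprn_ile1// ?invr_ge0// invf_le1// ler1n.
Qed.

Lemma gaussr_translate_le (b : R) (x z u : 'rV[R]_n) :
  (forall i, `|z ord0 i - u ord0 i| <= 1) ->
  gaussr (b *: (x - z)) <= expR (pi * (b ^+ 2 * n%:R)) * gaussr ((b / 2) *: (x - u)).
Proof.
move=> zu.
have D : dot (x - u) (x - u) <= 4 * (n%:R + dot (x - z) (x - z)).
  have -> : n%:R = \sum_(i < n) (1 : R) by rewrite sumr_const card_ord.
  rewrite /dot -big_split mulr_sumr; apply: ler_sum => i _; rewrite !mxE /=.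
  have : (z ord0 i - u ord0 i) ^+ 2 <= 1 by rewrite -real_normK ?num_real// expr_le1.
  have := sqr_ge0 (x ord0 i - z ord0 i - (z ord0 i - u ord0 i)); nra.
rewrite /gaussr -expRD ler_expR -!mulrN -mulrDr ler_wpM2l ?pi_ge0//.
have dotZ2 c (v : 'rV[R]_n) : dot (c *: v) (c *: v) = c ^+ 2 * dot v v.
  by rewrite dotZl dotZr mulrA expr2.
rewrite !dotZ2 [(b / 2) ^+ 2](_ : _ = b ^+ 2 / 4); last by field.
have := ler_wpM2l (sqr_ge0 b) D.
move: (dot _ _) (dot _ _) (b ^+ 2) => p q r; lra.
Qed.

(* For u in the cell of k, every z in the support of [psi k] is within sup
   distance 1 of u, so the sup over z is at most a constant times [J u]. Averaging
   over u in the cell and summing over k gives the integral of [J]. *)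
Lemma wiener_of_kernel (F : 'rV[R]_n -> R[i]) (b : R) : 0 < b -> Cb F ->
  (norm1 leb F < +oo)%E ->
  (forall z, ((normc (F z))%:E <=
     \int[leb]_x (normc (F x) * gaussr (b *: (x - z)))%:E)%E) ->
  (wiener_norm F < +oo)%E.
Proof.
move=> b0 /Cb_cmeasurable mF fF Fker.
pose H (p : 'rV[R]_n * 'rV[R]_n) := F p.2 * gauss ((b / 2) *: (p.2 - p.1)).
have mH : cmeasurable H by measurability.
pose J u := norm1 leb (fun x => H (u, x)).
have mJ : measurable_fun setT J by exact: measurable_norm1_F.
have J0 u : (0 <= J u)%E by exact: norm1_ge0.
have b20 : b / 2 != 0 by rewrite mulf_neq0 ?invr_eq0 ?gt_eqF.
have fJ : (\int[leb]_u J u < +oo)%E.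
  rewrite -norm1_tonelli1// norm1_tonelli2//.
  rewrite (eq_integral (fun x => (norm1 leb (fun t => gauss ((b / 2) *: t)) * (normc (F x))%:E)%E)).
    rewrite ge0_integralZl//; last 3 first.
    - exact: measurable_enormc.
    - by move=> x _; rewrite lee_fin normc_ge0.
    - exact: norm1_ge0.
    by rewrite lte_mul_pinfty ?norm1_ge0 ?ge0_fin_numE ?norm1_ge0 ?norm1_gauss_scale.
  move=> x _; rewrite muleC -(@norm1_leb_opp _ _ x (fun t => gauss ((b / 2) *: t))); last by measurability.
  by rewrite -norm1Z//; measurability.
pose E := expR (pi * (b ^+ 2 * n%:R)) : R.
have E0 : 0 < E by exact: expR_gt0.
have FJ k z u : cell k u -> ((normc (F z * (psi k z)%:C))%:E <= E%:E * J u)%E.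
  move=> /cellP ku; have [->|/psi_neq0 pz] := eqVneq (psi k z) 0.
    by rewrite mulr0 Normc.normc0 mule_ge0// lee_fin ltW.
  have /andP[p0 p1] := psi_itv k z.
  apply: (@le_trans _ _ (normc (F z))%:E).
    by rewrite lee_fin Normc.normcM normc_real ger0_norm// ler_piMr ?normc_ge0.
  apply: le_trans (Fker z) _.
  rewrite /J /norm1 -ge0_integralZl//; last 3 first.
  - by apply: measurable_enormc; apply: cmeasurable_pair1.
  - by move=> x _; rewrite lee_fin normc_ge0.
  - by rewrite lee_fin ltW.
  apply: ge0_le_integral => //.
  - by move=> x _; rewrite lee_fin mulr_ge0 ?normc_ge0// ltW// gaussr_gt0.
  - apply/measurable_EFinP; apply: measurable_funM; first exact: measurable_normc.
    by measurability.
  - apply: measurable_funeM; apply: measurable_enormc; exact: cmeasurable_pair1.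
  move=> x _; rewrite -EFinM lee_fin /H/= Normc.normcM normc_gauss mulrCA.
  rewrite ler_wpM2l ?normc_ge0// gaussr_translate_le// => i.
  have := pz i; have /andP[k1 k2] := ku i.
  by rewrite ltr_norml => /andP[z1 z2]; rewrite ler_norml; apply/andP; split; lra.
have mf : measurable_fun setT (fun u => (2 ^+ n * E)%:E * J u)%E.
  exact: measurable_funeM.
have f0 u : (0 <= (2 ^+ n * E)%:E * J u)%E.
  by rewrite mule_ge0// lee_fin mulr_ge0// ltW.
apply: (@le_lt_trans _ _ (\int[leb]_u ((2 ^+ n * E)%:E * J u))%E); last first.
  rewrite ge0_integralZl//; last by rewrite lee_fin mulr_ge0// ltW.
  by rewrite lte_mul_pinfty// lee_fin mulr_ge0// ltW.
rewrite (ge0_integral_partition _ measurable_cell trivIset_cell bigcup_cell mf f0).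
apply: le_esum => k _; set s := supnorm _.
have s0 : (0 <= s)%E.
  by apply: le_trans (normc_le_supnorm _ 0); rewrite lee_fin normc_ge0.
have -> : s = (\int[leb]_(t in cell k) ((2 ^+ n)%:E * s))%E.
  rewrite integral_cst; last exact: measurable_cell.
  rewrite -[RHS]/((2 ^+ n)%:E * s * leb (cell k))%E leb_cell muleAC -EFinM.
  by rewrite -exprMn divff ?pnatr_eq0// expr1n mul1e.
apply: ge0_le_integral => //.
- exact: measurable_cell.
- by move=> t _; rewrite mule_ge0// lee_fin ltW.
- exact: measurable_funTS.
move=> u ku; rewrite EFinM -muleA lee_wpmul2l ?lee_fin ?(ltW two_gt0)//.
by rewrite /s; apply: supnorm_le => z; exact: FJ.
Qed.

End tent_cells.

(** * Invariance and algebra structures on S0 *)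

Section S0.
Context {R : realType} {n : nat}.
Local Notation normc := Normc.normc.
Local Notation leb := (@leb R n).
Local Notation leb2 := (@leb2 R n).
Local Open Scope complex_scope.
Implicit Types (f g h p : 'rV[R]_n -> R[i]) (x w t : 'rV[R]_n).

Lemma dot_row_mx (x w y v : 'rV[R]_n) :
  dot (row_mx x w) (row_mx y v) = dot x y + dot w v.
Proof.
rewrite /dot big_split_ord; congr (_ + _); apply: eq_bigr => i _.
  by rewrite !row_mxEl.
by rewrite !row_mxEr.
Qed.

Lemma gaussr_row_mx (b : R) (x w y v : 'rV[R]_n) :
  gaussr (b *: (row_mx x w - row_mx y v)) =
  gaussr (b *: (x - y)) * gaussr (b *: (w - v)).
Proof.
rewrite opp_row_mx add_row_mx scale_row_mx /gaussr dot_row_mx -expRD.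
by rewrite mulrDr opprD.
Qed.

Lemma S0_norm_leb2 f : Cb f -> S0_norm f = norm1 leb2 (gstft2 f).
Proof. exact: S0_normE. Qed.

Lemma S0P f : S0 f <-> Cb f /\ (S0_norm f < +oo)%E.
Proof.
split=> [[cf [cF wF]]|[cf fF]]; first by split => //; exact: (wiener_norm1 cF wF).
have cF := Cb_gauss_stft cf.
split => //; split => //.
have s0 : 0 < Num.sqrt (2 : R) by rewrite sqrtr_gt0.
have s2 : Num.sqrt (2 : R) ^+ 2 = 2 by rewrite sqr_sqrtr.
apply: (@wiener_of_kernel _ _ _ (Num.sqrt 2)^-1) => //.
move=> z; rewrite -(hsubmxK z).
have fF2 : (norm1 (leb \x leb)%E (gstft2 f) < +oo)%E by rewrite -S0_normE.
have := gstft2_kernel_bound (lsubmx z) (rsubmx z) s2 s0 cf fF2.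
rewrite gstft2E -[row_mx _ _]/(row_mx (lsubmx z) (rsubmx z)) => /le_trans; apply.
have mF := cmeasurable_gstft2 cf.
rewrite fubini_tonelli1; last 2 first.
- apply/measurable_EFinP; apply: measurable_funM; first exact: measurable_normc.
  by apply: measurable_funM; measurability.
- by move=> p; rewrite lee_fin !mulr_ge0 ?normc_ge0// ltW// gaussr_gt0.
rewrite ge0_integral_leb_row_mx; last 2 first.
- apply/measurable_EFinP; apply: measurable_funM; last by measurability.
  by apply: measurable_normc; exact: Cb_cmeasurable.
- by move=> p; rewrite lee_fin !mulr_ge0 ?normc_ge0// ltW// gaussr_gt0.
rewrite le_eqVlt; apply/orP; left; apply/eqP.
apply: eq_integral => x _; apply: eq_integral => w _.
by rewrite gaussr_row_mx gstft2E.
Qed.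

Lemma S0_norm_ge0 f : (0 <= S0_norm f)%E.
Proof. by apply: integral_ge0 => z _; rewrite lee_fin normc_ge0. Qed.

Lemma S0_norm_fin_num f : S0 f -> S0_norm f \is a fin_num.
Proof. by move=> /S0P[_ ff]; rewrite ge0_fin_numE// S0_norm_ge0. Qed.

Lemma S0_norm1_lty f : S0 f -> (norm1 leb f < +oo)%E.
Proof. by move=> /S0P[cf]; apply: le_lt_trans; exact: norm1_le_S0_norm. Qed.

Lemma S0_Cb f : S0 f -> Cb f. Proof. by case. Qed.

Lemma S0_gstft2_lty f : S0 f -> (norm1 leb2 (gstft2 f) < +oo)%E.
Proof. by move=> /S0P[cf]; rewrite S0_norm_leb2. Qed.

Lemma norm1_bounded_mul (f g : 'rV[R]_n -> R[i]) (M : R) :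
  cmeasurable f -> cmeasurable g -> (forall t, normc (f t) <= M) ->
  (norm1 leb (fun t => f t * g t)%R <= M%:E * norm1 leb g)%E.
Proof.
move=> mf mg fM; have M0 : 0 <= M by apply: le_trans (fM 0); exact: normc_ge0.
have -> : (M%:E * norm1 leb g = norm1 leb (fun t => M%:C * g t)%R)%E.
  by rewrite norm1Z// normc_real ger0_norm.
apply: le_norm1; [by measurability|by measurability|move=> t].
by rewrite !Normc.normcM normc_real (ger0_norm M0) ler_wpM2r ?normc_ge0.
Qed.

Lemma norm1_leb2_shift (F : 'rV[R]_n * 'rV[R]_n -> R[i]) a b : cmeasurable F ->
  norm1 leb2 (fun z => F (z.1 + a, z.2 + b)) = norm1 leb2 F.
Proof.
move=> mF.
have mFs : cmeasurable (fun z : 'rV[R]_n * 'rV[R]_n => F (z.1 + a, z.2 + b)).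
  apply: (cmeasurable_comp _ mF).
  apply/measurable_fun_pairP; split; by measurability.
rewrite [LHS](norm1_tonelli1 _ _ mFs) [RHS](norm1_tonelli1 _ _ mF).
transitivity (\int[leb]_x norm1 leb (fun w => F ((x + a)%R, w)))%E.
  apply: eq_integral => x _.
  by rewrite (norm1_leb_shift b (f := fun w => F (x + a, w)))//; exact: cmeasurable_pair1.
have := ge0_integral_leb_affine a (oner_neq0 R) (measurable_norm1_F leb mF)
  (fun x => norm1_ge0 _ _).
rewrite normr1 expr1n mul1e => ->.
by apply: eq_integral => x _; rewrite scale1r.
Qed.

Lemma cint_gauss_shift_cis x v :
  cint leb (fun t => gauss (t - x) * cis (- dot v t)) = cis (- dot v x) * gauss v.
Proof.
have mg : cmeasurable (fun t => gauss t * cis (- dot v t)) by measurability.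
have fg : (norm1 leb (fun t => gauss t * cis (- dot v t))%R < +oo)%E.
  apply: le_lt_trans (_ : (norm1 leb (@gauss R n) < +oo)%E); last by rewrite norm1_gauss ltry.
  apply: le_norm1; [by []|exact: cmeasurable_gauss|move=> t].
  by rewrite Normc.normcM normc_cis mulr1.
rewrite -[in RHS]cint_gauss_cis -(cint_leb_shift (- x) mg fg) -cintZ; last 2 first.
- by measurability.
- by have := norm1_leb_shift (- x) mg => ->.
apply: eq_cint => t; rewrite [RHS]mulrCA -cisD; congr (_ * cis _).
by rewrite dotBr; ring.
Qed.

Lemma gstft_fourier f x w : S0 f ->
  gstft (fourier f) x w = cis (- dot w x) * gstft f (- w) x.
Proof.
move=> /[dup] /S0_norm1_lty ff /[dup] sf /S0_Cb /[dup] cf /Cb_cmeasurable mf.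
pose Phi (q : 'rV[R]_n * 'rV[R]_n) :=
  f q.2 * cis (- dot q.1 q.2) * (gauss (q.1 - x) * cis (- dot w q.1)).
have mPhi : cmeasurable Phi by measurability.
have PhiE t s : Phi (t, s) = f s * cis (- dot t s) * (gauss (t - x) * cis (- dot w t)) by [].
have fPhi : (norm1 (leb \x leb)%E Phi < +oo)%E.
  rewrite norm1_tonelli2//; apply: le_lt_trans ff; apply: ge0_le_integral => //.
  - by move=> s _; exact: norm1_ge0.
  - exact: measurable_norm1_G.
  - exact: measurable_enormc.
  move=> s _; rewrite -[leRHS]mule1 -(@norm1_gauss R n) -(norm1_leb_shift (- x)); last by measurability.
  rewrite -[(normc _)%:E]/((normc (f s))%:E) -norm1Z; last by measurability.
  apply: le_norm1; [by measurability|by measurability|move=> t].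
  by rewrite PhiE !Normc.normcM !normc_cis !mulr1.
transitivity (cint leb (fun t => cint leb (fun s => Phi (t, s)))).
  apply: eq_cint => t; under [RHS]eq_cint do rewrite PhiE.
  rewrite cintZr ?mulrA//; first by measurability.
  apply: le_lt_trans ff; apply: le_norm1; [by measurability|by []|move=> s].
  by rewrite Normc.normcM normc_cis mulr1.
rewrite (cint_fubini mPhi fPhi) -cintZ; last 2 first.
- by measurability.
- have [_ [M M0 fM]] := (CbP f).1 cf.
  apply: le_lt_trans (_ : (M%:E < +oo)%E); last by rewrite ltry.
  apply: le_trans _ (norm1_window (- w) mf fM).
  apply: le_norm1; [by measurability|by measurability|move=> s].
  by rewrite Normc.normcM normc_cis mulr1.
apply: eq_cint => s.
transitivity (f s * cint leb (fun t => gauss (t - x) * cis (- dot (s + w) t))).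
  rewrite -cintZ; last 2 first.
  - by measurability.
  - apply: (@le_lt_trans _ _ (norm1 leb (fun t => gauss (t - x)))).
      apply: le_norm1; [by measurability|by measurability|move=> t].
      by rewrite Normc.normcM normc_cis mulr1.
    by rewrite norm1_leb_shift ?norm1_gauss ?ltry//; exact: cmeasurable_gauss.
  apply: eq_cint => t; rewrite PhiE dotDl opprD cisD (dotC s); ring.
rewrite cint_gauss_shift_cis opprK dotDl opprD cisD (dotC s); ring.
Qed.

Lemma S0_norm_fourier f : S0 f -> S0_norm (fourier f) = S0_norm f.
Proof.
move=> /[dup] /S0_norm1_lty ff /[dup] sf /S0_Cb /[dup] cf /Cb_cmeasurable mf.
have cff : Cb (fourier f) by exact: Cb_fourier.
have mF := cmeasurable_gstft2 cf; have mFf := cmeasurable_gstft2 cff.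
rewrite (S0_norm_leb2 cff) (S0_norm_leb2 cf) [LHS](norm1_tonelli2 _ _ mFf) [RHS](norm1_tonelli1 _ _ mF).
have N10 : (-1 : R) != 0 by rewrite oppr_eq0 oner_neq0.
have := ge0_integral_leb_affine 0 N10 (measurable_norm1_F leb mF)
  (fun x => norm1_ge0 _ _).
rewrite normrN1 expr1n mul1e => e; rewrite [RHS]e.
apply: eq_integral => w _; rewrite addr0 scaleN1r; apply: eq_integral => x _.
rewrite -[gstft2 (fourier f) _]/(gstft (fourier f) x w) -[gstft2 f _]/(gstft f (- w) x).
by rewrite (gstft_fourier x w sf) Normc.normcM normc_cis mul1r.
Qed.

Lemma S0_fourier f : S0 f -> S0 (fourier f) /\ S0_norm (fourier f) = S0_norm f.
Proof.
move=> sf; have e := S0_norm_fourier sf; split; last exact: e.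
apply/S0P; split; last by rewrite e; case/S0P : sf.
by apply: Cb_fourier; [exact: Cb_cmeasurable (S0_Cb sf)|exact: S0_norm1_lty].
Qed.

Lemma gstft_modulation_translation f x0 w0 x w : Cb f ->
  gstft (modulation w0 (translation x0 f)) x w =
  cis (dot (w0 - w) x0) * gstft f (x - x0) (w - w0).
Proof.
move=> /[dup] cf /Cb_cmeasurable mf; have [_ [M M0 fM]] := (CbP f).1 cf.
have mk : cmeasurable (fun t => f t * gauss (t - (x - x0)) * cis (- dot (w - w0) t)).
  by measurability.
have fk : (norm1 leb (fun t => f t * gauss (t - (x - x0)) * cis (- dot (w - w0) t))%R < +oo)%E.
  apply: le_lt_trans (_ : (M%:E < +oo)%E); last by rewrite ltry.
  apply: le_trans _ (norm1_window (x - x0) mf fM).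
  apply: le_norm1; [by measurability|by measurability|move=> s].
  by rewrite Normc.normcM normc_cis mulr1.
rewrite /gstft -(cint_leb_shift (- x0) mk fk) -cintZ; last 2 first.
- by measurability.
- by have := norm1_leb_shift (- x0) mk => ->.
apply: eq_cint => t; rewrite /modulation /translation.
rewrite (_ : t - x0 - (x - x0) = t - x); last by rewrite opprB addrA subrK.
have -> : cis (dot w0 t) * f (t - x0) * gauss (t - x) * cis (- dot w t) =
  f (t - x0) * gauss (t - x) * (cis (dot w0 t) * cis (- dot w t)) by ring.
rewrite -cisD [RHS]mulrCA -cisD; congr (_ * cis _).
by rewrite !dotBr !dotBl; ring.
Qed.

Lemma Cb_modulation_translation f x0 w0 : Cb f ->
  Cb (modulation w0 (translation x0 f)).
Proof.
move=> cf; have [_ [M M0 fM]] := (CbP f).1 cf.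
apply: (@CbI _ _ _ M); last by move=> t; rewrite Normc.normcM normc_cis mul1r; exact: fM.
move=> u a ua; apply: ccvgM.
  by apply: ccvg_cis; apply: cvg_dot => //; exact: cvg_cst.
apply: (Cb_seq (f := f) (u := fun j => u j - x0) (a := a - x0) cf).
by apply: cvgB => //; exact: cvg_cst.
Qed.

Lemma S0_modulation_translation f x0 w0 : S0 f ->
  S0 (modulation w0 (translation x0 f)) /\
  S0_norm (modulation w0 (translation x0 f)) = S0_norm f.
Proof.
move=> /[dup] sf /S0_Cb cf; have cg := Cb_modulation_translation x0 w0 cf.
have e : S0_norm (modulation w0 (translation x0 f)) = S0_norm f.
  have mF := cmeasurable_gstft2 cf.
  rewrite (S0_norm_leb2 cg) (S0_norm_leb2 cf) -(norm1_leb2_shift (- x0) (- w0) mF).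
  apply: eq_integral => -[x w] _.
  rewrite -[gstft2 (modulation _ _) _]/(gstft (modulation w0 (translation x0 f)) x w).
  by rewrite (gstft_modulation_translation x0 w0 x w cf) Normc.normcM normc_cis mul1r.
split; last exact: e.
by apply/S0P; split; [exact: cg|rewrite e; case/S0P : sf].
Qed.

Lemma normc_convolution_le f h (M : R) t : Cb f -> cmeasurable h ->
  (forall t, normc (f t) <= M) ->
  ((normc (convolution f h t))%:E <= M%:E * norm1 leb h)%E.
Proof.
move=> cf mh fM; have mf := Cb_cmeasurable cf.
apply: le_trans (normc_cint _ _) _; first by measurability.
apply: (norm1_bounded_mul (f := fun s => f (t - s))) => //.
by measurability.
Qed.

Lemma Cb_convolution f h : Cb f -> cmeasurable h -> (norm1 leb h < +oo)%E ->
  Cb (convolution f h).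
Proof.
move=> cf mh fh; have mf := Cb_cmeasurable cf.
have [_ [M M0 fM]] := (CbP f).1 cf; apply/CbP; split.
  have ib : leb.-integrable setT (EFin \o (fun s => M * normc (h s))).
    rewrite (_ : EFin \o _ = (fun s => M%:E * (normc (h s))%:E)%E)//.
    by apply: integrableZl => //; exact: integrable_normc.
  rewrite -[convolution f h]/(fun t => cint leb (fun s => f (t - s) * h s)).
  apply: (continuous_cint (k := fun t s : 'rV[R]_n => f (t - s) * h s) _ ib).
  - by move=> t; measurability.
  - by move=> t s; rewrite Normc.normcM ler_wpM2r ?normc_ge0.
  - move=> s u a ua; apply: ccvgM; last exact: ccvg_cst.
    by apply: Cb_seq => //; apply: cvgB => //; exact: cvg_cst.
exists (M * fine (norm1 leb h)); first by rewrite mulr_ge0// fine_ge0// norm1_ge0.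
move=> t; rewrite -lee_fin EFinM fineK ?ge0_fin_numE ?norm1_ge0//.
exact: normc_convolution_le.
Qed.

Lemma gstft_convolution f h x w : Cb f -> cmeasurable h -> (norm1 leb h < +oo)%E ->
  gstft (convolution f h) x w =
  cint leb (fun s => h s * (cis (- dot w s) * gstft f (x - s) w)).
Proof.
move=> cf mh fh; have mf := Cb_cmeasurable cf.
have [_ [M M0 fM]] := (CbP f).1 cf.
pose Phi (q : 'rV[R]_n * 'rV[R]_n) :=
  f (q.1 - q.2) * h q.2 * (gauss (q.1 - x) * cis (- dot w q.1)).
have mPhi : cmeasurable Phi by measurability.
have PhiE t s : Phi (t, s) = f (t - s) * h s * (gauss (t - x) * cis (- dot w t)) by [].
have fPhi : (norm1 (leb \x leb)%E Phi < +oo)%E.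
  rewrite norm1_tonelli2//.
  apply: (@le_lt_trans _ _ (\int[leb]_s (M%:E * (normc (h s))%:E))%E); last first.
    rewrite ge0_integralZl//; last 2 first.
    - exact: measurable_enormc.
    - by move=> s _; rewrite lee_fin normc_ge0.
    by rewrite lte_mul_pinfty ?lee_fin.
  apply: ge0_le_integral => //.
  - by move=> s _; exact: norm1_ge0.
  - exact: measurable_norm1_G.
  - by apply: measurable_funeM; exact: measurable_enormc.
  move=> s _; rewrite -[leRHS]mule1 -(@norm1_gauss R n) -(norm1_leb_shift (- x)); last exact: cmeasurable_gauss.
  rewrite -EFinM -[(_ * _)%:E]/((M * normc (h s))%:E).
  have -> : M * normc (h s) = normc (M%:C * h s) by rewrite Normc.normcM normc_real ger0_norm.
  rewrite -norm1Z; last by measurability.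
  apply: le_norm1; [by measurability|by measurability|move=> t].
  rewrite PhiE !Normc.normcM !normc_cis !mulr1 (normc_real M) (ger0_norm M0).
  by rewrite ler_wpM2r ?normc_ge0// ler_wpM2r ?normc_ge0.
transitivity (cint leb (fun t => cint leb (fun s => Phi (t, s)))).
  apply: eq_cint => t; under [RHS]eq_cint do rewrite PhiE.
  rewrite cintZr ?mulrA//; first by measurability.
  apply: le_lt_trans (norm1_bounded_mul (f := fun s => f (t - s)) (M := M) _ mh _) _ => //.
    by measurability.
  by rewrite lte_mul_pinfty ?lee_fin.
rewrite (cint_fubini mPhi fPhi); apply: eq_cint => s.
have mk : cmeasurable (fun t => f (t - s) * gauss (t - x) * cis (- dot w t)) by measurability.
have fk : (norm1 leb (fun t => f (t - s) * gauss (t - x) * cis (- dot w t))%R < +oo)%E.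
  apply: le_lt_trans (_ : (M%:E < +oo)%E); last by rewrite ltry.
  have mfs : cmeasurable (fun t => f (t - s)) by measurability.
  apply: le_trans _ (norm1_window x mfs (fun t => fM _)).
  apply: le_norm1; [by measurability|by measurability|move=> t].
  by rewrite Normc.normcM normc_cis mulr1.
transitivity (h s * cint leb (fun t => f (t - s) * gauss (t - x) * cis (- dot w t))).
  by rewrite -cintZ//; apply: eq_cint => t; rewrite PhiE; ring.
congr (_ * _); rewrite -(cint_leb_shift s mk fk) /gstft -cintZ; last 2 first.
- by measurability.
- apply: le_lt_trans (_ : (M%:E < +oo)%E); last by rewrite ltry.
  apply: le_trans _ (norm1_window (x - s) mf fM).
  apply: le_norm1; [by measurability|by measurability|move=> t].
  by rewrite Normc.normcM normc_cis mulr1.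
apply: eq_cint => t; rewrite addrK (_ : t + s - x = t - (x - s)); last by rewrite opprB addrA addrAC.
by rewrite [RHS]mulrCA -cisD; congr (_ * cis _); rewrite dotDr; ring.
Qed.

End S0.

Section S0_algebra.
Context {R : realType} {n : nat}.
Local Notation normc := Normc.normc.
Local Notation leb := (@leb R n).
Local Notation leb2 := (@leb2 R n).
Implicit Types (f g h p : 'rV[R]_n -> R[i]) (x w t : 'rV[R]_n).

Lemma S0_norm_convolution f h : S0 f -> S0 h ->
  (S0_norm (convolution f h) <= S0_norm f * S0_norm h)%E.
Proof.
move=> sf sh; have cf := S0_Cb sf; have ch := S0_Cb sh.
have mf := Cb_cmeasurable cf; have mh := Cb_cmeasurable ch.
have fh := S0_norm1_lty sh.
have cfh : Cb (convolution f h) by exact: Cb_convolution.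
have mF := cmeasurable_gstft2 cf.
pose Psi (q : ('rV[R]_n * 'rV[R]_n) * 'rV[R]_n) :=
  h q.2 * gstft2 f (q.1.1 - q.2, q.1.2).
have mPsi : cmeasurable Psi.
  apply: cmeasurableM; first by measurability.
  apply: (cmeasurable_comp _ mF).
  by apply: measurable_fun_pair; measurability.
have -> : (S0_norm f * S0_norm h = S0_norm h * norm1 leb2 (gstft2 f))%E.
  by rewrite -(S0_norm_leb2 cf); exact: muleC.
apply: (@le_trans _ _ (norm1 (leb2 \x leb)%E Psi)).
  rewrite (S0_norm_leb2 cfh) [leRHS](norm1_tonelli1 _ _ mPsi); apply: ge0_le_integral => //.
  - by move=> z _; rewrite lee_fin normc_ge0.
  - by apply: measurable_enormc; exact: cmeasurable_gstft2.
  - exact: measurable_norm1_F.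
  move=> -[x w] _; rewrite -[gstft2 _ _]/(gstft (convolution f h) x w).
  have mPs : cmeasurable (fun s => Psi ((x, w), s)) by exact: cmeasurable_pair1.
  rewrite (gstft_convolution x w cf mh fh); apply: le_trans (normc_cint _ _) _.
    rewrite (_ : (fun s => _) = fun s => Psi ((x, w), s) * cis (- dot w s)); last first.
      by apply/funext => s; rewrite /Psi mulrCA mulrC.
    by apply: cmeasurableM; [exact: mPs|measurability].
  rewrite /norm1 le_eqVlt; apply/orP; left; apply/eqP; apply: eq_integral => s _.
  by rewrite /Psi !Normc.normcM normc_cis mul1r.
rewrite (norm1_tonelli2 _ _ mPsi).
rewrite (eq_integral (fun s => (norm1 leb2 (gstft2 f) * (normc (h s))%:E)%E)); last first.
  move=> s _; rewrite muleC -(norm1_leb2_shift (- s) 0 mF) -norm1Z; last first.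
    apply: (cmeasurable_comp _ mF).
    by apply: measurable_fun_pair; measurability.
  by apply: eq_integral => z _; rewrite /Psi addr0.
rewrite ge0_integralZl//; last 3 first.
- exact: measurable_enormc.
- by move=> s _; rewrite lee_fin normc_ge0.
- exact: norm1_ge0.
by rewrite muleC lee_wpmul2r ?norm1_ge0// norm1_le_S0_norm.
Qed.

Lemma S0_convolution f h : S0 f -> S0 h -> S0 (convolution f h).
Proof.
move=> sf sh; apply/S0P; split.
  apply: Cb_convolution; [exact: S0_Cb|exact: Cb_cmeasurable (S0_Cb sh)|exact: S0_norm1_lty].
apply: le_lt_trans (S0_norm_convolution sf sh) _.
have /S0P[_ fh] := sh.
exact: lte_mul_pinfty (S0_norm_ge0 f) (S0_norm_fin_num sf) fh.
Qed.

Lemma S0_representation f t : S0 f ->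
  f t = cint leb2 (fun z => gstft2 f z * cis (dot z.2 t)).
Proof.
move=> sf; have h1 (x : 'rV[R]_n) : `|1 : R| <= 1 by rewrite normr1.
have := gstft_reproducing t (S0_Cb sf) (S0_gstft2_lty sf) (@measurable_cst _ _ _ _ _ (1 : R)) h1.
rewrite (_ : cint leb _ = 1) ?mulr1 => [->|].
  by apply: eq_cint => z; rewrite mul1r.
rewrite -(@cint_gauss R n) -(@cint_leb_shift _ _ (- t) (@gauss R n)); last 2 first.
- exact: cmeasurable_gauss.
- by rewrite norm1_gauss ltry.
by apply: eq_cint => x; rewrite mul1r -(opprB x) /gauss dotNl dotNr opprK.
Qed.

Lemma gstft_mul f h x w : S0 f -> Cb h ->
  gstft (pointwise_mul f h) x w =
  cint leb2 (fun z => gstft2 f z * gstft h x (w - z.2)).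
Proof.
move=> sf ch; have mh := Cb_cmeasurable ch.
have cf := S0_Cb sf; have mF := cmeasurable_gstft2 cf; have fF := S0_gstft2_lty sf.
have [_ [M M0 hM]] := (CbP h).1 ch.
pose Phi (q : 'rV[R]_n * ('rV[R]_n * 'rV[R]_n)) :=
  gstft2 f q.2 * cis (dot q.2.2 q.1) * (h q.1 * gauss (q.1 - x) * cis (- dot w q.1)).
have mPhi : cmeasurable Phi by measurability.
have PhiE t z : Phi (t, z) = gstft2 f z * cis (dot z.2 t) *
  (h t * gauss (t - x) * cis (- dot w t)) by [].
have mhg : cmeasurable (fun t => h t * gauss (t - x)) by measurability.
have fhg := norm1_window x mh hM.
have fPhi : (norm1 (leb \x leb2)%E Phi < +oo)%E.
  rewrite norm1_tonelli2//.
  apply: (@le_lt_trans _ _ (\int[leb2]_z (M%:E * (normc (gstft2 f z))%:E))%E); last first.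
    rewrite ge0_integralZl//; last 2 first.
    - exact: measurable_enormc.
    - by move=> s _; rewrite lee_fin normc_ge0.
    by rewrite lte_mul_pinfty ?lee_fin.
  apply: ge0_le_integral => //.
  - by move=> s _; exact: norm1_ge0.
  - exact: measurable_norm1_G.
  - by apply: measurable_funeM; exact: measurable_enormc.
  move=> z _; rewrite muleC.
  apply: le_trans (lee_wpmul2l _ fhg); last by rewrite lee_fin normc_ge0.
  rewrite -norm1Z; last by measurability.
  apply: le_norm1; [by measurability|by measurability|move=> t].
  by rewrite PhiE !Normc.normcM !normc_cis !mulr1.
have fhgw v : (norm1 leb (fun t => h t * gauss (t - x) * cis (- dot v t))%R < +oo)%E.
  apply: le_lt_trans (_ : (M%:E < +oo)%E); last by rewrite ltry.
  apply: le_trans _ fhg.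
  apply: le_norm1; [by measurability|by measurability|move=> t].
  by rewrite Normc.normcM normc_cis mulr1.
transitivity (cint leb (fun t => cint leb2 (fun z => Phi (t, z)))).
  apply: eq_cint => t; under [RHS]eq_cint do rewrite PhiE.
  rewrite cintZr; last 2 first.
  - by measurability.
  - apply: le_lt_trans fF; apply: le_norm1; [by measurability|by []|move=> z].
    by rewrite Normc.normcM normc_cis mulr1.
  by rewrite -S0_representation// /pointwise_mul !mulrA.
rewrite (cint_fubini mPhi fPhi); apply: eq_cint => z.
rewrite /gstft -cintZ//; last by measurability.
apply: eq_cint => t; rewrite PhiE dotBl opprB addrC cisD; ring.
Qed.

Lemma S0_norm_mul f h : S0 f -> S0 h ->
  (S0_norm (pointwise_mul f h) <= S0_norm f * S0_norm h)%E.
Proof.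
move=> sf sh; have cf := S0_Cb sf; have ch := S0_Cb sh.
have cfh : Cb (pointwise_mul f h) by exact: Cb_mul.
have mF := cmeasurable_gstft2 cf; have mH := cmeasurable_gstft2 ch.
pose Psi (q : ('rV[R]_n * 'rV[R]_n) * ('rV[R]_n * 'rV[R]_n)) :=
  gstft2 f q.2 * gstft2 h (q.1.1, q.1.2 - q.2.2).
have mPsi : cmeasurable Psi.
  apply: cmeasurableM; first by measurability.
  apply: (cmeasurable_comp _ mH).
  by apply: measurable_fun_pair; measurability.
rewrite [leRHS]muleC (S0_norm_leb2 cfh) (S0_norm_leb2 cf) (S0_norm_leb2 ch).
apply: (@le_trans _ _ (norm1 (leb2 \x leb2)%E Psi)).
  rewrite [leRHS](norm1_tonelli1 _ _ mPsi); apply: ge0_le_integral => //.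
  - by move=> z _; rewrite lee_fin normc_ge0.
  - by apply: measurable_enormc; exact: cmeasurable_gstft2.
  - exact: measurable_norm1_F.
  move=> -[x w] _; rewrite -[gstft2 (pointwise_mul f h) _]/(gstft (pointwise_mul f h) x w).
  rewrite (gstft_mul x w sf ch); apply: normc_cint.
  exact: (cmeasurable_pair1 mPsi (x, w)).
rewrite (norm1_tonelli2 _ _ mPsi).
rewrite (eq_integral (fun z => (norm1 leb2 (gstft2 h) * (normc (gstft2 f z))%:E)%E)); last first.
  move=> z _; rewrite muleC -(norm1_leb2_shift 0 (- z.2) mH) -norm1Z; last first.
    apply: (cmeasurable_comp _ mH).
    by apply: measurable_fun_pair; measurability.
  by apply: eq_integral => q _; rewrite /Psi addr0.
rewrite ge0_integralZl//; last 3 first.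
- exact: measurable_enormc.
- by move=> s _; rewrite lee_fin normc_ge0.
- exact: norm1_ge0.
Qed.

Lemma S0_mul f h : S0 f -> S0 h -> S0 (pointwise_mul f h).
Proof.
move=> sf sh; apply/S0P; split; first by apply: Cb_mul; exact: S0_Cb.
apply: le_lt_trans (S0_norm_mul sf sh) _.
have /S0P[_ fh] := sh.
exact: lte_mul_pinfty (S0_norm_ge0 f) (S0_norm_fin_num sf) fh.
Qed.

Lemma norm1_convolution_integrand f g t : S0 f -> S0 g ->
  cmeasurable (fun s : 'rV[R]_n => f (t - s) * g s) /\
  (norm1 leb (fun s : 'rV[R]_n => f (t - s) * g s)%R < +oo)%E.
Proof.
move=> sf sg; have cf := S0_Cb sf; have cg := S0_Cb sg.
have mf := Cb_cmeasurable cf; have mg := Cb_cmeasurable cg.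
have [_ [M M0 fM]] := (CbP f).1 cf; split; first by measurability.
apply: (@le_lt_trans _ _ (M%:E * norm1 leb g)%E).
  by apply: (norm1_bounded_mul (f := fun s => f (t - s))) => //; measurability.
by rewrite lte_mul_pinfty ?lee_fin ?S0_norm1_lty.
Qed.

Lemma convolutionDl (a : R[i]) f g h : S0 f -> S0 g -> S0 h ->
  convolution (fun t => a * f t + g t) h =
  fun t => a * convolution f h t + convolution g h t.
Proof.
move=> sf sg sh; apply/funext => t.
have [m1 f1] := norm1_convolution_integrand t sf sh.
have [m2 f2] := norm1_convolution_integrand t sg sh.
rewrite /convolution -[cintegral _]/(cint leb _) -[cintegral _ in RHS]/(cint leb _).
rewrite -[X in _ = _ + X]/(cint leb _) -cintZ// -cintD//; last 2 first.
- by apply: cmeasurableM => //; exact: cmeasurable_cst.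
- by rewrite norm1Z// lte_mul_pinfty ?lee_fin ?normc_ge0.
by apply: eq_cint => s; rewrite mulrDl mulrA.
Qed.

Lemma convolutionDr (a : R[i]) f g h : S0 f -> S0 g -> S0 h ->
  convolution h (fun t => a * f t + g t) =
  fun t => a * convolution h f t + convolution h g t.
Proof.
move=> sf sg sh; apply/funext => t.
have [m1 f1] := norm1_convolution_integrand t sh sf.
have [m2 f2] := norm1_convolution_integrand t sh sg.
rewrite /convolution -[cintegral _]/(cint leb _) -[cintegral _ in RHS]/(cint leb _).
rewrite -[X in _ = _ + X]/(cint leb _) -cintZ// -cintD//; last 2 first.
- by apply: cmeasurableM => //; exact: cmeasurable_cst.
- by rewrite norm1Z// lte_mul_pinfty ?lee_fin ?normc_ge0.
by apply: eq_cint => s; rewrite mulrDr mulrCA.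
Qed.

Lemma convolutionA f g h : S0 f -> S0 g -> S0 h ->
  convolution f (convolution g h) = convolution (convolution f g) h.
Proof.
move=> sf sg sh; apply/funext => t.
have cf := S0_Cb sf; have cg := S0_Cb sg; have ch := S0_Cb sh.
have mf := Cb_cmeasurable cf; have mg := Cb_cmeasurable cg; have mh := Cb_cmeasurable ch.
have [_ [M M0 fM]] := (CbP f).1 cf.
have fg := S0_norm1_lty sg; have fh := S0_norm1_lty sh.
pose Phi (q : 'rV[R]_n * 'rV[R]_n) : R[i] := f (t - q.1) * (g (q.1 - q.2) * h q.2).
have mPhi : cmeasurable Phi by measurability.
have PhiE s r : Phi (s, r) = f (t - s) * (g (s - r) * h r) by [].
have bound r : (norm1 leb (fun s => Phi (s, r)) <= M%:E * norm1 leb g * (normc (h r))%:E)%E.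
  have mgs : cmeasurable (fun s : 'rV[R]_n => g (s - r)) by measurability.
  have mgr : cmeasurable (fun s : 'rV[R]_n => h r * g (s - r)).
    by apply: cmeasurableM => //; exact: cmeasurable_cst.
  have mft : cmeasurable (fun s : 'rV[R]_n => f (t - s)) by measurability.
  apply: (@le_trans _ _ (M%:E * norm1 leb (fun s => h r * g (s - r))%R)%E).
    apply: le_trans (norm1_bounded_mul (M := M) mft mgr (fun s => fM _)).
    rewrite le_eqVlt; apply/orP; left; apply/eqP; congr norm1.
    by apply/funext => s; rewrite PhiE (mulrC (g _)).
  rewrite norm1Z//; have := norm1_leb_shift (- r) mg => ->.
  by rewrite (muleC (normc _)%:E) muleA.
have fPhi : (norm1 (leb \x leb)%E Phi < +oo)%E.
  rewrite norm1_tonelli2//.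
  apply: (@le_lt_trans _ _ (\int[leb]_r (M%:E * norm1 leb g * (normc (h r))%:E))%E); last first.
    rewrite ge0_integralZl//; last 3 first.
    - exact: measurable_enormc.
    - by move=> s _; rewrite lee_fin normc_ge0.
    - by rewrite mule_ge0 ?lee_fin ?norm1_ge0.
    rewrite lte_mul_pinfty ?mule_ge0 ?lee_fin ?norm1_ge0//.
    by rewrite fin_numM// ge0_fin_numE ?norm1_ge0.
  apply: ge0_le_integral => //.
  - by move=> s _; exact: norm1_ge0.
  - exact: measurable_norm1_G.
  - by apply: measurable_funeM; exact: measurable_enormc.
transitivity (cint leb (fun s => cint leb (fun r => Phi (s, r)))).
  apply: eq_cint => s; have [m1 f1] := norm1_convolution_integrand s sg sh.
  by under [RHS]eq_cint do rewrite PhiE; rewrite cintZ.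
rewrite (cint_fubini mPhi fPhi); apply: eq_cint => r.
have [m1 f1] := norm1_convolution_integrand (t - r) sf sg.
rewrite -[convolution f g (t - r)]/(cint leb _) -cintZr//.
rewrite -(cint_leb_shift r (f := fun s => Phi (s, r))); last 2 first.
- by measurability.
- apply: le_lt_trans (bound r) _.
  have gfin : norm1 leb g \is a fin_num by rewrite ge0_fin_numE// norm1_ge0.
  by rewrite -(fineK gfin) -!EFinM ltry.
apply: eq_cint => s; rewrite PhiE addrK mulrA; congr (f _ * _ * _).
by rewrite opprD addrA addrAC.
Qed.

End S0_algebra.

(** * Completeness *)

Section normed_subspace.
Context {R : realType} {V : lmodType R[i]}.
Local Notation normc := Normc.normc.
Local Open Scope complex_scope.
Variables (E : set V) (N : V -> \bar R).
Hypothesis E0 : E 0.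
Hypothesis E_linear : forall (a : R[i]) x y, E x -> E y -> E (a *: x + y).
Hypothesis N_fin : forall x, E x -> N x \is a fin_num.
Hypothesis ND : forall x y, E x -> E y -> (N (x + y) <= N x + N y)%E.
Hypothesis NZ : forall (a : R[i]) x, E x -> N (a *: x) = ((normc a)%:E * N x)%E.
Hypothesis N_eq0 : forall x, E x -> N x = 0%E -> x = 0.

Definition subspace_pred : {pred V} := fun x => `[< E x >].

Lemma subspace_predP x : reflect (E x) (x \in subspace_pred).
Proof. by rewrite unfold_in; exact: asboolP. Qed.

Fact subspace_submod_closed : submod_closed subspace_pred.
Proof.
split; first exact/subspace_predP.
by move=> a x y /subspace_predP Ex /subspace_predP Ey; apply/subspace_predP/E_linear.
Qed.

HB.instance Definition _ :=
  GRing.isSubmodClosed.Build R[i] V subspace_pred subspace_submod_closed.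

Record normed_subspace :=
  NormedSubspace { subspace_val : V; _ : subspace_val \in subspace_pred }.

HB.instance Definition _ := [isSub for subspace_val].
HB.instance Definition _ := [Choice of normed_subspace by <:].
HB.instance Definition _ := [SubChoice_isSubLmodule of normed_subspace by <:].

Implicit Types x y : normed_subspace.

Lemma subspace_valP x : E (val x).
Proof. by apply/subspace_predP; exact: (valP x). Qed.

Definition subspace_norm x : R[i] := (fine (N (val x)))%:C.

Lemma subspace_normD x y : subspace_norm (x + y) <= subspace_norm x + subspace_norm y.
Proof.
have [Ex Ey] := (subspace_valP x, subspace_valP y).
rewrite /subspace_norm raddfD -rmorphD lecR -lee_fin EFinD !fineK ?ND ?N_fin//.
by rewrite -raddfD; exact: subspace_valP.
Qed.

Lemma subspace_normZ (a : R[i]) x : subspace_norm (a *: x) = `|a| * subspace_norm x.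
Proof.
have Ex := subspace_valP x.
by rewrite /subspace_norm linearZ/= NZ// fineM ?N_fin// rmorphM; case: a.
Qed.

Lemma subspace_norm_eq0 x : subspace_norm x = 0 -> x = 0.
Proof.
have Ex := subspace_valP x.
move=> [Nx0]; apply: val_inj; rewrite raddf0; apply: N_eq0 => //.
by rewrite -[LHS]fineK ?N_fin// Nx0.
Qed.

HB.instance Definition _ := Lmodule_isNormed.Build R[i] normed_subspace
  subspace_normD subspace_normZ subspace_norm_eq0.

Hypothesis N_complete : forall u : nat -> V, (forall n, E (u n)) ->
  (forall e : R, 0 < e -> exists m : nat, forall i j : nat,
    (m <= i)%N -> (m <= j)%N -> (N (u i - u j) <= e%:E)%E) ->
  exists2 f, E f & forall e : R, 0 < e ->
    exists m : nat, forall i : nat, (m <= i)%N -> (N (u i - f) <= e%:E)%E.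

Fact subspace_cauchy_cvg (F : set_system normed_subspace) :
  ProperFilter F -> cauchy F -> cvg F.
Proof.
move=> PF /cauchyP cF.
have inv_gt0 (k : nat) : (0 : R[i]) < (k.+1%:R^-1)%:C by rewrite ltcR invr_gt0.
have /choice[u Fu] (k : nat) : exists x, F (ball x (k.+1%:R^-1)%:C).
  exact: cF (inv_gt0 k).
have normE x y : `|x - y| = (fine (N (val x - val y)))%:C.
  by rewrite -raddfB.
have le_norm x y (e : R) : (N (val x - val y) <= e%:E)%E = (`|x - y| <= e%:C).
  rewrite normE lecR -lee_fin fineK//; apply: N_fin.
  by rewrite -raddfB; exact: subspace_valP.
have invS (e : R) : 0 < e -> exists m, forall i : nat, (m <= i)%N -> i.+1%:R^-1 < e.
  move=> /ltr_add_invr[m]; rewrite add0r => me.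
  exists m => i mi; apply: le_lt_trans me.
  by rewrite lef_pV2 ?posrE// ler_nat ltnS.
have [] := @N_complete (val \o u) (fun k => subspace_valP (u k)).
  move=> e e0; have [m me] := invS (e / 2) (divr_gt0 e0 (ltr0Sn _ _)).
  exists m => i j mi mj /=; rewrite le_norm.
  have [y []] := filter_ex (filterI (Fu i) (Fu j)).
  rewrite -!ball_normE/= => iy jy.
  rewrite -[u i - u j](subrKA y) (le_trans (ler_normD _ _))//.
  rewrite [e]splitr rmorphD lerD//; last rewrite distrC.
    by rewrite (le_trans (ltW iy))// lecR ltW// me.
  by rewrite (le_trans (ltW jy))// lecR ltW// me.
move=> f /subspace_predP Ef fu; apply: (cvgP (NormedSubspace Ef)).
apply/cvgrPdist_lt => _ /gt0_complex[e e0 ->].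
have e20 : 0 < e / 2 by rewrite divr_gt0.
have [m me] := invS _ e20; have [p pe] := fu _ e20.
have := Fu (maxn m p); apply: filterS => y.
rewrite -!ball_normE/= => uy.
rewrite -[_ - y](subrKA (u (maxn m p))) (le_lt_trans (ler_normD _ _))//.
rewrite [e]splitr rmorphD ler_ltD//.
  by rewrite distrC -le_norm; exact: pe (leq_maxr _ _).
by apply: lt_trans uy _; rewrite ltcR; exact: me (leq_maxl _ _).
Qed.

HB.instance Definition _ :=
  Uniform_isComplete.Build normed_subspace subspace_cauchy_cvg.

Lemma is_banach_subspace : is_banach_space E N.
Proof.
exists (normed_subspace : completeNormedModType R[i]), (val : {linear normed_subspace -> V}).
split; first exact: val_inj.
  apply/seteqP; split => [_ [x _ <-]|x /subspace_predP Ex]; first exact: subspace_valP.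
  by exists (NormedSubspace Ex).
by move=> x; rewrite -[`|x|]/(subspace_norm x) /= fineK// N_fin//; exact: subspace_valP.
Qed.

End normed_subspace.

Section complex_sequences.
Context {R : realType}.
Local Notation normc := Normc.normc.
Local Open Scope complex_scope.
Implicit Types (a : nat -> R[i]) (e : R).

Lemma ccvgD a (b : nat -> R[i]) (l m : R[i]) : ccvg a l -> ccvg b m ->
  ccvg (fun n => a n + b n) (l + m).
Proof.
move=> [a1 a2] [b1 b2]; split.
- by under eq_fun do rewrite complexReD; rewrite complexReD; exact: cvgD.
- by under eq_fun do rewrite complexImD; rewrite complexImD; exact: cvgD.
Qed.

Lemma ccvg_shift m a l : ccvg a l -> ccvg (fun j => a (m + j)%N) l.
Proof.
move=> /ccvgP al; apply/ccvgP => e /al[p _ ap]; exists p => // j pj.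
by apply: ap; exact: leq_trans pj (leq_addl _ _).
Qed.

Lemma real_cauchy_cvg (r : nat -> R) :
  (forall e, 0 < e -> exists m : nat, forall i j : nat,
    (m <= i)%N -> (m <= j)%N -> `|r i - r j| <= e) ->
  cvg (r n @[n --> \oo]).
Proof.
move=> cr; apply/cauchy_cvgP/cauchy_exP => e e0.
have [m rm] := cr (e / 2) (divr_gt0 e0 (ltr0Sn _ _)).
exists (r m); exists m => // i /= mi; rewrite -ball_normE/=.
by apply: le_lt_trans (rm _ _ (leqnn m) mi) _; rewrite ltr_pdivrMr// ltr_pMr// ltr1n.
Qed.

Lemma ccvg_cauchy a :
  (forall e, 0 < e -> exists m : nat, forall i j : nat,
    (m <= i)%N -> (m <= j)%N -> normc (a i - a j) <= e) ->
  exists l, ccvg a l.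
Proof.
move=> ca.
have /cvg_ex[l1 al1] : cvg (complex.Re (a n) @[n --> \oo]).
  apply: real_cauchy_cvg => e /ca[m am]; exists m => i j mi mj.
  apply: le_trans (am _ _ mi mj).
  have -> : complex.Re (a i) - complex.Re (a j) = complex.Re (a i - a j).
    by rewrite complexReD; case: (a j).
  exact: normc_Re.
have /cvg_ex[l2 al2] : cvg (complex.Im (a n) @[n --> \oo]).
  apply: real_cauchy_cvg => e /ca[m am]; exists m => i j mi mj.
  apply: le_trans (am _ _ mi mj).
  have -> : complex.Im (a i) - complex.Im (a j) = complex.Im (a i - a j).
    by rewrite complexImD; case: (a j).
  exact: normc_Im.
by exists (l1 +i* l2).
Qed.

Lemma normc_limit_le a (l b : R[i]) e (m : nat) : ccvg a l ->
  (forall j, (m <= j)%N -> normc (b - a j) <= e) -> normc (b - l) <= e.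
Proof.
move=> /ccvgP al ba; apply/ler_addgt0Pr => d /al[p _ ap].
rewrite -(subrKA (a (maxn m p))) (le_trans (le_normcD _ _))//.
by rewrite lerD ?ba ?leq_maxl// ltW//; apply: ap => /=; exact: leq_maxr.
Qed.

Lemma norm1_fatou d (T : measurableType d) (mu : {measure set T -> \bar R})
    (F : nat -> T -> R[i]) (G : T -> R[i]) (C : \bar R) :
  (forall n, cmeasurable (F n)) -> (forall t, ccvg (F ^~ t) (G t)) ->
  (forall n, (norm1 mu (F n) <= C)%E) -> (norm1 mu G <= C)%E.
Proof.
move=> mF FG FC.
have mF' n : measurable_fun setT (fun t => (normc (F n t))%:E).
  exact: measurable_enormc.
have F0 n t : setT t -> (0 <= (normc (F n t))%:E)%E by move=> _; rewrite lee_fin normc_ge0.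
apply: (@le_trans _ _ (limn_einf (fun n => norm1 mu (F n)))).
  apply: le_trans _ (@fatou _ _ _ mu _ measurableT _ mF' F0).
  rewrite le_eqVlt; apply/orP; left; apply/eqP; apply: eq_integral => t _.
  have cF : (normc (F n t))%:E @[n --> \oo] --> (normc (G t))%:E.
    by apply/fine_cvgP; split; [exact: nearW|exact: ccvg_normc].
  by have [-> _] := cvg_limn_einf_sup cF.
rewrite limn_einf_lim; apply: lime_le; first exact: is_cvg_einfs.
apply: nearW => n; apply: le_trans (FC n).
by apply: ereal_inf_lbound; exists n => /=.
Qed.

End complex_sequences.

Section S0_banach.
Context {R : realType} {n : nat}.
Local Notation normc := Normc.normc.
Local Notation leb := (@leb R n).
Local Notation leb2 := (@leb2 R n).
Implicit Types (f g : 'rV[R]_n -> R[i]).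

Lemma CbD f g : Cb f -> Cb g -> Cb (fun t => f t + g t).
Proof.
move=> /[dup] cf /CbP[_ [M M0 fM]] /[dup] cg /CbP[_ [M' M'0 gM]].
apply: (@CbI _ _ _ (M + M')).
  by move=> u x ux; apply: ccvgD; exact: Cb_seq.
by move=> t; rewrite (le_trans (le_normcD _ _))// lerD.
Qed.

Lemma CbZ (a : R[i]) f : Cb f -> Cb (fun t => a * f t).
Proof.
move=> /[dup] cf /CbP[_ [M M0 fM]]; apply: (@CbI _ _ _ (normc a * M)).
  by move=> u x ux; apply: ccvgM; [exact: ccvg_cst|exact: Cb_seq].
by move=> t; rewrite Normc.normcM ler_wpM2l ?normc_ge0.
Qed.

Lemma cmeasurable_gstft_integrand f x w : Cb f ->
  cmeasurable (fun t => f t * gauss (t - x) * cis (- dot w t)).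
Proof. by move=> /Cb_cmeasurable mf; measurability. Qed.

Lemma norm1_gstft_integrand f x w : Cb f ->
  (norm1 leb (fun t => f t * gauss (t - x) * cis (- dot w t))%R < +oo)%E.
Proof.
move=> /[dup] cf /[dup] /Cb_cmeasurable mf /CbP[_ [M M0 fM]].
apply: le_lt_trans (_ : (M%:E < +oo)%E); last by rewrite ltry.
apply: le_trans _ (norm1_window x mf fM).
apply: le_norm1; [exact: cmeasurable_gstft_integrand|by measurability|move=> t].
by rewrite Normc.normcM normc_cis mulr1.
Qed.

Lemma gstft2Z (a : R[i]) f z : Cb f -> gstft2 (fun t => a * f t) z = a * gstft2 f z.
Proof.
move=> cf; rewrite -cintZ; last 2 first.
- exact: cmeasurable_gstft_integrand.
- exact: norm1_gstft_integrand.
by apply: eq_cint => t; rewrite !mulrA.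
Qed.

Lemma gstft2D f g z : Cb f -> Cb g ->
  gstft2 (fun t => f t + g t) z = gstft2 f z + gstft2 g z.
Proof.
move=> cf cg; rewrite -cintD; last 4 first.
- exact: cmeasurable_gstft_integrand.
- exact: cmeasurable_gstft_integrand.
- exact: norm1_gstft_integrand.
- exact: norm1_gstft_integrand.
by apply: eq_cint => t; rewrite !mulrDl.
Qed.

Lemma S0_normZ (a : R[i]) f : Cb f ->
  S0_norm (fun t => a * f t)%R = ((normc a)%:E * S0_norm f)%E.
Proof.
move=> cf; rewrite (S0_norm_leb2 (CbZ a cf)) (S0_norm_leb2 cf).
rewrite -(norm1Z leb2 a (cmeasurable_gstft2 cf)).
by congr (norm1 _ _); apply/funext => z; exact: gstft2Z.
Qed.

Lemma S0_normD f g : Cb f -> Cb g ->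
  (S0_norm (fun t => f t + g t)%R <= S0_norm f + S0_norm g)%E.
Proof.
move=> cf cg; rewrite (S0_norm_leb2 (CbD cf cg)) (S0_norm_leb2 cf) (S0_norm_leb2 cg).
apply: le_trans _ (norm1D leb2 (cmeasurable_gstft2 cf) (cmeasurable_gstft2 cg)).
rewrite le_eqVlt; apply/orP; left; apply/eqP.
by congr (norm1 _ _); apply/funext => z; exact: gstft2D.
Qed.

Lemma S0D f g : S0 f -> S0 g -> S0 (fun t => f t + g t).
Proof.
move=> /S0P[cf ff] /S0P[cg fg]; apply/S0P; split; first exact: CbD.
exact: le_lt_trans (S0_normD cf cg) (lte_add_pinfty ff fg).
Qed.

Lemma S0Z (a : R[i]) f : S0 f -> S0 (fun t => a * f t).
Proof.
move=> /S0P[cf ff]; apply/S0P; split; first exact: CbZ.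
by rewrite (S0_normZ a cf) lte_mul_pinfty// lee_fin normc_ge0.
Qed.

Lemma S0B f g : S0 f -> S0 g -> S0 (fun t => f t - g t).
Proof.
move=> sf /(S0Z (-1)) sg; have := S0D sf sg.
by rewrite (_ : (fun t => f t + -1 * g t) = fun t => f t - g t)//; apply/funext => t; rewrite mulN1r.
Qed.

Lemma S0_0 : @S0 R n (fun=> 0).
Proof.
have c0 : @Cb R n (fun=> 0).
  apply: (@CbI _ _ _ 0); first by move=> u x ux; exact: ccvg_cst.
  by move=> t; rewrite (Normc.normc0 R).
apply/S0P; split => //.
rewrite (_ : (fun=> 0) = fun t : 'rV[R]_n => 0 * 0 :> R[i]); last by apply/funext => t; rewrite mul0r.
by rewrite (S0_normZ 0 c0) (Normc.normc0 R) mul0e.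
Qed.

Lemma Cb_uniform_limit (u : nat -> 'rV[R]_n -> R[i]) f :
  (forall i, Cb (u i)) ->
  (forall e : R, 0 < e -> exists m : nat, forall t, normc (u m t - f t) <= e) ->
  Cb f.
Proof.
move=> cu uf; apply/CbP; split.
  apply/continuous_complexP => a e e0.
  have e30 : 0 < e / 3 by rewrite divr_gt0.
  have [m um] := uf _ e30.
  have [/continuous_complexP/(_ a _ e30) cm _] := cu m.
  apply: filterS cm => x uxa.
  rewrite (_ : f x - f a = - (u m x - f x) + (u m x - u m a) + (u m a - f a)); last by ring.
  rewrite (le_lt_trans (le_normcD _ _))//.
  rewrite (_ : e = e / 3 + e / 3 + e / 3); last by field.
  rewrite ltr_leD// (le_lt_trans (le_normcD _ _))// ler_ltD//.
  by rewrite normcN.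
have [m um] := uf 1 ltr01; have /CbP[_ [M M0 uM]] := cu m.
exists (M + 1); first by rewrite addr_ge0.
move=> t; rewrite -[f t](subKr (u m t)).
by rewrite (le_trans (le_normcD _ _))// lerD// normcN.
Qed.

Lemma S0_complete (u : nat -> 'rV[R]_n -> R[i]) : (forall i, S0 (u i)) ->
  (forall e : R, 0 < e -> exists m : nat, forall i j : nat,
    (m <= i)%N -> (m <= j)%N -> (S0_norm (fun t => u i t - u j t)%R <= e%:E)%E) ->
  exists2 f, S0 f & forall e : R, 0 < e -> exists m : nat, forall i : nat,
    (m <= i)%N -> (S0_norm (fun t => u i t - f t)%R <= e%:E)%E.
Proof.
move=> su cu; have sB i j := S0B (su i) (su j).
have sup_le f (e : R) t : S0 f -> (S0_norm f <= e%:E)%E -> normc (f t) <= e.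
  by move=> sf fe; rewrite -lee_fin; apply: le_trans fe; exact: (normc_le_S0_norm t (S0_Cb sf)).
have /choice[f uf] t : exists l, ccvg (u ^~ t) l.
  apply: ccvg_cauchy => e /cu[m um]; exists m => i j mi mj.
  exact: (sup_le _ _ t (sB i j) (um i j mi mj)).
have uniform (e : R) : 0 < e -> exists m : nat, forall i t, (m <= i)%N -> normc (u i t - f t) <= e.
  move=> /cu[m um]; exists m => i t mi; apply: (normc_limit_le (m := m) (uf t)) => j mj.
  exact: (sup_le _ _ t (sB i j) (um i j mi mj)).
have cf : Cb f.
  apply: (Cb_uniform_limit (fun i => S0_Cb (su i))) => e /uniform[m um].
  by exists m => t; exact: um.
have cB i : Cb (fun t => u i t - f t).
  have := CbD (S0_Cb (su i)) (CbZ (-1) cf).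
  by rewrite (_ : (fun t => u i t + -1 * f t) = fun t => u i t - f t)//; apply/funext => t; rewrite mulN1r.
have gu i z : ccvg (fun j => gstft2 (fun t => u i t - u j t) z) (gstft2 (fun t => u i t - f t) z).
  apply/ccvgP => e e0; have [m um] := uniform _ (divr_gt0 e0 (ltr0Sn R 1)).
  exists m => // j mj.
  suff -> : gstft2 (fun t => u i t - u j t) z - gstft2 (fun t => u i t - f t) z =
      gstft2 (fun t => -1 * (u j t - f t)) z.
    apply: (@le_lt_trans _ _ (e / 2)); last by rewrite ltr_pdivrMr// ltr_pMr// ltr1n.
    apply: normc_gstft; first by apply: Cb_cmeasurable; exact: CbZ.
    by move=> t; rewrite mulN1r normcN um.
  rewrite -[- gstft2 _ _]mulN1r -(gstft2Z (-1) z (cB i)).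
  rewrite -(gstft2D z (S0_Cb (sB i j)) (CbZ (-1) (cB i))).
  by congr (gstft2 _ z); apply/funext => t; ring.
have lim_le (e : R) : 0 < e -> exists m : nat, forall i : nat,
    (m <= i)%N -> (S0_norm (fun t => u i t - f t)%R <= e%:E)%E.
  move=> /cu[m um]; exists m => i mi; rewrite (S0_norm_leb2 (cB i)).
  apply: (norm1_fatou (F := fun j => gstft2 (fun t => u i t - u (m + j)%N t))).
  - by move=> j; apply: cmeasurable_gstft2; exact: S0_Cb (sB i _).
  - by move=> z; exact: (ccvg_shift m (gu i z)).
  - by move=> j; rewrite -(S0_norm_leb2 (S0_Cb (sB i _))); apply: um => //; exact: leq_addr.
exists f => //; apply/S0P; split=> //; have [m /(_ m (leqnn m)) um] := lim_le 1 ltr01.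
have -> : f = fun t => u m t + -1 * (u m t - f t) by apply/funext => t; ring.
have sBm : S0 (fun t => u m t - f t) by apply/S0P; split => //; apply: le_lt_trans um _; rewrite ltry.
by have /S0P[] := S0D (su m) (S0Z (-1) sBm).
Qed.

End S0_banach.

Section S0_banach_algebra.
Context {R : realType} {n : nat}.
Local Notation fun_space := ('rV[R]_n -> R[i]^o).
Local Notation S0 := (@S0 R n).
Local Notation S0_norm := (@S0_norm R n).

Lemma S0_is_banach_space : @is_banach_space R fun_space S0 S0_norm.
Proof.
apply: is_banach_subspace.
- exact: S0_0.
- by move=> a f g sf sg; exact: (S0D (S0Z a sf) sg).
- exact: S0_norm_fin_num.
- by move=> f g /S0_Cb cf /S0_Cb cg; exact: (S0_normD cf cg).
- by move=> a f /S0_Cb cf; exact: (S0_normZ a cf).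
- move=> f /S0_Cb cf f0; apply/funext => t; apply: (@Normc.eq0_normc R).
  apply/eqP; rewrite eq_le normc_ge0 andbT.
  by have := normc_le_S0_norm t cf; rewrite f0 lee_fin.
- exact: S0_complete.
Qed.

Lemma S0_convolution_algebra :
  @is_banach_algebra R fun_space S0 S0_norm (@convolution R n).
Proof.
split.
- exact: S0_is_banach_space.
- exact: S0_convolution.
- exact: convolutionA.
- move=> a f g h sf sg sh; split; first exact: (convolutionDl a sf sg sh).
  exact: (convolutionDr a sf sg sh).
- exact: S0_norm_convolution.
Qed.

Lemma S0_pointwise_algebra :
  @is_banach_algebra R fun_space S0 S0_norm (@pointwise_mul R n).
Proof.
split.
- exact: S0_is_banach_space.
- exact: S0_mul.
- by move=> f g h _ _ _; apply/funext => t; exact: mulrA.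
- move=> a f g h _ _ _; split; apply/funext => t.
    by rewrite /pointwise_mul/= mulrDl -mulrA.
  by rewrite /pointwise_mul/= mulrDr mulrCA.
- exact: S0_norm_mul.
Qed.

End S0_banach_algebra.

Theorem theorem7p2 (R : realType) (d : nat) :
  [/\ @is_banach_space R ('rV[R]_d -> R[i]^o) (@S0 R d) (@S0_norm R d),
      forall f : 'rV[R]_d -> R[i], S0 f ->
        S0 (fourier f) /\ S0_norm (fourier f) = S0_norm f,
      forall (f : 'rV[R]_d -> R[i]) (x w : 'rV[R]_d), S0 f ->
        S0 (modulation w (translation x f)) /\
        S0_norm (modulation w (translation x f)) = S0_norm f,
      @is_banach_algebra R ('rV[R]_d -> R[i]^o) (@S0 R d) (@S0_norm R d)
        (@convolution R d) &
      @is_banach_algebra R ('rV[R]_d -> R[i]^o) (@S0 R d) (@S0_norm R d)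
        (@pointwise_mul R d)].
Proof.
split.
- exact: S0_is_banach_space.
- exact: S0_fourier.
- exact: S0_modulation_translation.
- exact: S0_convolution_algebra.
- exact: S0_pointwise_algebra.
Qed.
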